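(* Let $w$ be an element of $W=S_{n+1}$, the Weyl group of type $A_n$, and let $\Pi$ be the preprojective algebra of type $A_n$ over a field $k$. Take $(i,j)\in\operatorname{BInv}(w)$, let $e$ denote the edge of the Bruhat inversion graph $G_w$ corresponding to $(i,j)$, and let $B_e$ be the $\Pi$-module constructed from $e$. Then $B_e$ is the unique simple object (up to isomorphism) in $\mathcal{F}(w)$ with $\underline{\dim}\,B_e=\beta_{(i,j)}$.
   Context: Setting: $Q$ is a quiver with underlying graph the Dynkin diagram $1 - 2 - \cdots - n$ of type $A_n$. $\Phi=\{\varepsilon_a-\varepsilon_b : 1\le a\neq b\le n+1\}\subset\mathbb{R}^{n+1}$, simple roots $\alpha_a=\varepsilon_a-\varepsilon_{a+1}$, $\beta_{(a,b)}=\varepsilon_a-\varepsilon_b$. $W=S_{n+1}$ acts by $w(\varepsilon_a)=\varepsilon_{w(a)}$; $s_a$ is the simple reflection for $\alpha_a$. One-line notation: $w=w(1)w(2)\cdots w(n+1)$. $\operatorname{BInv}(w)$ is the set of pairs $(i,j)$, $1\le i<j\le n+1$, such that in the one-line notation for $w$ the letter $j$ appears to the left of $i$ and there is no $m$ with $i<m<j$ appearing between $j$ and $i$. Bruhat inversion graph $G_w$: in an $(n+1)\times(n+1)$ array of boxes (rows numbered from top to bottom, columns from left to right), put a dot in box $(r,w(r))$ (row $r$, column $w(r)$) for each $r$, and join the dots $(w^{-1}(i),i)$ and $(w^{-1}(j),j)$ by a segment for each $(i,j)\in\operatorname{BInv}(w)$. Edges of $G_w$ thus correspond bijectively to elements of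 $\operatorname{BInv}(w)$. Preprojective algebra: $\overline{Q}$ is the double quiver, with arrows $a\to a+1$ and $a+1\to a$ for $1\le a<n$; $\Pi=k\overline{Q}/(\sum_{a\in Q_1}(aa^*-a^*a))$, where $a^*$ is the arrow reverse to $a$. $\operatorname{mod}\Pi$ denotes finitely generated right $\Pi$-modules, identified with representations of $\overline{Q}$ satisfying the relations (paths are composed left to right). $\underline{\dim}\,M=\sum_a m_a\alpha_a$, where $m_a$ is the dimension of $M$ at vertex $a$. Construction of $B_e$: keep only the edge $e$ of $G_w$ corresponding to $(i,j)$, and move all dots vertically to one horizontal line, letting $e$ curve but not pass through any dot (arc diagram). Draw vertical lines $1,\dots,n$ between adjacent dots, line $a$ lying between the dots of columns $a$ and $a+1$. The subquiver $Q(e)$ of $\overline{Q}$ has as vertices those $a$ such that $e$ meets line $a$; and for $a,a+1\in Q(e)_0$, it has the arrow $a\to a+1$ if the part of $e$ between lines $a$ and $a+1$ passes above the dot lying between these lines, and the arrow $a\leftarrow a+1$ if it passes below. Explicitly: $Q(e)_0=\{i,i+1,\dots,j-1\}$, and for each $m$ with $i<m<j$, $Q(e)$ has the arrow $m-1\to m$ if the letter $m$ appears to the right of $i$ in the one-line notation for $w$, and the arrow $m-1\leftarrow m$ if $m$ appears to the left of $j$. As a representation of $\overline{Q}$, $B_e$ has $k$ at each vertex of $Q(e)$ and $0$ at other vertices, the identity map for each arrow of $Q(e)$, and the zero map for all other arrows of $\overline{Q}$; it is a $\Pi$-module. Torsion-free class $\mathcal{F}(w)$: let $I_a$ be the two-sided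 ideal of $\Pi$ generated by $1-e_a$, with $e_a$ the idempotent at vertex $a$; for a reduced expression $w=s_{u_1}\cdots s_{u_l}$ put $I(w)=I_{u_l}I_{u_{l-1}}\cdots I_{u_1}$ (independent of the expression). $\mathcal{F}(w)$ is the category $\operatorname{Sub}(\Pi/I(w))$ of modules embedding into a finite direct sum of direct summands of $\Pi/I(w)$; it is closed under submodules and extensions. A nonzero $M\in\mathcal{F}(w)$ is a simple object in $\mathcal{F}(w)$ if there is no submodule $L$ of $M$ with $0\neq L\neq M$ and $L,M/L\in\mathcal{F}(w)$. *)

(* Defs.v *)
From HB Require Import structures.
From mathcomp Require Import all_boot all_order all_algebra all_fingroup.
From mathcomp Require Import generic_quotient ring_quotient finmap boolp.
From mathcomp Require Import monalg zify.

Set Implicit Arguments.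
Unset Strict Implicit.
Unset Printing Implicit Defensive.

Import GRing.Theory.
Local Open Scope ring_scope.
Local Open Scope quotient_scope.

(* Quotients by two-sided ideals and by submodules                          *)

Section GeneratedIdeal.
Variables (R : pzRingType) (S : R -> Prop).

Definition ideal_gen : {pred R} := fun x =>
  `[< exists m (a s b : 'I_m -> R),
        (forall t, S (s t)) /\ x = \sum_t a t * s t * b t >].

Lemma ideal_genP x : reflect (exists m (a s b : 'I_m -> R),
  (forall t, S (s t)) /\ x = \sum_t a t * s t * b t) (x \in ideal_gen).
Proof. exact: asboolP. Qed.

Lemma ideal_gen_zmod : zmod_closed ideal_gen.
Proof.
split; first by apply/ideal_genP; exists 0%N, (fun=> 0), (fun=> 0), (fun=> 0);
  split=> [[]|] //; rewrite big_ord0.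
move=> x y /ideal_genP[m [a [s [b [Ss ->]]]]] /ideal_genP[m' [a' [s' [b' [Ss' ->]]]]].
pose h (T : Type) (f : 'I_m -> T) (g : 'I_m' -> T) (t : 'I_(m + m')) :=
  match split t with inl u => f u | inr u => g u end.
apply/ideal_genP; exists (m + m')%N, (h _ a (fun u => - a' u)), (h _ s s'), (h _ b b').
split=> [t|]; first by rewrite /h; case: split.
rewrite big_split_ord /= -sumrN; congr (_ + _); apply: eq_bigr => t _.
  by rewrite /h (unsplitK (inl t)).
by rewrite /h (unsplitK (inr t)) !mulNr.
Qed.

HB.instance Definition _ := GRing.isZmodClosed.Build R ideal_gen ideal_gen_zmod.

Lemma ideal_genMl x y : y \in ideal_gen -> x * y \in ideal_gen.
Proof.
move=> /ideal_genP[m [a [s [b [Ss ->]]]]]; apply/ideal_genP.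
exists m, (fun t => x * a t), s, b; split=> //.
by rewrite mulr_sumr; apply: eq_bigr => t _; rewrite !mulrA.
Qed.

Lemma ideal_genMr x y : x \in ideal_gen -> x * y \in ideal_gen.
Proof.
move=> /ideal_genP[m [a [s [b [Ss ->]]]]]; apply/ideal_genP.
exists m, a, s, (fun t => b t * y); split=> //.
by rewrite mulr_suml; apply: eq_bigr => t _; rewrite !mulrA.
Qed.

Definition ring_quot : Type := Quotient.quot ideal_gen.
HB.instance Definition _ := GRing.Zmodule.on ring_quot.

Definition to_quot (x : R) : ring_quot := \pi_(Quotient.quot ideal_gen) x.

Lemma to_quot_repr (x : ring_quot) : to_quot (repr (x : Quotient.quot ideal_gen)) = x.
Proof. exact: reprK. Qed.

Lemma to_quotP x y : reflect (to_quot x = to_quot y) (x - y \in ideal_gen).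
Proof. by rewrite Quotient.idealrBE; apply: eqP. Qed.

Lemma to_quotB : {morph to_quot : x y / x - y}.
Proof. exact: (raddfB (\pi_(Quotient.quot ideal_gen))). Qed.
HB.instance Definition _ := GRing.isZmodMorphism.Build R ring_quot to_quot to_quotB.

Let rep (x : ring_quot) : R := repr (x : Quotient.quot ideal_gen).
Definition ring_quot_one : ring_quot := to_quot 1.
Definition ring_quot_mul (x y : ring_quot) : ring_quot := to_quot (rep x * rep y).

Lemma to_quotM x y : to_quot (x * y) = ring_quot_mul (to_quot x) (to_quot y).
Proof.
apply/to_quotP; set x' := rep (to_quot x); set y' := rep (to_quot y).
have hx : x - x' \in ideal_gen by apply/to_quotP; rewrite to_quot_repr.
have hy : y - y' \in ideal_gen by apply/to_quotP; rewrite to_quot_repr.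
have -> : x * y - x' * y' = (x - x') * y + x' * (y - y').
  by rewrite mulrBl mulrBr addrA subrK.
have hD := @rpredD _ (ideal_gen : zmodClosed R).
by apply: hD; [apply: ideal_genMr | apply: ideal_genMl].
Qed.

Fact ring_quot_mulA : associative ring_quot_mul.
Proof.
move=> x y z; rewrite -[x]to_quot_repr -[y]to_quot_repr -[z]to_quot_repr.
by rewrite -!to_quotM mulrA.
Qed.
Fact ring_quot_mul1 : left_id ring_quot_one ring_quot_mul.
Proof. by move=> x; rewrite -[x]to_quot_repr -to_quotM mul1r. Qed.
Fact ring_quot_mulr1 : right_id ring_quot_one ring_quot_mul.
Proof. by move=> x; rewrite -[x]to_quot_repr -to_quotM mulr1. Qed.
Fact ring_quot_mulDl : left_distributive ring_quot_mul +%R.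
Proof.
move=> x y z; rewrite -[x]to_quot_repr -[y]to_quot_repr -[z]to_quot_repr.
by rewrite -raddfD -!to_quotM -raddfD mulrDl.
Qed.
Fact ring_quot_mulDr : right_distributive ring_quot_mul +%R.
Proof.
move=> x y z; rewrite -[x]to_quot_repr -[y]to_quot_repr -[z]to_quot_repr.
by rewrite -raddfD -!to_quotM -raddfD mulrDr.
Qed.

HB.instance Definition _ := GRing.Zmodule_isPzRing.Build ring_quot
  ring_quot_mulA ring_quot_mul1 ring_quot_mulr1 ring_quot_mulDl ring_quot_mulDr.

Lemma to_quot_monoid : monoid_morphism to_quot.
Proof. by split=> // x y; rewrite to_quotM. Qed.
HB.instance Definition _ :=
  GRing.isMonoidMorphism.Build R ring_quot to_quot to_quot_monoid.

Section Lift.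
Variables (T : pzRingType) (f : {rmorphism R -> T}).
Hypothesis fS : forall s, S s -> f s = 0.

Definition quot_lift of (forall s, S s -> f s = 0) :=
  fun x : ring_quot => f (repr (x : Quotient.quot ideal_gen)).

Lemma quot_liftE x : quot_lift fS (to_quot x) = f x.
Proof.
have /ideal_genP[m [a [s [b [Ss e]]]]] :
    repr (to_quot x : Quotient.quot ideal_gen) - x \in ideal_gen.
  by apply/to_quotP; rewrite to_quot_repr.
apply/eqP; rewrite -subr_eq0 -rmorphB e rmorph_sum big1 // => t _.
by rewrite !rmorphM (fS (Ss t)) mulr0 mul0r.
Qed.

Fact quot_lift_zmod : zmod_morphism (quot_lift fS).
Proof.
move=> x y; rewrite -[x]to_quot_repr -[y]to_quot_repr.
by rewrite -raddfB !quot_liftE raddfB.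
Qed.
HB.instance Definition _ :=
  GRing.isZmodMorphism.Build ring_quot T (quot_lift fS) quot_lift_zmod.

Fact quot_lift_monoid : monoid_morphism (quot_lift fS).
Proof.
split; first by rewrite -(rmorph1 to_quot) quot_liftE rmorph1.
move=> x y; rewrite -[x]to_quot_repr -[y]to_quot_repr.
by rewrite -rmorphM !quot_liftE rmorphM.
Qed.
HB.instance Definition _ :=
  GRing.isMonoidMorphism.Build ring_quot T (quot_lift fS) quot_lift_monoid.
End Lift.

End GeneratedIdeal.

Section SubQuotientModules.
Variables (R : pzRingType) (M : lmodType R) (L : submodClosed M).

Record submodule : predArgType :=
  Submodule { submodule_val : M; _ : submodule_val \in L }.
HB.instance Definition _ := [isSub for submodule_val].
HB.instance Definition _ := [Choice of submodule by <:].
HB.instance Definition _ := [SubChoice_isSubLmodule of submodule by <:].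

Definition submod_pred : {pred M} := fun x => x \in L.
Fact submod_pred_zmod : zmod_closed submod_pred.
Proof.
split=> [|x y Lx Ly]; first exact: (rpred0 L).
by rewrite /submod_pred unfold_in -scaleN1r; apply: rpredD => //; apply: rpredZ.
Qed.
HB.instance Definition _ := GRing.isZmodClosed.Build M submod_pred submod_pred_zmod.

Definition mod_quot : Type := Quotient.quot submod_pred.
HB.instance Definition _ := GRing.Zmodule.on mod_quot.

Definition to_mquot (x : M) : mod_quot := \pi_(Quotient.quot submod_pred) x.

Lemma to_mquot_repr (x : mod_quot) : to_mquot (repr (x : Quotient.quot submod_pred)) = x.
Proof. exact: reprK. Qed.

Lemma to_mquotP x y : reflect (to_mquot x = to_mquot y) (x - y \in L).
Proof. by rewrite -[_ \in L]/(x - y \in submod_pred) Quotient.idealrBE; apply: eqP. Qed.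

Lemma to_mquotB : {morph to_mquot : x y / x - y}.
Proof. exact: (raddfB (\pi_(Quotient.quot submod_pred))). Qed.
HB.instance Definition _ := GRing.isZmodMorphism.Build M mod_quot to_mquot to_mquotB.

Definition mod_quot_scale (a : R) (x : mod_quot) : mod_quot :=
  to_mquot (a *: repr (x : Quotient.quot submod_pred)).

Lemma to_mquotZ a x : to_mquot (a *: x) = mod_quot_scale a (to_mquot x).
Proof.
apply/to_mquotP; rewrite -scalerBr; apply: rpredZ; apply/to_mquotP.
by rewrite to_mquot_repr.
Qed.

Fact mod_quot_scaleA a b v :
  mod_quot_scale a (mod_quot_scale b v) = mod_quot_scale (a * b) v.
Proof. by rewrite -[v]to_mquot_repr -!to_mquotZ scalerA. Qed.
Fact mod_quot_scale1 : left_id 1 mod_quot_scale.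
Proof. by move=> v; rewrite -[v]to_mquot_repr -to_mquotZ scale1r. Qed.
Fact mod_quot_scaleDr : right_distributive mod_quot_scale +%R.
Proof.
move=> a u v; rewrite -[u]to_mquot_repr -[v]to_mquot_repr.
by rewrite -raddfD -!to_mquotZ -raddfD scalerDr.
Qed.
Fact mod_quot_scaleDl v : {morph mod_quot_scale^~ v : a b / a + b}.
Proof.
by move=> a b; rewrite -[v]to_mquot_repr -!to_mquotZ -raddfD scalerDl.
Qed.
HB.instance Definition _ := GRing.Zmodule_isLmodule.Build R mod_quot
  mod_quot_scaleA mod_quot_scale1 mod_quot_scaleDr mod_quot_scaleDl.

End SubQuotientModules.

Section DirectSum.
Variables (R : pzRingType) (I : finType) (X : I -> lmodType R).

Definition dsum : Type := {dffun forall t : I, X t}.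
HB.instance Definition _ := Choice.on dsum.
Implicit Types f g h : dsum.

Definition dsum_zero : dsum := [ffun t => 0 : X t].
Definition dsum_opp f : dsum := [ffun t => - f t].
Definition dsum_add f g : dsum := [ffun t => f t + g t].
Definition dsum_scale a f : dsum := [ffun t => a *: f t].

Fact dsum_addA : associative dsum_add.
Proof. by move=> f g h; apply/ffunP=> t; rewrite !ffunE addrA. Qed.
Fact dsum_addC : commutative dsum_add.
Proof. by move=> f g; apply/ffunP=> t; rewrite !ffunE addrC. Qed.
Fact dsum_add0 : left_id dsum_zero dsum_add.
Proof. by move=> f; apply/ffunP=> t; rewrite !ffunE add0r. Qed.
Fact dsum_addN : left_inverse dsum_zero dsum_opp dsum_add.
Proof. by move=> f; apply/ffunP=> t; rewrite !ffunE addNr. Qed.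
HB.instance Definition _ :=
  GRing.isZmodule.Build dsum dsum_addA dsum_addC dsum_add0 dsum_addN.

Fact dsum_scaleA a b f : dsum_scale a (dsum_scale b f) = dsum_scale (a * b) f.
Proof. by apply/ffunP=> t; rewrite !ffunE scalerA. Qed.
Fact dsum_scale1 : left_id 1 dsum_scale.
Proof. by move=> f; apply/ffunP=> t; rewrite !ffunE scale1r. Qed.
Fact dsum_scaleDr : right_distributive dsum_scale +%R.
Proof. by move=> a f g; apply/ffunP=> t; rewrite !ffunE scalerDr. Qed.
Fact dsum_scaleDl f : {morph dsum_scale^~ f : a b / a + b}.
Proof. by move=> a b; apply/ffunP=> t; rewrite !ffunE scalerDl. Qed.
HB.instance Definition _ := GRing.Zmodule_isLmodule.Build R dsum
  dsum_scaleA dsum_scale1 dsum_scaleDr dsum_scaleDl.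
End DirectSum.

Record quiver := Quiver {
  vertex : finType;
  arrow : finType;
  src : arrow -> vertex;
  tgt : arrow -> vertex }.

Section Paths.
Variable Q : quiver.

Fixpoint walk (a : vertex Q) (s : seq (arrow Q)) : bool :=
  if s is x :: s' then (src x == a) && walk (tgt x) s' else true.

Fixpoint walk_end (a : vertex Q) (s : seq (arrow Q)) : vertex Q :=
  if s is x :: s' then walk_end (tgt x) s' else a.

Record qpath : predArgType := QPath {
  qpath_val : vertex Q * seq (arrow Q);
  _ : walk qpath_val.1 qpath_val.2 }.
HB.instance Definition _ := [isSub for qpath_val].
HB.instance Definition _ := [Choice of qpath by <:].

Definition psrc (p : qpath) : vertex Q := (val p).1.
Definition parrows (p : qpath) : seq (arrow Q) := (val p).2.
Definition ptgt (p : qpath) : vertex Q := walk_end (psrc p) (parrows p).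

Definition lazy_path (a : vertex Q) : qpath := @QPath (a, [::]) isT.

Fact arrow_path_subproof (x : arrow Q) : walk (src x) [:: x].
Proof. by rewrite /= eqxx. Qed.
Definition arrow_path (x : arrow Q) : qpath :=
  @QPath (src x, [:: x]) (arrow_path_subproof x).

Lemma walk_cat a s t : walk a (s ++ t) = walk a s && walk (walk_end a s) t.
Proof. by elim: s a => //= x s IH a; rewrite IH andbA. Qed.
Lemma walk_end_cat a s t : walk_end a (s ++ t) = walk_end (walk_end a s) t.
Proof. by elim: s a => //=. Qed.

(* Paths are composed from left to right; None when they do not compose. *)
Definition pcomp (p q : qpath) : option qpath :=
  if ptgt p == psrc q then insub (psrc p, parrows p ++ parrows q) else None.

Lemma pcompE p q r : pcomp p q = Some r ->
  [/\ ptgt p = psrc q, psrc r = psrc p & parrows r = parrows p ++ parrows q].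
Proof.
by rewrite /pcomp; case: eqP => // e; case: insubP => // r' _ e' [<-];
  rewrite /psrc /parrows e'.
Qed.

Lemma pcomp_ex p q : ptgt p = psrc q -> exists r, pcomp p q = Some r.
Proof.
move=> e; rewrite /pcomp e eqxx; case: insubP => [r|]; first by exists r.
by rewrite /= walk_cat (valP p) [walk_end _ _]e (valP q).
Qed.

Lemma pcomp_none p q : ptgt p <> psrc q -> pcomp p q = None.
Proof. by rewrite /pcomp => /eqP/negbTE->. Qed.

Lemma qpath_eq p q : psrc p = psrc q -> parrows p = parrows q -> p = q.
Proof.
move=> e1 e2; apply: val_inj; move: e1 e2; rewrite /psrc /parrows.
by case: (val p) (val q) => [? ?] [? ?] /= -> ->.
Qed.

Lemma pcomp_src p q r : pcomp p q = Some r -> psrc r = psrc p.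
Proof. by case/pcompE. Qed.

Lemma pcomp_tgt p q r : pcomp p q = Some r -> ptgt r = ptgt q.
Proof.
by case/pcompE=> e1 e2 e3; rewrite /ptgt e2 e3 walk_end_cat -e1.
Qed.

Lemma pcompA p q r :
  obind (fun x => pcomp x r) (pcomp p q) = obind (pcomp p) (pcomp q r).
Proof.
have [e1|n1] := eqVneq (ptgt p) (psrc q); last first.
  rewrite (pcomp_none (elimN eqP n1)) /=.
  case e: (pcomp q r) => [x|] //=; rewrite pcomp_none //.
  by rewrite (pcomp_src e); apply/eqP.
have [pq epq] := pcomp_ex e1; rewrite epq /=.
have [e2|n2] := eqVneq (ptgt q) (psrc r); last first.
  rewrite (pcomp_none (elimN eqP n2)) /= pcomp_none //.
  by rewrite (pcomp_tgt epq); apply/eqP.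
have [qr eqr] := pcomp_ex e2; rewrite eqr /=.
have [x ex] : exists x, pcomp pq r = Some x.
  by apply: pcomp_ex; rewrite (pcomp_tgt epq).
have [y ey] : exists y, pcomp p qr = Some y.
  by apply: pcomp_ex; rewrite (pcomp_src eqr).
rewrite ex ey; congr Some; move: epq eqr ex ey.
move=> /pcompE[_ s1 a1] /pcompE[_ s2 a2] /pcompE[_ s3 a3] /pcompE[_ s4 a4].
by apply: qpath_eq; rewrite ?s3 ?s1 ?s4 // a3 a1 a4 a2 catA.
Qed.

Lemma pcomp_lazyl a q : pcomp (lazy_path a) q = if a == psrc q then Some q else None.
Proof.
have [e|n] := eqVneq a (psrc q); last by apply: pcomp_none; apply/eqP.
have [r er] := @pcomp_ex (lazy_path a) q e; rewrite er; congr Some.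
by case/pcompE: er => _ es ea; apply: qpath_eq; rewrite ?es ?ea.
Qed.

Lemma pcomp_lazyr p a : pcomp p (lazy_path a) = if ptgt p == a then Some p else None.
Proof.
have [e|n] := eqVneq (ptgt p) a; last by apply: pcomp_none; apply/eqP.
have [r er] := @pcomp_ex p (lazy_path a) e; rewrite er; congr Some.
by case/pcompE: er => _ es ea; apply: qpath_eq; rewrite ?es ?ea ?cats0.
Qed.

End Paths.

Section LinearExtension.
Variables (k : fieldType) (K : choiceType) (V : lmodType k) (h : K -> V).

Definition lin_ext (x : {malg k[K]}) : V := \sum_(p <- msupp x) x@_p *: h p.

Lemma lin_extE (d : {fset K}) x : (msupp x `<=` d)%fset ->
  lin_ext x = \sum_(p <- d) x@_p *: h p.
Proof.
move=> sub; rewrite /lin_ext (big_fset_incl _ sub) // => p _ n.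
by rewrite mcoeff_outdom // scale0r.
Qed.

Fact lin_ext_linear : linear lin_ext.
Proof.
move=> a x y.
pose d := (msupp x `|` msupp y `|` msupp (a *: x + y))%fset.
have sx : (msupp x `<=` d)%fset by rewrite /d -fsetUA fsubsetUl.
have sy : (msupp y `<=` d)%fset by rewrite /d fsetUAC fsubsetUr.
have sz : (msupp (a *: x + y) `<=` d)%fset by rewrite /d fsubsetUr.
rewrite (lin_extE sx) (lin_extE sy) (lin_extE sz) scaler_sumr -big_split /=.
by apply: eq_bigr => p _; rewrite mcoeffD mcoeffZ scalerDl scalerA.
Qed.
HB.instance Definition _ :=
  GRing.isLinear.Build k {malg k[K]} V _ lin_ext lin_ext_linear.

Lemma lin_extU p : lin_ext << p >> = h p.
Proof.
by rewrite (@lin_extE [fset p]%fset) ?msuppU_le // big_seq_fset1 mcoeffUU scale1r.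
Qed.
End LinearExtension.

Lemma lin_ext_uniq (k : fieldType) (K : choiceType) (V : lmodType k)
  (f g : {linear {malg k[K]} -> V}) : (forall p, f << p >> = g << p >>) -> f =1 g.
Proof.
move=> e x; rewrite [x]monalgE !linear_sum; apply: eq_bigr => p _.
have -> : << x@_p *g p >> = x@_p *: << p >> :> {malg k[K]}.
  by apply/malgP => q; rewrite mcoeffZ !mcoeffU mulrnAr mulr1.
by rewrite !linearZZ e.
Qed.

Section PathAlgebraDef.
Variables (k : fieldType) (Q : quiver).
Definition path_algebra : Type := {malg k[qpath Q]}.
HB.instance Definition _ := GRing.Lmodule.on path_algebra.
End PathAlgebraDef.

HB.lock Definition pbasis (k : fieldType) (Q : quiver) (p : qpath Q) :
  path_algebra k Q := << p >>.
Canonical pbasis_unlockable := Unlockable pbasis.unlock.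

Definition pbasis_mul (k : fieldType) (Q : quiver) (p q : qpath Q) :
    path_algebra k Q :=
  if pcomp p q is Some r then pbasis k r else 0.

HB.lock Definition path_mul (k : fieldType) (Q : quiver)
    (x y : path_algebra k Q) : path_algebra k Q :=
  lin_ext (fun p => lin_ext (fun q => pbasis_mul k p q) y) x.
Canonical path_mul_unlockable := Unlockable path_mul.unlock.

Section PathAlgebraTheory.
Variables (k : fieldType) (Q : quiver).
Local Notation path_algebra := (path_algebra k Q).
Local Notation pbasis := (@pbasis k Q).
Local Notation pbasis_mul := (@pbasis_mul k Q).
Local Notation path_mul := (@path_mul k Q).

Definition path_one : path_algebra := \sum_a pbasis (lazy_path a).

Fact path_mull_linear y : linear (path_mul^~ y).
Proof. by move=> a x x'; rewrite path_mul.unlock linearP. Qed.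
Fact path_mulr_linear x : linear (path_mul x).
Proof.
move=> a y y'; rewrite path_mul.unlock /lin_ext scaler_sumr -big_split /=.
apply: eq_bigr => p _; rewrite -!/(lin_ext _ _) linearP scalerDr.
by rewrite !scalerA [_ * a]mulrC.
Qed.
Definition path_mull y : path_algebra -> path_algebra := path_mul^~ y.
HB.instance Definition _ y := GRing.isLinear.Build k path_algebra path_algebra _
  (path_mull y) (path_mull_linear y).
HB.instance Definition _ x := GRing.isLinear.Build k path_algebra path_algebra _
  (path_mul x) (path_mulr_linear x).

Lemma path_mulE p q : path_mul (pbasis p) (pbasis q) = pbasis_mul p q.
Proof. by rewrite path_mul.unlock pbasis.unlock !lin_extU. Qed.

Lemma path_ind (f g : {linear path_algebra -> path_algebra}) :
  (forall p, f (pbasis p) = g (pbasis p)) -> f =1 g.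
Proof. by rewrite pbasis.unlock; apply: lin_ext_uniq. Qed.

Fact path_mulDl : left_distributive path_mul +%R.
Proof. by move=> x y z; rewrite -!/(path_mull _ _) raddfD. Qed.
Fact path_mulDr : right_distributive path_mul +%R.
Proof. by move=> x y z; rewrite raddfD. Qed.

Fact path_mulA : associative path_mul.
Proof.
move=> x y z.
apply: (path_ind (f := path_mull (path_mul y z)) (g := path_mull z \o path_mull y)) => p.
rewrite /path_mull /=.
apply: (path_ind (f := path_mul (pbasis p) \o path_mull z)
                 (g := path_mull z \o path_mul (pbasis p))) => q.
rewrite /path_mull /=.
apply: (path_ind (f := path_mul (pbasis p) \o path_mul (pbasis q))
                 (g := path_mul (path_mul (pbasis p) (pbasis q)))) => r /=.
rewrite !path_mulE; have := pcompA p q r; rewrite /pbasis_mul.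
case: (pcomp p q) => [pq|]; case: (pcomp q r) => [qr|] /= e.
- by rewrite !path_mulE /pbasis_mul e.
- by rewrite path_mulE /pbasis_mul e linear0.
- by rewrite path_mulE /pbasis_mul -e -/(path_mull _ _) linear0.
- by rewrite linear0 -/(path_mull _ _) linear0.
Qed.

Fact path_mul1 : left_id path_one path_mul.
Proof.
move=> x; rewrite -/(path_mull _ _).
apply: (path_ind (f := path_mul path_one) (g := idfun)) => p /=.
rewrite -/(path_mull _ _) /path_one linear_sum /= (bigD1 (psrc p)) //= big1.
  by rewrite addr0 /path_mull path_mulE /pbasis_mul pcomp_lazyl eqxx.
by move=> a n; rewrite /path_mull path_mulE /pbasis_mul pcomp_lazyl (negbTE n).
Qed.

Fact path_mulr1 : right_id path_one path_mul.
Proof.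
move=> x; apply: (path_ind (f := path_mull path_one) (g := idfun)) => p /=.
rewrite /path_mull /path_one linear_sum /= (bigD1 (ptgt p)) //= big1.
  by rewrite addr0 path_mulE /pbasis_mul pcomp_lazyr eqxx.
by move=> a n; rewrite path_mulE /pbasis_mul pcomp_lazyr eq_sym (negbTE n).
Qed.

HB.instance Definition _ := GRing.Zmodule_isPzRing.Build path_algebra
  path_mulA path_mul1 path_mulr1 path_mulDl path_mulDr.

Lemma path_algebra_mulE (x y : path_algebra) : x * y = path_mul x y.
Proof. by []. Qed.

End PathAlgebraTheory.

Section MatrixRepresentation.
Variables (k : fieldType) (Q : quiver) (N : nat).
Variables (vm : vertex Q -> 'M[k]_N) (am : arrow Q -> 'M[k]_N).

Definition path_mx (p : qpath Q) : 'M[k]_N :=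
  foldl (fun A x => A *m am x) (vm (psrc p)) (parrows p).

Definition path_rep : path_algebra k Q -> 'M[k]_N := lin_ext path_mx.

(* vm and am make k^N (row vectors) a representation of Q when the vm a are
   the projections of a direct sum decomposition, with summand V_a at the
   vertex a, and am x maps V_(src x) to V_(tgt x), killing the other V_a. *)
Definition is_rep : Prop :=
  [/\ forall a b, vm a *m vm b = if a == b then vm a else 0,
      \sum_a vm a = 1%:M,
      forall x, vm (src x) *m am x = am x
    & forall x, am x *m vm (tgt x) = am x].

Hypothesis rep : is_rep.

Lemma path_mx_foldl (A : 'M[k]_N) s :
  foldl (fun (A : 'M[k]_N) x => A *m am x) A s = A *m foldl (fun (A : 'M[k]_N) x => A *m am x) (1%:M : 'M[k]_N) s.
Proof.
elim: s A => [|x s IH] A /=; first by rewrite mulmx1.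
by rewrite IH [in RHS]IH mul1mx mulmxA.
Qed.

Lemma path_mx_tgt p : path_mx p *m vm (ptgt p) = path_mx p.
Proof.
case: rep => [vv _ _ at_]; rewrite /path_mx /ptgt.
have: vm (psrc p) *m vm (psrc p) = vm (psrc p) by rewrite vv eqxx.
move: {1 3 4 5}(vm (psrc p)) => A; elim: (parrows p) (psrc p) A => //= x s IH a A eA.
by apply: IH; rewrite -mulmxA at_.
Qed.

Lemma path_mxM p q :
  path_mx p *m path_mx q = if pcomp p q is Some r then path_mx r else 0.
Proof.
case: (rep) => [vv _ va _].
have qE : path_mx q = vm (psrc q) *m path_mx q.
  by rewrite /path_mx path_mx_foldl mulmxA vv eqxx.
have [e|n] := eqVneq (ptgt p) (psrc q); last first.
  rewrite pcomp_none; last exact/eqP.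
  by rewrite -(path_mx_tgt p) qE mulmxA -(mulmxA (path_mx p)) vv (negbTE n) mulmx0 mul0mx.
have [r er] := pcomp_ex e; rewrite er; case/pcompE: er => _ e1 e2.
rewrite [path_mx r]/path_mx e1 e2 foldl_cat -/(path_mx p) path_mx_foldl.
by rewrite [path_mx q]path_mx_foldl mulmxA -e path_mx_tgt.
Qed.

Fact path_rep_zmod : zmod_morphism path_rep.
Proof. exact: raddfB. Qed.

Fact path_rep_monoid : monoid_morphism path_rep.
Proof.
case: (rep) => [_ vs _ _]; split.
  transitivity (\sum_a vm a); last exact: vs.
  rewrite [LHS](_ : _ = lin_ext path_mx (path_one k Q)) // /path_one linear_sum.
  by apply: eq_bigr => a _; rewrite pbasis.unlock; apply: lin_extU.
move=> x y; rewrite path_algebra_mulE [RHS]/(path_rep x *m path_rep y).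
rewrite /path_rep path_mul.unlock.
rewrite [X in lin_ext _ X]/lin_ext [X in _ = X *m _]/lin_ext.
rewrite linear_sum mulmx_suml /=; apply: eq_bigr => p _.
rewrite linearZ /= -scalemxAl; congr (_ *: _).
rewrite [X in lin_ext _ X]/lin_ext [X in _ = _ *m X]/lin_ext.
rewrite linear_sum mulmx_sumr /=; apply: eq_bigr => q _.
rewrite linearZ /= -scalemxAr; congr (_ *: _).
rewrite path_mxM /pbasis_mul; case: (pcomp p q) => [r|]; last by rewrite linear0.
by rewrite pbasis.unlock; apply: lin_extU.
Qed.

End MatrixRepresentation.

Section RepHom.
Variables (k : fieldType) (Q : quiver) (N : nat).
Variables (vm : vertex Q -> 'M[k]_N) (am : arrow Q -> 'M[k]_N).
Variable rep : is_rep vm am.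

Definition rep_hom of is_rep vm am := path_rep vm am.
HB.instance Definition _ := GRing.isZmodMorphism.Build
  (path_algebra k Q) 'M[k]_N (rep_hom rep) (path_rep_zmod vm am).
HB.instance Definition _ := GRing.isMonoidMorphism.Build
  (path_algebra k Q) 'M[k]_N (rep_hom rep) (path_rep_monoid rep).

Lemma rep_hom_basis p : rep_hom rep (pbasis k p) = path_mx vm am p.
Proof. by rewrite pbasis.unlock; apply: lin_extU. Qed.
End RepHom.

(* A right R-module is a left module over the converse ring R^c:
   a *: v stands for v a.                                                   *)

Section RowModule.
Variables (k : fieldType) (R : pzRingType) (N : nat).

Definition row_module of {rmorphism R -> 'M[k]_N} : Type := 'rV[k]_N.
HB.instance Definition _ f := GRing.Zmodule.on (row_module f).

Variable f : {rmorphism R -> 'M[k]_N}.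

Definition row_scale (a : R^c) (v : row_module f) : row_module f := v *m f a.

Fact row_scaleA a b v : row_scale a (row_scale b v) = row_scale (a * b) v.
Proof. by rewrite /row_scale -mulmxA -[f b *m f a]/(f b * f a) -rmorphM. Qed.
Fact row_scale1 : left_id 1 row_scale.
Proof. by move=> v; rewrite /row_scale [f 1]rmorph1 [LHS]mulmx1. Qed.
Fact row_scaleDr : right_distributive row_scale +%R.
Proof. by move=> a u v; rewrite /row_scale mulmxDl. Qed.
Fact row_scaleDl v : {morph row_scale^~ v : a b / a + b}.
Proof. by move=> a b; rewrite /row_scale [f _]rmorphD mulmxDr. Qed.
HB.instance Definition _ := GRing.Zmodule_isLmodule.Build R^c (row_module f)
  row_scaleA row_scale1 row_scaleDr row_scaleDl.
End RowModule.

(* The thin representation of a subquiver (V, E): k at each vertex in V,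
   the identity along each arrow in E joining vertices in V, zero elsewhere.
   Its total space is k^V, enumerated by enum_val.                          *)
Section Thin.
Variables (k : fieldType) (Q : quiver).
Variables (V : {set vertex Q}) (E : {set arrow Q}).

Definition thin_vertex (a : vertex Q) : 'M[k]_#|V| :=
  \matrix_(s, t) ((s == t) && (enum_val s == a))%:R.
Definition thin_arrow (x : arrow Q) : 'M[k]_#|V| :=
  \matrix_(s, t) [&& x \in E, enum_val s == src x & enum_val t == tgt x]%:R.

Lemma thin_vertex_mull a (A : 'M[k]_#|V|) s t :
  (thin_vertex a *m A) s t = (enum_val s == a)%:R * A s t.
Proof.
rewrite mxE (bigD1 s) //= big1 ?addr0 => [|r n]; rewrite !mxE ?eqxx //.
by rewrite eq_sym (negbTE n) mul0r.
Qed.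
Lemma thin_vertex_mulr a (A : 'M[k]_#|V|) s t :
  (A *m thin_vertex a) s t = A s t * (enum_val t == a)%:R.
Proof.
rewrite mxE (bigD1 t) //= big1 ?addr0 => [|r n]; rewrite !mxE ?eqxx //.
by rewrite (negbTE n) mulr0.
Qed.

Lemma thin_is_rep : is_rep thin_vertex thin_arrow.
Proof.
split.
- move=> a b; apply/matrixP=> s t; rewrite thin_vertex_mull !mxE.
  have [<-|n] := eqVneq a b; rewrite !mxE.
    by case: (s == t); case: (_ == a); rewrite /= ?mulr1 ?mulr0.
  case: eqVneq => [->|_]; last by rewrite mul0r.
  by rewrite (negbTE n) andbF mulr0.
- apply/matrixP=> s t; rewrite summxE (bigD1 (enum_val s)) //= big1 => [|a n].
    by rewrite !mxE eqxx andbT addr0.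
  by rewrite mxE [_ == a]eq_sym (negbTE n) andbF.
- move=> x; apply/matrixP=> s t; rewrite thin_vertex_mull !mxE.
  by case: (enum_val s == src x); rewrite ?andbF ?mul1r ?mulr0.
- move=> x; apply/matrixP=> s t; rewrite thin_vertex_mulr !mxE.
  by case: (enum_val t == tgt x); rewrite ?andbF ?mulr1 ?mulr0 ?mul0r.
Qed.

End Thin.

(* inl x is the arrow x of Q and inr x is the reverse arrow x^*. *)
Definition double_quiver (Q : quiver) : quiver :=
  @Quiver (vertex Q) (arrow Q + arrow Q)%type
    (fun x => match x with inl y => src y | inr y => tgt y end)
    (fun x => match x with inl y => tgt y | inr y => src y end).

Section Preprojective.
Variables (k : fieldType) (Q : quiver).
Let Qbar := double_quiver Q.

Definition preproj_rel : path_algebra k Qbar :=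
  \sum_(x : arrow Q)
    (pbasis k (@arrow_path Qbar (inl x)) * pbasis k (@arrow_path Qbar (inr x))
   - pbasis k (@arrow_path Qbar (inr x)) * pbasis k (@arrow_path Qbar (inl x))).

Definition preproj : Type := ring_quot (fun x => x = preproj_rel).
HB.instance Definition _ := GRing.PzRing.on preproj.

Definition to_preproj : path_algebra k Qbar -> preproj := @to_quot _ _.
Definition idem (a : vertex Q) : preproj :=
  to_preproj (pbasis k (@lazy_path Qbar a)).
Definition kscalar (c : k) : preproj := to_preproj (c *: (1 : path_algebra k Qbar)).

Lemma arrow_path_mx N (vm : vertex Qbar -> 'M[k]_N) am (rep : is_rep vm am) x :
  path_mx vm am (arrow_path x) = am x.
Proof. by case: (rep) => [_ _ va _]; rewrite /path_mx /= va. Qed.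

(* Holds because x x^* and x^* x act by zero for every x. *)
Lemma thin_preproj (V : {set vertex Qbar}) (E : {set arrow Qbar}) :
  (forall x : arrow Q, ~~ ((inl x \in E) && (inr x \in E))) ->
  forall r, r = preproj_rel -> rep_hom (thin_is_rep k V E) r = 0.
Proof.
move=> nE _ ->.
have am0 y : y \notin E -> thin_arrow k V E y = 0.
  by move=> /negbTE yE; apply/matrixP=> s t; rewrite !mxE yE.
pose F : {rmorphism path_algebra k Qbar -> 'M[k]_#|V|} :=
  rep_hom (thin_is_rep k V E).
have FE x : F (pbasis k (@arrow_path Qbar x)) = thin_arrow k V E x.
  by rewrite [LHS]rep_hom_basis (arrow_path_mx (thin_is_rep k V E)).
rewrite -[LHS]/(F _) rmorph_sum big1 // => x _.
rewrite rmorphB !rmorphM !FE.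
by case/nandP: (nE x) => /am0 ->; rewrite ?mulr0 ?mul0r subrr.
Qed.

Definition thin_module (V : {set vertex Qbar}) (E : {set arrow Qbar})
    (nE : forall x : arrow Q, ~~ ((inl x \in E) && (inr x \in E))) :
    lmodType preproj^c :=
  row_module (quot_lift (thin_preproj V nE) : {rmorphism preproj -> _}).

(* The ideal I_a and, for u = [:: u_1; ...; u_l], the product
   I_(u_l) ... I_(u_1).                                                     *)

Definition vertex_ideal (a : vertex Q) : {pred preproj} :=
  ideal_gen (fun x => x = 1 - idem a).

Definition ideal_mul (I J : {pred preproj}) : {pred preproj} := fun x =>
  `[< exists m (a b : 'I_m -> preproj),
        (forall t, a t \in I /\ b t \in J) /\ x = \sum_t a t * b t >].

Fixpoint word_ideal (u : seq (vertex Q)) : {pred preproj} :=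
  if u is a :: u' then ideal_mul (word_ideal u') (vertex_ideal a) else predT.

Lemma ideal_mul_right (I J : {pred preproj}) :
  (forall x y, x \in J -> x * y \in J) ->
  @submod_closed preproj^c (preproj^c)^o (ideal_mul I J).
Proof.
move=> Jr; split; first by apply/asboolP; exists 0%N, (fun=> 0), (fun=> 0);
  split=> [[]|] //; rewrite big_ord0.
move=> c x y /asboolP[m [a [b [ab ->]]]] /asboolP[m' [a' [b' [ab' ->]]]].
pose h (f : 'I_m -> preproj) (g : 'I_m' -> preproj) (t : 'I_(m + m')) :=
  match split t with inl u => f u | inr u => g u end.
apply/asboolP; exists (m + m')%N, (h a a'), (h (fun t => b t * (c : preproj)) b').
split=> [t|].
  rewrite /h; case: split => s; last exact: ab'.
  by have [? ?] := ab s; split=> //; apply: Jr.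
rewrite big_split_ord /=; apply: (congr2 (fun u v : preproj => u + v)).
  apply: etrans (mulr_suml _ _ _ (c : preproj)) _; apply: eq_bigr => t _.
  by rewrite /h (unsplitK (inl t)) mulrA.
by apply: eq_bigr => t _; rewrite /h (unsplitK (inr t)).
Qed.

Fact word_ideal_submod u : @submod_closed preproj^c (preproj^c)^o (word_ideal u).
Proof.
by case: u => [|a u] /=; [split | apply: ideal_mul_right => x y; apply: ideal_genMr].
Qed.
(* I(w) as a submodule of the regular right module. *)
Definition word_submod (u : seq (vertex Q)) : {pred (preproj^c)^o} :=
  word_ideal u.
HB.instance Definition _ u := GRing.isSubmodClosed.Build
  preproj^c (preproj^c)^o (word_submod u) (word_ideal_submod u).

(* The right module Pi / I(w), I(w) being given by the word u. *)
Definition preproj_quot (u : seq (vertex Q)) : lmodType preproj^c :=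
  mod_quot (word_submod u).

End Preprojective.

Section Modules.
Variable R : pzRingType.
Implicit Types X Y M : lmodType R.

Definition isomorphic M X : Prop := exists f : {linear M -> X}, bijective f.

Definition fin_gen M : Prop := exists m (g : 'I_m -> M),
  forall v, exists c : 'I_m -> R, v = \sum_t c t *: g t.

Definition is_summand X Y : Prop :=
  exists X' : lmodType R, isomorphic (X * X')%type Y.

Definition in_Sub Y M : Prop :=
  fin_gen M /\
  exists (r : nat) (X : 'I_r -> lmodType R),
    (forall t, is_summand (X t) Y) /\
    exists f : {linear M -> dsum X}, injective f.

Definition is_simple_object (F : lmodType R -> Prop) M : Prop :=
  [/\ F M,
      exists v : M, v != 0
    & ~ exists L : submodClosed M,
          [/\ exists2 v : M, v \in L & v != 0,
              exists v : M, v \notin L,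
              F (submodule L) & F (mod_quot L)]].
End Modules.

Section Dimension.
Variables (k : fieldType) (Q : quiver) (M : lmodType (preproj k Q)^c).

(* M e_a = {v | v e_a = v} has a k-basis with m elements. *)
Definition has_dim_at (a : vertex Q) (m : nat) : Prop :=
  exists b : 'I_m -> M,
    [/\ forall t, (idem k a : (preproj k Q)^c) *: b t = b t,
        forall v : M, (idem k a : (preproj k Q)^c) *: v = v ->
          exists c : 'I_m -> k,
            v = \sum_t (kscalar Q (c t) : (preproj k Q)^c) *: b t
      & forall c : 'I_m -> k,
          \sum_t (kscalar Q (c t) : (preproj k Q)^c) *: b t = 0 ->
          forall t, c t = 0].
End Dimension.

(* Type A_n. Vertices, letters and coordinates are numbered from 0: the vertex
   a : 'I_n is the vertex a + 1 of the Dynkin diagram, and the letter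
   i : 'I_n.+1 is i + 1.                                                     *)

Section TypeA.
Variable n : nat.

Definition edge_lo (x : 'I_n.-1) : 'I_n := widen_ord (leq_pred n) x.
Fact edge_hi_subproof (x : 'I_n.-1) : (x.+1 < n)%N.
Proof. by rewrite -ltn_predRL. Qed.
Definition edge_hi (x : 'I_n.-1) : 'I_n := Ordinal (edge_hi_subproof x).

(* o chooses the orientation of each edge of the Dynkin diagram. *)
Definition quiverA (o : 'I_n.-1 -> bool) : quiver :=
  @Quiver 'I_n 'I_n.-1
    (fun x => if o x then edge_lo x else edge_hi x)
    (fun x => if o x then edge_hi x else edge_lo x).

Definition eps (a : 'I_n.+1) : 'rV[int]_n.+1 := delta_mx 0 a.
Definition rootA (i j : 'I_n.+1) : 'rV[int]_n.+1 := eps i - eps j.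
Definition simple_root (a : 'I_n) : 'rV[int]_n.+1 :=
  rootA (widen_ord (leqnSn n) a) (lift ord0 a).

Definition simple_refl (a : 'I_n) : 'S_n.+1 :=
  tperm (widen_ord (leqnSn n) a) (lift ord0 a).

(* s_(u_1) \o ... \o s_(u_l); the product s * t of permutations applies s
   first.                                                                    *)
Definition word_perm (u : seq 'I_n) : 'S_n.+1 :=
  foldr (fun a s => s * simple_refl a)%g 1%g u.

Definition reduced_expr (w : 'S_n.+1) (u : seq 'I_n) : Prop :=
  word_perm u = w /\ forall v, word_perm v = w -> (size u <= size v)%N.

(* Position of a letter in w(1) w(2) ... w(n+1), i.e., the row of the dot in
   the column of that letter.                                                *)
Definition letter_pos (w : 'S_n.+1) (l : 'I_n.+1) : 'I_n.+1 := (w^-1)%g l.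

Definition BInv (w : 'S_n.+1) (i j : 'I_n.+1) : bool :=
  [&& (i < j)%N, (letter_pos w j < letter_pos w i)%N
    & [forall m : 'I_n.+1, (i < m < j)%N ==> ~~ (letter_pos w j < letter_pos w m < letter_pos w i)%N]].

Definition has_dim_vector k o (M : lmodType (preproj k (quiverA o))^c)
    (b : 'rV[int]_n.+1) : Prop :=
  exists d : 'I_n -> nat,
    (forall a, has_dim_at M (a : vertex (quiverA o)) (d a)) /\
    b = \sum_a simple_root a *+ d a.

Definition torsion_free k o (u : seq 'I_n) :
    lmodType (preproj k (quiverA o))^c -> Prop :=
  in_Sub (@preproj_quot k (quiverA o) u).

Section ArcModule.
Variables (k : fieldType) (o : 'I_n.-1 -> bool) (w : 'S_n.+1) (i j : 'I_n.+1).
Let Qbar := double_quiver (quiverA o).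

Definition arc_vertices : {set vertex Qbar} := [set a : 'I_n | (i <= a < j)%N].

Definition arc_arrow (a b : 'I_n) : bool :=
  [exists m : 'I_n.+1, (i < m < j)%N &&
     ([&& a.+1 == m, b == m :> nat & (letter_pos w i < letter_pos w m)%N]
   || [&& a == m :> nat, b.+1 == m & (letter_pos w m < letter_pos w j)%N])].

Definition arc_arrows : {set arrow Qbar} :=
  [set x : arrow Qbar | arc_arrow (src x) (tgt x)].

Lemma arc_arrow_asym (a b : 'I_n) :
  BInv w i j -> arc_arrow a b -> ~~ arc_arrow b a.
Proof.
case/and3P=> _ ji _ /existsP[m /andP[_ hm]].
apply/negP => /existsP[m' /andP[_ hm']].
have e : m = m' :> nat.
  by move: hm hm' => /orP[|] /and3P[/eqP ? /eqP ? _] /orP[|] /and3P[/eqP ? /eqP ? _]; lia.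
move/ord_inj: e hm' => <-; move: hm.
by move=> /orP[|] /and3P[/eqP ? /eqP ? ?] /orP[|] /and3P[/eqP ? /eqP ? ?]; lia.
Qed.

Lemma arc_arrowsP : BInv w i j ->
  forall x : 'I_n.-1, ~~ ((inl x \in arc_arrows) && (inr x \in arc_arrows)).
Proof.
move=> ij x; rewrite !inE; apply/nandP; case: (boolP (arc_arrow _ _)); last by left.
by move/(arc_arrow_asym ij); right.
Qed.

(* The Pi-module B_e of the edge e given by (i, j). *)
Definition arc_module (ij : BInv w i j) : lmodType (preproj k (quiverA o))^c :=
  @thin_module k (quiverA o) arc_vertices arc_arrows (arc_arrowsP ij).
End ArcModule.

End TypeA.

(* Main.v *)
Require Import Defs.
From HB Require Import structures.
From mathcomp Require Import all_boot all_order all_algebra all_fingroup.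
From mathcomp Require Import generic_quotient ring_quotient finmap boolp.
From mathcomp Require Import monalg zify.

Set Implicit Arguments.
Unset Strict Implicit.
Unset Printing Implicit Defensive.

Import GRing.Theory.
Local Open Scope ring_scope.

(** Up to signs of the arrows, Pi is generated by the vertex idempotents e_d and
    two commuting elements, raise (the sum of the arrows a -> a + 1) and lower
    (the sum of the arrows a + 1 -> a). Hence Pi has the basis
    e_d raise^y lower^x, x <= d, d + y < n, and I(w) is spanned by those basis
    elements for which x is at least the number of letters beyond the end vertex
    among w(1), ..., w(d + 1).

    The key point is that a module cogenerated by Pi / I(w) which is thin with
    support [p, q), or contains such a chain of vectors, forces q to appear
    to the left of p in w: one follows a nonzero coefficient of a homomorphism to
    Pi / I(w) along the chain inside one row of this basis. Applied to the
    submodules [i, m) and [m, j), this determines which arrows act by nonzero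
    scalars on a module with dimension vector beta_(i, j), hence uniqueness;
    applied to a component of a proper quotient of B_e, whose end letters are in
    the wrong order, it gives simplicity. Finally B_e embeds in the row of
    Pi / I(w) given by the position of j, as a strip along the boundary of I(w). *)

(** * Reduced words *)

(** Right multiplication never changes the starting vertex d, so the rows e_d Pi can be treated
    separately, and a row is governed by one function of the vertex m: a monomial of row d ending at
    m survives in Pi / I(w) exactly when x < [cnt w d m.+1]. From the vertex m - 1 to the vertex m
    this bound drops by one if the letter m is among w(1), ..., w(d + 1), and is unchanged
    otherwise. In the first case [lower] takes the last surviving monomial at m to the last one at m
    - 1; in the second [raise] takes the last one at m - 1 to the last one at m. This turns the
    order of the letters into the direction of arrows, and it is why B_e is found in the row of j,
    which separates the inner letters left of j from those right of i.

    Spanning of Pi by the monomials is formal. Their independence, and the fact that I(w) is no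
    larger than expected, come from an explicit matrix representation on the index set of the basis,
    so no dimension of Pi or of Pi / I(w) has to be known in advance. *)

Section Words.
Variable n : nat.
Implicit Types (a b : 'I_n) (w : 'S_n.+1) (l : 'I_n.+1).

Definition lo_letter a : 'I_n.+1 := widen_ord (leqnSn n) a.
Definition hi_letter a : 'I_n.+1 := lift ord0 a.

Lemma hi_letterE a : hi_letter a = a.+1 :> nat.
Proof. by []. Qed.

Lemma lo_hi_neq a : lo_letter a != hi_letter a.
Proof. by rewrite -val_eqE /= /bump /=; lia. Qed.

Lemma letter_pos_inj w : injective (letter_pos w).
Proof. exact: perm_inj. Qed.

Lemma letter_pos_reflr w a l :
  letter_pos (w * simple_refl a)%g l = letter_pos w (simple_refl a l).
Proof. by rewrite /letter_pos invMg permM tpermV. Qed.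

Lemma letter_pos_refll w b l :
  letter_pos (simple_refl b * w)%g l = simple_refl b (letter_pos w l).
Proof. by rewrite /letter_pos invMg permM tpermV. Qed.

Lemma simple_refl_flip b (p q : 'I_n.+1) : (p < q)%N ->
  (simple_refl b q < simple_refl b p)%N -> p = lo_letter b /\ q = hi_letter b.
Proof.
rewrite /simple_refl -/(lo_letter b) -/(hi_letter b) => pq.
have hb : hi_letter b = b.+1 :> nat by [].
have lb : lo_letter b = b :> nat by [].
case: (tpermP _ _ q) => [e1|e1|/eqP q1 /eqP q2];
  case: (tpermP _ _ p) => [e2|e2|/eqP p1 /eqP p2];
  try by [split]; move=> h; exfalso.
all: try (move/(congr1 val): e1 => /= e1); try (move/(congr1 val): e2 => /= e2).
all: try (rewrite -val_eqE /= in q1); try (rewrite -val_eqE /= in q2).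
all: try (rewrite -val_eqE /= in p1); try (rewrite -val_eqE /= in p2).
all: by move: h; rewrite ?hb ?lb; unfold bump in *; lia.
Qed.

Lemma word_perm_rcons (u : seq 'I_n) b :
  word_perm (rcons u b) = (simple_refl b * word_perm u)%g.
Proof. by elim: u => [|a u IH] /=; rewrite ?mul1g ?mulg1 // IH mulgA. Qed.

(* The exchange property: at the letter of u where the inversion (a, a + 1) is
   created, that letter and the new a cancel. *)
Lemma exchange (u : seq 'I_n) a :
  (letter_pos (word_perm u) (hi_letter a) < letter_pos (word_perm u) (lo_letter a))%N ->
  exists2 v, (size v < size u)%N & word_perm v = word_perm (a :: u).
Proof.
elim/last_ind: u => [|u b IH].
  by rewrite /letter_pos /= invg1 !perm1 hi_letterE /=; lia.
rewrite word_perm_rcons !letter_pos_refll => h.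
set p := letter_pos _ (hi_letter a) in IH h.
set q := letter_pos _ (lo_letter a) in IH h.
have [pq|] := ltnP p q.
  have [v sv ev] := IH pq; exists (rcons v b); first by rewrite !size_rcons.
  by rewrite /= !word_perm_rcons ev /= mulgA.
rewrite leq_eqVlt => /orP[/eqP/val_inj/letter_pos_inj e|qp].
  by have := lo_hi_neq a; rewrite e eqxx.
have [qb pb] := simple_refl_flip qp h.
(* [word_perm u] carries the two positions swapped by b to the letters a and a + 1, so conjugation
   by it turns s_b into s_a and the two reflections cancel. *)
exists u; rewrite ?size_rcons //= word_perm_rcons.
have lo : word_perm u (lo_letter b) = lo_letter a by rewrite -qb /q /letter_pos permKV.
have hi : word_perm u (hi_letter b) = hi_letter a by rewrite -pb /p /letter_pos permKV.
rewrite /simple_refl -/(lo_letter b) -/(hi_letter b) -/(lo_letter a) -/(hi_letter a).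
by rewrite -lo -hi -tpermJ conjgE !mulgA mulgK tperm2 mul1g.
Qed.

Lemma reduced_cons w a u : reduced_expr w (a :: u) ->
  reduced_expr (word_perm u) u /\
  (letter_pos (word_perm u) (lo_letter a) < letter_pos (word_perm u) (hi_letter a))%N.
Proof.
case=> ew min; split.
  split=> // v ev; have := min (a :: v); rewrite /= ltnS; apply.
  by rewrite /= ev -ew.
rewrite ltnNge leq_eqVlt; apply/negP => /orP[/eqP/val_inj/letter_pos_inj e|].
  by have := lo_hi_neq a; rewrite e eqxx.
move/exchange=> [v sv ev]; have := min v; rewrite ev ew => /(_ erefl) /=.
by lia.
Qed.

(** The vertex m lies between the letters m and m + 1, so the letters beyond m are counted with
    [t = m.+1]. The threshold is a plain number since it may exceed n. *)
Definition cnt w (d t : nat) : nat :=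
  \sum_(l < n.+1) ((t <= l) && (letter_pos w l <= d))%N.

Lemma cntS w d (t : 'I_n.+1) : cnt w d t = ((letter_pos w t <= d) + cnt w d t.+1)%N.
Proof.
rewrite /cnt (bigD1 t) //= leqnn [in RHS](bigD1 t) //= ltnn add0n; congr addn.
by apply: eq_bigr => l lt; rewrite ltn_neqAle eq_sym val_eqE lt.
Qed.

Lemma cntS_nat w d t : (t <= n)%N ->
  cnt w d t = ((letter_pos w (inord t) <= d) + cnt w d t.+1)%N.
Proof. by move=> tn; rewrite -{1}(@inordK n t) // cntS inordK. Qed.

Lemma cnt_out w d t : (n < t)%N -> cnt w d t = 0%N.
Proof. by move=> h; rewrite /cnt big1 // => l _; have := ltn_ord l; lia. Qed.

Lemma cnt0 w d : (d <= n)%N -> cnt w d 0 = d.+1.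
Proof.
move=> dn; rewrite /cnt (reindex_inj (@perm_inj _ w)) /=.
under eq_bigr do rewrite /letter_pos permK.
rewrite -(big_mkord predT (fun i => (i <= d)%N : nat)) (@big_cat_nat _ _ _ d.+1) //=.
rewrite [X in (_ + X)%N]big1_seq ?addn0; last first.
  by move=> i; rewrite mem_index_iota; lia.
rewrite (eq_big_nat _ _ (F2 := fun=> 1%N)); first by rewrite sum_nat_const_nat; lia.
by move=> i; lia.
Qed.

Lemma cnt_step w d t : (cnt w d t.+1 <= cnt w d t <= (cnt w d t.+1).+1)%N.
Proof.
have [tn|tn] := ltnP t n.+1; last by rewrite !cnt_out //; lia.
by have := cntS w d (Ordinal tn); case: (_ <= _)%N => /= ->; lia.
Qed.

(** At most t of the d + 1 letters in the positions up to d are smaller than t. *)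
Lemma cnt_ge w d t : (d <= n)%N -> (d.+1 <= cnt w d t + t)%N.
Proof.
move=> dn; elim: t => [|t IH]; first by rewrite cnt0 // addn0.
by have := cnt_step w d t; lia.
Qed.

Lemma cnt_le w d t : (d <= n)%N -> (cnt w d t <= d.+1)%N.
Proof.
move=> dn; elim: t => [|t IH]; first by rewrite cnt0.
by have := cnt_step w d t; lia.
Qed.

Lemma cnt_le_out w d t : (cnt w d t <= n.+1 - t)%N.
Proof.
have [tn|tn] := ltnP n t; first by rewrite cnt_out.
rewrite -{1}(subKn (leqW tn)); move: (n.+1 - t)%N (leq_subr t n.+1) => r.
elim: r => [|r IH] h; first by rewrite subn0 cnt_out.
have := cnt_step w d (n.+1 - r.+1); have -> : (n.+1 - r.+1).+1 = (n.+1 - r)%N by lia.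
by have := IH (ltnW h); lia.
Qed.

Lemma cnt1 d t : (d <= n)%N -> cnt 1%g d t = (d.+1 - t)%N.
Proof.
move=> dn; elim: t => [|t IH]; first by rewrite cnt0 ?subn0.
have [tn|tn] := ltnP t n.+1; last by rewrite cnt_out //; lia.
have := cntS 1%g d (Ordinal tn); rewrite /letter_pos invg1 perm1 /= IH.
by case: leqP; lia.
Qed.

(** The reflection exchanges the letters a and a + 1, and a + 1 is the only threshold that separates
    them. *)
Lemma cnt_refl_neq w a d t : t != a.+1 -> cnt (w * simple_refl a)%g d t = cnt w d t.
Proof.
move=> ta; rewrite /cnt (reindex_inj (@perm_inj _ (simple_refl a))) /=.
apply: eq_bigr => l _; rewrite letter_pos_reflr tpermK; congr (nat_of_bool (_ && _)).
rewrite /simple_refl -/(lo_letter a) -/(hi_letter a).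
by case: tpermP => [->|->|//]; rewrite hi_letterE /=; lia.
Qed.

Lemma cnt_refl_eq w a d : cnt (w * simple_refl a)%g d a.+1
  = ((letter_pos w (lo_letter a) <= d) + cnt w d a.+2)%N.
Proof.
rewrite -(hi_letterE a) cntS letter_pos_reflr tpermR cnt_refl_neq //.
by rewrite hi_letterE; lia.
Qed.

End Words.

(** * Path algebras: bilinearity and induction along paths *)

Section PathAlgebra.
Variables (k : fieldType) (Q : quiver).
Implicit Types (x y : path_algebra k Q) (c : k).

Lemma path_scalerAl c x y : (c *: x) * y = c *: (x * y).
Proof. exact: (linearZZ (path_mull y)). Qed.

Lemma path_scalerAr c x y : x * (c *: y) = c *: (x * y).
Proof. exact: (linearZZ (path_mul x)). Qed.

Lemma pbasisM (p q : qpath Q) :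
  pbasis k p * pbasis k q = if Defs.pcomp p q is Some r then pbasis k r else 0.
Proof. exact: path_mulE. Qed.

Lemma pbasis_arrow_neq (a b : arrow Q) : tgt a != src b ->
  pbasis k (arrow_path a) * pbasis k (arrow_path b) = 0.
Proof. by move=> ab; rewrite pbasisM pcomp_none //; apply/eqP. Qed.

Lemma pbasis_lazyl a (b : arrow Q) :
  pbasis k (lazy_path a) * pbasis k (arrow_path b)
  = if a == src b then pbasis k (arrow_path b) else 0.
Proof. by rewrite pbasisM pcomp_lazyl; case: (a == _). Qed.

Lemma pbasis_lazyr a (b : arrow Q) :
  pbasis k (arrow_path b) * pbasis k (lazy_path a)
  = if tgt b == a then pbasis k (arrow_path b) else 0.
Proof. by rewrite pbasisM pcomp_lazyr; case: (_ == a). Qed.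

Lemma path_algebra_ind (P : path_algebra k Q -> Prop) :
  P 0 -> (forall x y, P x -> P y -> P (x + y)) -> (forall c x, P x -> P (c *: x)) ->
  P 1 ->
  (forall x a, P x -> P (x * pbasis k (lazy_path a))) ->
  (forall x b, P x -> P (x * pbasis k (arrow_path b))) ->
  forall x, P x.
Proof.
move=> P0 PD PZ P1 Pv Pa x.
have Pp p : P (pbasis k p).
  move: {2}(parrows p) (erefl (parrows p)) => s.
  (* Paths compose from left to right, so removing the last arrow exhibits a right
     multiplication. *)
  elim/last_ind: s p => [|s b IH] p ep.
    have -> : p = lazy_path (psrc p) by apply: qpath_eq.
    by rewrite -[pbasis k _]mul1r; apply: Pv.
  have := valP p; rewrite -[(val p).1]/(psrc p) -[(val p).2]/(parrows p) ep.
  rewrite -cats1 walk_cat => /andP[w1 /=]; rewrite andbT => /eqP eb.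
  have := Pa _ b (IH (QPath (qpath_val := (psrc p, s)) w1) erefl).
  rewrite pbasisM; have [r er] := @pcomp_ex _
    (QPath (qpath_val := (psrc p, s)) w1) (arrow_path b) (esym eb).
  rewrite er; case/pcompE: er => _ e1 e2.
  suff -> : p = r by [].
  by apply: qpath_eq; rewrite ?e1 // e2 ep /parrows /= cats1.
have -> : x = lin_ext (@pbasis k Q) x.
  apply: (@lin_ext_uniq _ _ _ idfun (lin_ext (@pbasis k Q))) => p.
  by apply: esym; rewrite /= [LHS](lin_extU (@pbasis k Q) p) pbasis.unlock.
by rewrite /lin_ext; elim/big_ind: _ => // p _; apply: PZ.
Qed.

End PathAlgebra.

(** * Matrices of partial functions *)

Section PartialFunctionMatrix.
Variables (k : fieldType) (G : finType).

Definition pfun_mx (h : G -> option G) : 'M[k]_#|G| :=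
  \matrix_(s, t) (h (enum_val s) == Some (enum_val t))%:R.

Lemma pfun_mxM h h' :
  pfun_mx h *m pfun_mx h' = pfun_mx (fun g => obind h' (h g)).
Proof.
apply/matrixP=> s t; rewrite !mxE; case e: (h (enum_val s)) => [g|] /=.
  rewrite (bigD1 (enum_rank g)) //= big1 ?addr0 => [|r n].
    by rewrite !mxE e enum_rankK eqxx mul1r.
  rewrite !mxE e.
  have/negbTE-> : Some g != Some (enum_val r).
    by apply: contra n => /eqP[->]; rewrite enum_valK.
  by rewrite mul0r.
by rewrite big1 // => r _; rewrite mxE e mul0r.
Qed.

Lemma eq_pfun_mx h h' : h =1 h' -> pfun_mx h = pfun_mx h'.
Proof. by move=> e; apply/matrixP=> s t; rewrite !mxE e. Qed.

Lemma pfun_mx0 h : (forall g, h g = None) -> pfun_mx h = 0.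
Proof. by move=> e; apply/matrixP=> s t; rewrite !mxE e. Qed.

End PartialFunctionMatrix.

(** * Generators of the preprojective algebra of type A *)

Section TypeAGenerators.
Variables (k : fieldType) (n : nat) (o : 'I_n.-1 -> bool).
Let Q := quiverA o.
Let Qbar := double_quiver Q.
Local Notation PA := (path_algebra k Qbar).
Local Notation Pi := (preproj k Q).

Definition up_arrow (y : 'I_n.-1) : arrow Qbar := if o y then inl y else inr y.
Definition down_arrow (y : 'I_n.-1) : arrow Qbar := if o y then inr y else inl y.

Lemma src_up y : src (up_arrow y) = edge_lo y :> 'I_n.
Proof. by rewrite /up_arrow; case e: (o y); rewrite /= e. Qed.
Lemma tgt_up y : tgt (up_arrow y) = edge_hi y :> 'I_n.
Proof. by rewrite /up_arrow; case e: (o y); rewrite /= e. Qed.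
Lemma src_down y : src (down_arrow y) = edge_hi y :> 'I_n.
Proof. by rewrite /down_arrow; case e: (o y); rewrite /= e. Qed.
Lemma tgt_down y : tgt (down_arrow y) = edge_lo y :> 'I_n.
Proof. by rewrite /down_arrow; case e: (o y); rewrite /= e. Qed.

Lemma edge_lo_inj :  injective (@edge_lo n).
Proof. by move=> x y /(congr1 val) /= e; apply: val_inj. Qed.
Lemma edge_hi_inj : injective (@edge_hi n).
Proof. by move=> x y /(congr1 val) /= [e]; apply: val_inj. Qed.

Definition up_path (y : 'I_n.-1) : PA := pbasis k (arrow_path (up_arrow y)).

(* The sign turns the preprojective relation into [raise, lower] = 0 for every
   orientation. *)
Definition down_path (y : 'I_n.-1) : PA :=
  (if o y then 1 else -1) * pbasis k (arrow_path (down_arrow y)).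

Definition path_raise : PA := \sum_y up_path y.
Definition path_lower : PA := \sum_y down_path y.

Lemma up_down_neq x y : x != y -> up_path x * down_path y = 0.
Proof.
move=> xy; rewrite /up_path /down_path.
have h : pbasis k (arrow_path (up_arrow x)) * pbasis k (arrow_path (down_arrow y)) = 0.
  by apply: pbasis_arrow_neq; rewrite tgt_up src_down (inj_eq edge_hi_inj).
by case: (o y); rewrite ?mulN1r ?mul1r ?mulrN h ?oppr0.
Qed.

Lemma down_up_neq x y : x != y -> down_path x * up_path y = 0.
Proof.
move=> xy; rewrite /up_path /down_path.
have h : pbasis k (arrow_path (down_arrow x)) * pbasis k (arrow_path (up_arrow y)) = 0.
  by apply: pbasis_arrow_neq; rewrite tgt_down src_up (inj_eq edge_lo_inj).
by case: (o x); rewrite ?mulN1r ?mul1r ?mulNr h ?oppr0.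
Qed.

(** In the product of the two sums, arrows over different edges do not compose, so one term per edge
    remains. For an edge with [o x] false the arrow of Q points down, and the sign in [down_path]
    makes up for the exchanged roles of x and x^*. *)
Lemma preproj_relE :
  preproj_rel k Q = path_raise * path_lower - path_lower * path_raise.
Proof.
have diag (a b : 'I_n.-1 -> PA) : (forall x y, x != y -> a x * b y = 0) ->
    (\sum_x a x) * (\sum_y b y) = \sum_x a x * b x.
  move=> h; rewrite mulr_suml; apply: eq_bigr => x _.
  rewrite mulr_sumr (bigD1 x) //= big1 ?addr0 // => y xy.
  by apply: h; rewrite eq_sym.
rewrite (diag _ _ up_down_neq) (diag _ _ down_up_neq) -sumrB.
apply: eq_bigr => x _; rewrite /up_path /down_path /up_arrow /down_arrow.
case: (o x); rewrite ?mul1r // !mulN1r mulrN mulNr.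
by rewrite opprK addrC.
Qed.

End TypeAGenerators.

(* Sealed: unification that unfolds elements of the quotient of the path algebra
   is prohibitively slow. *)
HB.lock Definition raise (k : fieldType) (n : nat) (o : 'I_n.-1 -> bool) :
  preproj k (quiverA o) := to_preproj (path_raise k o).
HB.lock Definition lower (k : fieldType) (n : nat) (o : 'I_n.-1 -> bool) :
  preproj k (quiverA o) := to_preproj (path_lower k o).
(* Zero outside 0, ..., n - 1, so that vtx_raise and vtx_lower hold for every m. *)
HB.lock Definition vtx (k : fieldType) (n : nat) (o : 'I_n.-1 -> bool) (m : nat) :
    preproj k (quiverA o) :=
  if insub m is Some a then @idem k (quiverA o) a else 0.
HB.lock Definition scal (k : fieldType) (n : nat) (o : 'I_n.-1 -> bool) (c : k) :
  preproj k (quiverA o) := kscalar (quiverA o) c.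

Section TypeAGeneratorRelations.
Variables (k : fieldType) (n : nat) (o : 'I_n.-1 -> bool).
Let Q := quiverA o.
Let Qbar := double_quiver Q.
Local Notation PA := (path_algebra k Qbar).
Local Notation Pi := (preproj k Q).
Local Notation vtx := (vtx k o).
Local Notation raise := (raise k o).
Local Notation lower := (lower k o).
Local Notation scal := (@scal k n o).
Local Notation path_raise := (path_raise k o).
Local Notation path_lower := (path_lower k o).
Local Notation up_path := (up_path k o).
Local Notation down_path := (down_path k o).
Local Notation up_arrow := (up_arrow o).
Local Notation down_arrow := (down_arrow o).

Lemma raiseE : raise = to_preproj path_raise.
Proof. by rewrite raise.unlock. Qed.
Lemma lowerE : lower = to_preproj path_lower.
Proof. by rewrite lower.unlock. Qed.
Lemma scalE c : scal c = kscalar Q c.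
Proof. by rewrite scal.unlock. Qed.

Lemma vtxE (a : 'I_n) : vtx a = @idem k Q a.
Proof. by rewrite vtx.unlock valK. Qed.

Lemma vtx_out m : (n <= m)%N -> vtx m = 0.
Proof. by move=> h; rewrite vtx.unlock insubF // ltnNge h. Qed.
Lemma to_preprojM (x y : PA) : to_preproj (x * y) = to_preproj x * to_preproj y :> Pi.
Proof. exact: (rmorphM (@to_quot PA (fun x => x = preproj_rel k Q))). Qed.
Lemma to_preprojD (x y : PA) : to_preproj (x + y) = to_preproj x + to_preproj y :> Pi.
Proof. exact: (rmorphD (@to_quot PA (fun x => x = preproj_rel k Q))). Qed.
Lemma to_preprojB (x y : PA) : to_preproj (x - y) = to_preproj x - to_preproj y :> Pi.
Proof. exact: (rmorphB (@to_quot PA (fun x => x = preproj_rel k Q))). Qed.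
Lemma to_preproj1 : to_preproj (1 : PA) = 1 :> Pi.
Proof. by []. Qed.
Lemma to_preproj0 : to_preproj (0 : PA) = 0 :> Pi.
Proof. exact: (rmorph0 (@to_quot PA (fun x => x = preproj_rel k Q))). Qed.
Lemma to_preproj_sum (I : finType) (F : I -> PA) :
  to_preproj (\sum_t F t) = \sum_t to_preproj (F t) :> Pi.
Proof. exact: (rmorph_sum (@to_quot PA (fun x => x = preproj_rel k Q))). Qed.
Lemma to_preproj_surj (z : Pi) : exists x : PA, to_preproj x = z.
Proof. by exists (repr (z : Quotient.quot _)); apply: to_quot_repr. Qed.

Lemma to_preproj_rel0 : to_preproj (preproj_rel k Q) = 0 :> Pi.
Proof.
rewrite -to_preproj0; apply/to_quotP; rewrite subr0; apply/ideal_genP.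
exists 1%N, (fun=> 1), (fun=> preproj_rel k Q), (fun=> 1); split=> //.
by rewrite big_ord1 mul1r mulr1.
Qed.

Lemma raise_lower : raise * lower = lower * raise.
Proof.
apply/eqP; rewrite -subr_eq0 raiseE lowerE -!to_preprojM -to_preprojB -preproj_relE.
by rewrite to_preproj_rel0.
Qed.

Lemma scalD : {morph scal : a b / a + b}.
Proof. by move=> a b; rewrite !scalE /kscalar scalerDl to_preprojD. Qed.
Lemma scalM : {morph scal : a b / a * b}.
Proof.
by move=> a b; rewrite !scalE /kscalar -to_preprojM path_scalerAl mul1r scalerA.
Qed.
Lemma scal1 : scal 1 = 1.
Proof. by rewrite scalE /kscalar scale1r. Qed.
Lemma scal0 : scal 0 = 0.
Proof. by rewrite scalE /kscalar scale0r to_preproj0. Qed.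
Lemma scal_to_preproj c (x : PA) : scal c * to_preproj x = to_preproj (c *: x).
Proof. by rewrite scalE /kscalar -to_preprojM path_scalerAl mul1r. Qed.
Lemma scalC c (z : Pi) : scal c * z = z * scal c.
Proof.
case: (to_preproj_surj z) => x <-; rewrite scal_to_preproj scalE /kscalar.
by rewrite -to_preprojM path_scalerAr mulr1.
Qed.

Lemma vtxM a b : vtx a * vtx b = if a == b then vtx a else 0.
Proof.
have [ha|ha] := ltnP a n; last by rewrite (vtx_out ha) mul0r if_same.
have [hb|hb] := ltnP b n; last first.
  by rewrite (vtx_out hb) mulr0; case: eqP => // e; rewrite vtx_out // e.
rewrite -[a]/(val (Ordinal ha)) -[b]/(val (Ordinal hb)) !vtxE /idem -to_preprojM.
rewrite pbasisM pcomp_lazyl -[psrc _]/(Ordinal hb : vertex Q) -val_eqE /=.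
case: eqP => [e|_]; last exact: to_preproj0.
by subst b; rewrite (bool_irrelevance ha hb).
Qed.

Lemma sum_vtx : \sum_(a < n) vtx a = 1.
Proof.
rewrite -to_preproj1 -[1]/(path_one k Qbar) to_preproj_sum.
by apply: eq_bigr => a _; rewrite vtxE.
Qed.

Lemma idem_up (a : 'I_n) y : pbasis k (@lazy_path Qbar a) * up_path y
  = if a == edge_lo y then up_path y else 0.
Proof. by rewrite /up_path pbasis_lazyl src_up. Qed.
Lemma up_idem (a : 'I_n) y : up_path y * pbasis k (@lazy_path Qbar a)
  = if edge_hi y == a then up_path y else 0.
Proof. by rewrite /up_path pbasis_lazyr tgt_up. Qed.
Lemma idem_down (a : 'I_n) y : pbasis k (@lazy_path Qbar a) * down_path y
  = if a == edge_hi y then down_path y else 0.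
Proof.
rewrite /down_path; case: (o y); rewrite ?mulN1r ?mul1r ?mulrN pbasis_lazyl src_down;
 by case: (a == _); rewrite ?oppr0.
Qed.
Lemma down_idem (a : 'I_n) y : down_path y * pbasis k (@lazy_path Qbar a)
  = if edge_lo y == a then down_path y else 0.
Proof.
rewrite /down_path -mulrA pbasis_lazyr tgt_down.
by case: (edge_lo y == a); rewrite ?mulr0.
Qed.

Lemma sum_if_unique (V : nmodType) (I : finType) (P : pred I) (F : I -> V) i :
  (forall t, P t = (t == i)) -> \sum_t (if P t then F t else 0) = F i.
Proof. by move=> h; rewrite -big_mkcond (eq_bigl _ _ h) big_pred1_eq. Qed.

Lemma vtx_raise a : vtx a * raise = raise * vtx a.+1.
Proof.
have [ha|ha] := ltnP a.+1 n; last first.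
  rewrite (vtx_out ha) mulr0; have [hb|hb] := ltnP a n; last first.
    by rewrite vtx_out // mul0r.
  rewrite -[a]/(val (Ordinal hb)) vtxE /idem raiseE -!to_preprojM /path_raise mulr_sumr.
  rewrite big1 ?to_preproj0 // => y _; rewrite idem_up -val_eqE /=.
  by case: eqP => // e; have := edge_hi_subproof y; rewrite -e ltnNge ha.
have hy : (a < n.-1)%N by lia.
rewrite -[a.+1]/(val (Ordinal ha)) vtxE.
have -> : vtx a = @idem k Q (edge_lo (Ordinal hy)) by rewrite -vtxE.
rewrite /idem raiseE -!to_preprojM /path_raise mulr_sumr mulr_suml.
under eq_bigr do rewrite idem_up.
under [in RHS]eq_bigr do rewrite up_idem.
rewrite (@sum_if_unique _ _ _ _ (Ordinal hy)); last first.
  by move=> t; rewrite -!val_eqE eq_sym.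
by rewrite (@sum_if_unique _ _ _ _ (Ordinal hy)).
Qed.

Lemma vtx_lower a : vtx a.+1 * lower = lower * vtx a.
Proof.
have [ha|ha] := ltnP a.+1 n; last first.
  rewrite (vtx_out ha) mul0r; have [hb|hb] := ltnP a n; last first.
    by rewrite vtx_out // mulr0.
  rewrite -[a]/(val (Ordinal hb)) vtxE /idem lowerE -!to_preprojM /path_lower mulr_suml.
  rewrite big1 ?to_preproj0 // => y _; rewrite down_idem -val_eqE /=.
  by case: eqP => // e; have := edge_hi_subproof y; rewrite e ltnNge ha.
have hy : (a < n.-1)%N by lia.
rewrite -[a.+1]/(val (Ordinal ha)) vtxE.
have -> : vtx a = @idem k Q (edge_lo (Ordinal hy)) by rewrite -vtxE.
rewrite /idem lowerE -!to_preprojM /path_lower mulr_sumr mulr_suml.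
under eq_bigr do rewrite idem_down.
under [in RHS]eq_bigr do rewrite down_idem.
rewrite (@sum_if_unique _ _ _ _ (Ordinal hy)); last first.
  by move=> t; rewrite -!val_eqE eq_sym.
by rewrite (@sum_if_unique _ _ _ _ (Ordinal hy)).
Qed.

Lemma vtx0_lower : vtx 0 * lower = 0.
Proof.
have [h|h] := ltnP 0 n; last by rewrite vtx_out // mul0r.
rewrite -[0%N]/(val (Ordinal h)) vtxE /idem lowerE -!to_preprojM /path_lower mulr_sumr.
by rewrite big1 ?to_preproj0 // => y _; rewrite idem_down -val_eqE.
Qed.

Lemma up_pathE y : to_preproj (up_path y) = vtx y * raise :> Pi.
Proof.
have -> : vtx y = @idem k Q (edge_lo y) by rewrite -vtxE.
rewrite /idem raiseE -!to_preprojM /path_raise mulr_sumr.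
under eq_bigr do rewrite idem_up.
rewrite (@sum_if_unique _ _ _ _ y) // => t.
by rewrite (inj_eq (@edge_lo_inj _)) eq_sym.
Qed.

Lemma down_pathE y : to_preproj (down_path y) = vtx y.+1 * lower :> Pi.
Proof.
have -> : vtx y.+1 = @idem k Q (edge_hi y) by rewrite -vtxE.
rewrite /idem lowerE -!to_preprojM /path_lower mulr_sumr.
under eq_bigr do rewrite idem_down.
rewrite (@sum_if_unique _ _ _ _ y) // => t.
by rewrite (inj_eq (@edge_hi_inj _)) eq_sym.
Qed.

(** Only right multiplications occur: they keep each row of the monomial basis stable, and right
    modules are acted on in this way. *)
Lemma preproj_ind (P : Pi -> Prop) :
  P 0 -> (forall x y, P x -> P y -> P (x + y)) ->
  (forall c x, P x -> P (x * scal c)) -> P 1 ->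
  (forall x a, P x -> P (x * vtx a)) ->
  (forall x, P x -> P (x * raise)) -> (forall x, P x -> P (x * lower)) ->
  forall z, P z.
Proof.
move=> P0 PD PZ P1 Pv Pr Pl z; case: (to_preproj_surj z) => x <-.
(* Needed to undo the sign in [down_path]. *)
have PN y : P y -> P (- y).
  move=> Py; have := PZ (-1) _ Py; rewrite -scalC.
  suff -> : scal (-1) = -1 by rewrite mulN1r.
  by apply/eqP; rewrite -addr_eq0 -scal1 -scalD addNr scal0.
elim/path_algebra_ind: x => [|x y Px Py|c x Px||x a Px|x b Px].
- by rewrite to_preproj0.
- by rewrite to_preprojD; apply: PD.
- by rewrite -scal_to_preproj scalC; apply: PZ.
- by rewrite to_preproj1.
- by rewrite to_preprojM -[to_preproj (pbasis _ _)]/(@idem k Q a) -vtxE; apply: Pv.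
have [y [->|->]] : exists y, b = up_arrow y \/ b = down_arrow y.
  case: b => y; exists y; rewrite /up_arrow /down_arrow.
    by case: (o y); [left | right].
  by case: (o y); [right | left].
- by rewrite to_preprojM -[pbasis _ _]/(up_path y) up_pathE mulrA; apply/Pr/Pv.
have Pd : P (to_preproj x * to_preproj (down_path y)).
  by rewrite down_pathE mulrA; apply/Pl/Pv.
rewrite to_preprojM; move: Pd; rewrite /down_path to_preprojM.
case: (o y); first by rewrite to_preproj1 mul1r.
rewrite -[-1]add0r to_preprojB to_preproj0 to_preproj1 sub0r mulN1r mulrN.
by move/PN; rewrite opprK.
Qed.

End TypeAGeneratorRelations.

(** * The monomial basis of the preprojective algebra *)

Section Boxes.
Variable n : nat.

(* (d, x, s) stands for e_d raise^(s - d) lower^x, which ends at the vertex s - x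
   and is nonzero exactly when x <= d <= s < n. *)
Definition box : predArgType :=
  {b : 'I_n * 'I_n * 'I_n | (b.1.2 <= b.1.1 <= b.2)%N}.
HB.instance Definition _ := Finite.on box.

Definition bd (b : box) : nat := (val b).1.1.
Definition bx (b : box) : nat := (val b).1.2.
Definition bs (b : box) : nat := (val b).2.

(** [None] stands for a zero monomial, so that multiplication by a generator becomes a partial
    function on boxes. *)
Definition mk_box (d x s : nat) : option box :=
  [pick b : box | [&& bd b == d, bx b == x & bs b == s]].

Lemma box_inj (b c : box) : bd b = bd c -> bx b = bx c -> bs b = bs c -> b = c.
Proof.
case: b c => [[[d x] s] h] [[[d' x'] s'] h']; rewrite /bd /bx /bs /= => e1 e2 e3.
by apply: val_inj => /=; congr (_, _, _); apply: val_inj.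
Qed.

Lemma box_bounds (b : box) : (bx b <= bd b <= bs b)%N && (bs b < n)%N.
Proof. by rewrite (valP b) ltn_ord. Qed.

Lemma mk_boxK b : mk_box (bd b) (bx b) (bs b) = Some b.
Proof.
rewrite /mk_box; case: pickP => [c /and3P[/eqP e1 /eqP e2 /eqP e3]|/(_ b)].
  by rewrite (box_inj e1 e2 e3).
by rewrite !eqxx.
Qed.

Lemma mk_boxP d x s b : mk_box d x s = Some b -> [/\ bd b = d, bx b = x & bs b = s].
Proof. by rewrite /mk_box; case: pickP => // c /and3P[/eqP ? /eqP ? /eqP ?] [<-]. Qed.

Lemma mk_boxE d x s b :
  (mk_box d x s == Some b) = [&& bd b == d, bx b == x & bs b == s].
Proof.
apply/eqP/and3P => [/mk_boxP[-> -> ->] //|[/eqP <- /eqP <- /eqP <-]].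
exact: mk_boxK.
Qed.

Lemma mk_box_ex d x s : (x <= d)%N -> (d <= s)%N -> (s < n)%N ->
  exists b, [/\ mk_box d x s = Some b, bd b = d, bx b = x & bs b = s].
Proof.
move=> xd ds sn; have dn := leq_ltn_trans ds sn; have xn := leq_ltn_trans xd dn.
pose b0 := (Ordinal dn, Ordinal xn, Ordinal sn).
have h : (b0.1.2 <= b0.1.1 <= b0.2)%N by rewrite /= xd ds.
pose b : box := exist _ b0 h.
by exists b; split=> //; rewrite -[d]/(bd b) -[x]/(bx b) -[s]/(bs b) mk_boxK.
Qed.

Lemma mk_box_none d x s : ~~ [&& x <= d, d <= s & s < n]%N -> mk_box d x s = None.
Proof.
move=> h; case e: (mk_box d x s) => [b|] //; case/mk_boxP: e h => <- <- <-.
by have /andP[/andP[-> ->] ->] := box_bounds b.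
Qed.

Definition at_vertex (a : 'I_n) (b : box) : option box :=
  if (bs b - bx b == a)%N then Some b else None.
Definition step_up (b : box) := mk_box (bd b) (bx b) (bs b).+1.
Definition step_down (b : box) := mk_box (bd b) (bx b).+1 (bs b).

(** The boxes of one row form a rectangle: if the diagonal neighbour of b exists, so do both
    intermediate boxes. Hence the two orders of stepping agree even where they are undefined, and
    the matrices of the two steps commute. *)
Lemma step_up_down b : obind step_down (step_up b) = mk_box (bd b) (bx b).+1 (bs b).+1.
Proof.
rewrite /step_up; case e: (mk_box _ _ _) => [c|] /=.
  by case/mk_boxP: e => e1 e2 e3; rewrite /step_down e1 e2 e3.
have hb := box_bounds b; rewrite mk_box_none //; apply/negP => h.
have [| | |c [ec _ _ _]] := @mk_box_ex (bd b) (bx b) (bs b).+1; [lia|lia|lia|].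
by rewrite e in ec.
Qed.

Lemma step_down_up b : obind step_up (step_down b) = mk_box (bd b) (bx b).+1 (bs b).+1.
Proof.
rewrite /step_down; case e: (mk_box _ _ _) => [c|] /=.
  by case/mk_boxP: e => e1 e2 e3; rewrite /step_up e1 e2 e3.
have hb := box_bounds b; rewrite mk_box_none //; apply/negP => h.
have [| | |c [ec _ _ _]] := @mk_box_ex (bd b) (bx b).+1 (bs b); [lia|lia|lia|].
by rewrite e in ec.
Qed.
End Boxes.

(** Turns a sum over arrows into a sum over vertices, where the idempotents add up to 1. *)
Lemma sum_edge_lo (V : zmodType) n (F : 'I_n -> V) :
  (forall a : 'I_n, (n <= a.+1)%N -> F a = 0) ->
  \sum_(y : 'I_n.-1) F (edge_lo y) = \sum_a F a.
Proof.
case: n F => [|m] F h; first by rewrite !big_ord0.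
rewrite big_ord_recr /= h ?addr0 //; apply: eq_bigr => y _.
by congr F; apply: val_inj.
Qed.

Lemma sum_edge_hi (V : zmodType) n (F : 'I_n -> V) :
  (forall a : 'I_n, a = 0%N :> nat -> F a = 0) ->
  \sum_(y : 'I_n.-1) F (edge_hi y) = \sum_a F a.
Proof.
case: n F => [|m] F h; first by rewrite !big_ord0.
rewrite big_ord_recl /= h ?add0r //; apply: eq_bigr => y _.
by congr F; apply: val_inj.
Qed.

Section BoxRepresentation.
Variables (k : fieldType) (n : nat) (o : 'I_n.-1 -> bool).
Let Q := quiverA o.
Let Qbar := double_quiver Q.
Local Notation PA := (path_algebra k Qbar).
Local Notation Pi := (preproj k Q).
Local Notation N := #|box n|.

Definition up_mx : 'M[k]_N := pfun_mx k (@step_up n).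
Definition down_mx : 'M[k]_N := pfun_mx k (@step_down n).
Definition vtx_mx (a : vertex Qbar) : 'M[k]_N := pfun_mx k (@at_vertex n a).

Lemma up_downmx : up_mx *m down_mx = down_mx *m up_mx.
Proof.
by rewrite !pfun_mxM; apply: eq_pfun_mx => b; rewrite step_up_down step_down_up.
Qed.

Lemma vtx_mxM a b : vtx_mx a *m vtx_mx b = if a == b then vtx_mx a else 0.
Proof.
rewrite pfun_mxM; case: eqVneq => [<-|ab].
  by apply: eq_pfun_mx => c; rewrite /at_vertex; case h: (_ == _); rewrite //= h.
apply: pfun_mx0 => c; rewrite /at_vertex; case: (bs c - bx c =P a)%N => //= e.
by rewrite e; case: (a =P b :> nat) => // e'; case/eqP: ab; apply: val_inj.
Qed.

Lemma sum_vtx_mx : \sum_a vtx_mx a = 1%:M.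
Proof.
apply/matrixP=> s t; rewrite summxE mxE; set b : box n := enum_val s.
have hb : (bs b - bx b < n)%N by have := box_bounds b; lia.
rewrite (bigD1 (Ordinal hb : 'I_n)) //= big1 ?addr0 => [|a ne].
  by rewrite mxE /at_vertex -/b eqxx /= (inj_eq (@Some_inj _)) (inj_eq enum_val_inj).
rewrite mxE /at_vertex -/b; case: (bs b - bx b =P a)%N => // e; case/eqP: ne.
by apply: val_inj; rewrite /= e.
Qed.

Lemma vtx_up_mx (y : 'I_n.-1) :
  vtx_mx (edge_lo y) *m up_mx = up_mx *m vtx_mx (edge_hi y).
Proof.
rewrite !pfun_mxM; apply: eq_pfun_mx => b; rewrite /at_vertex /=.
have hb := box_bounds b; rewrite /step_up.
case e: (mk_box _ _ _) => [c|] /=; last by case: eqP => //= _; rewrite /step_up e.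
case/mk_boxP: (e) => e1 e2 e3; rewrite e2 e3 subSn; last lia.
by rewrite eqSS; case: eqP => //= _; rewrite /step_up e.
Qed.

Lemma vtx_down_mx (y : 'I_n.-1) :
  vtx_mx (edge_hi y) *m down_mx = down_mx *m vtx_mx (edge_lo y).
Proof.
rewrite !pfun_mxM; apply: eq_pfun_mx => b; rewrite /at_vertex /=.
have hb := box_bounds b; rewrite /step_down.
case e: (mk_box _ _ _) => [c|] /=; last by case: eqP => //= _; rewrite /step_down e.
case/mk_boxP: (e) => e1 e2 e3; have hc := box_bounds c; rewrite e2 e3.
have -> : ((bs b - (bx b).+1 == y) = (bs b - bx b == y.+1))%N by lia.
by case: eqP => //= _; rewrite /step_down e.
Qed.

Definition edge_of (z : arrow Qbar) : 'I_n.-1 :=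
  match z with inl y => y | inr y => y end.
Definition is_up (z : arrow Qbar) : bool :=
  match z with inl y => o y | inr y => ~~ o y end.

(** The sign repeats the one in [down_path], so that [path_lower] acts by [down_mx] itself. *)
Definition arrow_mx (z : arrow Qbar) : 'M[k]_N :=
  if is_up z then vtx_mx (edge_lo (edge_of z)) *m up_mx
  else (if o (edge_of z) then 1 else -1)
       *: (vtx_mx (edge_hi (edge_of z)) *m down_mx).

Lemma box_is_rep : is_rep vtx_mx arrow_mx.
Proof.
have srcE (z : arrow Qbar) : src z =
    (if is_up z then edge_lo (edge_of z) else edge_hi (edge_of z)) :> 'I_n.
  by case: z => y /=; case: (o y).
have tgtE (z : arrow Qbar) : tgt z =
    (if is_up z then edge_hi (edge_of z) else edge_lo (edge_of z)) :> 'I_n.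
  by case: z => y /=; case: (o y).
split; [exact: vtx_mxM | exact: sum_vtx_mx | move=> z | move=> z].
  rewrite /arrow_mx srcE; case: (is_up z); rewrite -?scalemxAr mulmxA vtx_mxM eqxx //.
rewrite /arrow_mx tgtE; case: (is_up z).
  by rewrite vtx_up_mx -mulmxA vtx_mxM eqxx.
by rewrite -scalemxAl vtx_down_mx -mulmxA vtx_mxM eqxx.
Qed.

Definition box_hom : {rmorphism PA -> 'M[k]_N} := rep_hom box_is_rep.

Lemma box_hom_vtx a : box_hom (pbasis k (lazy_path a)) = vtx_mx a.
Proof. exact: rep_hom_basis. Qed.

Lemma box_hom_arrow z : box_hom (pbasis k (arrow_path z)) = arrow_mx z.
Proof. by rewrite [LHS]rep_hom_basis (arrow_path_mx box_is_rep). Qed.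

Lemma box_homZ c (x : PA) : box_hom (c *: x) = c *: box_hom x.
Proof. exact: linearZZ (lin_ext (path_mx vtx_mx arrow_mx)) c x. Qed.

Lemma box_hom_up y : box_hom (up_path k o y) = vtx_mx (edge_lo y) *m up_mx.
Proof.
rewrite /up_path box_hom_arrow /arrow_mx /up_arrow.
by case e: (o y); rewrite /= e.
Qed.

Lemma box_hom_down y : box_hom (down_path k o y) = vtx_mx (edge_hi y) *m down_mx.
Proof.
rewrite /down_path rmorphM box_hom_arrow /arrow_mx /down_arrow.
case e: (o y); rewrite /= e /=; first by rewrite rmorph1 mul1r scale1r.
by rewrite rmorphN rmorph1 mulN1r scaleN1r opprK.
Qed.

Lemma box_hom_raise : box_hom (path_raise k o) = up_mx.
Proof.
rewrite rmorph_sum; under eq_bigr do rewrite box_hom_up.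
rewrite (@sum_edge_lo _ n (fun a => vtx_mx a *m up_mx)).
  by rewrite -mulmx_suml sum_vtx_mx mul1mx.
(* A box ending at the last vertex has s = n - 1, so it has no step up. *)
move=> a ha; rewrite pfun_mxM; apply: pfun_mx0 => b; rewrite /at_vertex.
case: eqP => //= e; have := box_bounds b.
by move=> hb; rewrite /step_up mk_box_none //; apply/negP; lia.
Qed.

Lemma box_hom_lower : box_hom (path_lower k o) = down_mx.
Proof.
rewrite rmorph_sum; under eq_bigr do rewrite box_hom_down.
rewrite (@sum_edge_hi _ n (fun a => vtx_mx a *m down_mx)).
  by rewrite -mulmx_suml sum_vtx_mx mul1mx.
move=> a ha; rewrite pfun_mxM; apply: pfun_mx0 => b; rewrite /at_vertex.
case: eqP => //= e; have := box_bounds b.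
by move=> hb; rewrite /step_down mk_box_none //; apply/negP; lia.
Qed.

Lemma box_hom_rel r : r = preproj_rel k Q -> box_hom r = 0.
Proof.
move=> ->; rewrite preproj_relE rmorphB !rmorphM box_hom_raise box_hom_lower.
by rewrite -[_ * _]/(_ *m _) up_downmx subrr.
Qed.

Definition preproj_hom : {rmorphism Pi -> 'M[k]_N} := quot_lift box_hom_rel.

Lemma preproj_hom_to (x : PA) : preproj_hom (to_preproj x) = box_hom x.
Proof. exact: quot_liftE. Qed.

Lemma preproj_hom_raise : preproj_hom (raise k o) = up_mx.
Proof. by rewrite raiseE preproj_hom_to box_hom_raise. Qed.
Lemma preproj_hom_lower : preproj_hom (lower k o) = down_mx.
Proof. by rewrite lowerE preproj_hom_to box_hom_lower. Qed.
Lemma preproj_hom_vtx (a : 'I_n) : preproj_hom (vtx k o a) = vtx_mx a.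
Proof. by rewrite vtxE preproj_hom_to box_hom_vtx. Qed.
Lemma preproj_hom_scal c : preproj_hom (scal o c) = c%:M.
Proof. by rewrite scalE preproj_hom_to box_homZ rmorph1 scalemx1. Qed.

End BoxRepresentation.

(* The coefficient of e_d raise^(s - d) lower^x in z, cf. preproj_span. *)
HB.lock Definition bcoef (k : fieldType) (n : nat) (o : 'I_n.-1 -> bool)
    (z : preproj k (quiverA o)) (d x s : nat) : k :=
  if mk_box n d 0 d is Some b0 then
  if mk_box n d x s is Some b then
    preproj_hom k o z (enum_rank b0) (enum_rank b)
  else 0 else 0.

Section BoxCoefficients.
Variables (k : fieldType) (n : nat) (o : 'I_n.-1 -> bool).
Local Notation Pi := (preproj k (quiverA o)).
Local Notation N := #|box n|.
Local Notation preproj_hom := (preproj_hom k o).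
Implicit Types z : Pi.

Lemma bcoefD d x s : {morph (fun z : Pi => bcoef z d x s) : z z' / z + z'}.
Proof.
move=> z z'; rewrite bcoef.unlock rmorphD.
case: (mk_box _ _ _ _) => [b0|]; last by rewrite addr0.
by case: (mk_box _ _ _ _) => [b|]; rewrite ?addr0 // mxE.
Qed.

Lemma bcoef0 d x s : bcoef (0 : Pi) d x s = 0.
Proof. by rewrite bcoef.unlock rmorph0; do 2 case: (mk_box _ _ _ _) => // ?; rewrite mxE. Qed.

Lemma bcoef_out z d x s : ~~ [&& x <= d, d <= s & s < n]%N -> bcoef z d x s = 0.
Proof. by move=> h; rewrite bcoef.unlock (mk_box_none h); case: (mk_box _ _ _ _). Qed.

Lemma mulmx_pfun (A : 'M[k]_N) (h : box n -> option (box n)) i b :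
  (A *m pfun_mx k h) i (enum_rank b) = \sum_(g | h g == Some b) A i (enum_rank g).
Proof.
rewrite mxE (reindex (fun g : box n => enum_rank g)) /=; last first.
  by exists enum_val => s _; rewrite ?enum_rankK ?enum_valK.
rewrite [RHS]big_mkcond; apply: eq_bigr => g _; rewrite mxE !enum_rankK.
by case: (h g == _); rewrite ?mulr1 ?mulr0.
Qed.

Lemma bcoef_raise0 z d x : bcoef (z * raise k o) d x 0 = 0.
Proof.
rewrite bcoef.unlock; case e0: (mk_box n d 0 d) => [b0|] //.
case e: (mk_box n d x 0) => [b|] //.
rewrite rmorphM preproj_hom_raise -[_ * _]/(_ *m _) mulmx_pfun big1 // => g /eqP.
by rewrite /step_up => /mk_boxP[_ _ e3]; case/mk_boxP: e => _ _; rewrite e3.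
Qed.

Lemma bcoef_raise z d x s :
  bcoef (z * raise k o) d x s.+1 = if (s.+1 < n)%N then bcoef z d x s else 0.
Proof.
case: ifP => sn; last by apply: bcoef_out; rewrite sn !andbF.
rewrite bcoef.unlock; case e0: (mk_box n d 0 d) => [b0|] //.
case e: (mk_box n d x s.+1) => [b|]; last first.
  rewrite mk_box_none //; apply/negP => h.
  have [| | |c [ec _ _ _]] := @mk_box_ex n d x s.+1; [lia|lia|lia|].
  by rewrite ec in e.
rewrite rmorphM preproj_hom_raise -[_ * _]/(_ *m _) mulmx_pfun.
case/mk_boxP: e => h1 h2 h3.
(* The only possible preimage of b under [step_up] is (d, x, s); when s + 1 = d it is not a box, and
   the coefficient there is 0 by convention. *)
have eb g : (step_up g == Some b) = (mk_box n d x s == Some g).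
  by rewrite /step_up !mk_boxE h1 h2 h3 eqSS (eq_sym d) (eq_sym x) (eq_sym s).
move: (preproj_hom z) => A; under eq_bigl do rewrite eb.
case: (mk_box n d x s) => [g|]; last by rewrite big_pred0_eq.
by apply: big_pred1 => i; rewrite (inj_eq (@Some_inj _)) eq_sym.
Qed.

Lemma bcoef_lower0 z d s : bcoef (z * lower k o) d 0 s = 0.
Proof.
rewrite bcoef.unlock; case e0: (mk_box n d 0 d) => [b0|] //.
case e: (mk_box n d 0 s) => [b|] //.
rewrite rmorphM preproj_hom_lower -[_ * _]/(_ *m _) mulmx_pfun big1 // => g /eqP.
by rewrite /step_down => /mk_boxP[_ e3 _]; case/mk_boxP: e => _; rewrite e3.
Qed.

Lemma bcoef_lower z d x s :
  bcoef (z * lower k o) d x.+1 s = if (x.+1 <= d)%N then bcoef z d x s else 0.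
Proof.
case: ifP => sn; last by apply: bcoef_out; rewrite sn.
rewrite bcoef.unlock; case e0: (mk_box n d 0 d) => [b0|] //.
case e: (mk_box n d x.+1 s) => [b|]; last first.
  rewrite mk_box_none //; apply/negP => h.
  have [| | |c [ec _ _ _]] := @mk_box_ex n d x.+1 s; [lia|lia|lia|].
  by rewrite ec in e.
rewrite rmorphM preproj_hom_lower -[_ * _]/(_ *m _) mulmx_pfun.
case/mk_boxP: e => h1 h2 h3.
have eb g : (step_down g == Some b) = (mk_box n d x s == Some g).
  by rewrite /step_down !mk_boxE h1 h2 h3 eqSS (eq_sym d) (eq_sym x) (eq_sym s).
move: (preproj_hom z) => A; under eq_bigl do rewrite eb.
case: (mk_box n d x s) => [g|]; last by rewrite big_pred0_eq.
by apply: big_pred1 => i; rewrite (inj_eq (@Some_inj _)) eq_sym.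
Qed.

Lemma bcoef_vtx z a d x s :
  bcoef (z * vtx k o a) d x s = if (s - x == a)%N then bcoef z d x s else 0.
Proof.
have [an|an] := ltnP a n; last first.
  rewrite vtx_out // mulr0 bcoef0; case: eqP => // e; rewrite bcoef_out //.
  by apply/negP; lia.
rewrite bcoef.unlock -[a]/(val (Ordinal an)).
case e0: (mk_box n d 0 d) => [b0|]; last by case: ifP.
case e: (mk_box n d x s) => [b|]; last by case: ifP.
rewrite rmorphM preproj_hom_vtx -[_ * _]/(_ *m _) mulmx_pfun.
case/mk_boxP: e => h1 h2 h3.
have eb g : (at_vertex (Ordinal an) g == Some b) = (s - x == a)%N && (g == b).
  rewrite /at_vertex; case: ifP => [/eqP ea|ea] /=.
    rewrite (inj_eq (@Some_inj _)); case: eqP => [eg|]; rewrite ?andbF // andbT.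
    by rewrite -h2 -h3 -eg; apply/esym/eqP.
  by case: (g =P b) => [eg|]; rewrite ?andbF // -h2 -h3 -eg ea.
move: (preproj_hom z) => A; under eq_bigl do rewrite eb.
by case: ifP => _; rewrite ?big_pred0_eq ?big_pred1_eq.
Qed.

Lemma bcoef_scal z c d x s : bcoef (z * scal o c) d x s = c * bcoef z d x s.
Proof.
rewrite bcoef.unlock; case: (mk_box _ _ _ _) => [b0|]; last by rewrite mulr0.
case: (mk_box _ _ _ _) => [b|]; last by rewrite mulr0.
rewrite rmorphM preproj_hom_scal -[_ * _]/(_ *m _).
by rewrite -scalemx1 -scalemxAr mulmx1 mxE.
Qed.

Lemma bcoef1 d x s : bcoef (1 : Pi) d x s = ((x == 0) && (s == d) && (d < n))%N%:R.
Proof.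
rewrite bcoef.unlock rmorph1; case e0: (mk_box n d 0 d) => [b0|]; last first.
  case: ltnP => dn; last by rewrite andbF.
  by have [|||c [ec _ _ _]] // := @mk_box_ex n d 0 d; rewrite ec in e0.
have dn : (d < n)%N by case/mk_boxP: e0 => _ _ <-; apply: ltn_ord.
rewrite dn andbT; case e: (mk_box n d x s) => [b|]; last first.
  by case: eqP => // ex; case: eqP => // es; rewrite ex es e0 in e.
rewrite mxE (inj_eq enum_rank_inj).
case/mk_boxP: e0 => h1 h2 h3; case/mk_boxP: e => g1 g2 g3.
congr (_%:R); congr nat_of_bool; apply/eqP/andP => [eb|[/eqP ex /eqP es]].
  by rewrite -g2 -g3 -eb h2 h3.
by apply: box_inj; congruence.
Qed.

End BoxCoefficients.

Lemma sum_shift (V : nmodType) n (F G : nat -> V) :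
  F 0%N = 0 -> (forall s, (s.+1 < n)%N -> F s.+1 = G s) -> G n.-1 = 0 ->
  \sum_(s < n) F s = \sum_(s < n) G s.
Proof.
case: n => [|n] F0 FG Gn; first by rewrite !big_ord0.
rewrite big_ord_recl big_ord_recr /= F0 Gn add0r addr0.
by apply: eq_bigr => s _; apply: FG; rewrite ltnS.
Qed.

HB.lock Definition mono (k : fieldType) (n : nat) (o : 'I_n.-1 -> bool)
    (d y x : nat) : preproj k (quiverA o) :=
  vtx k o d * raise k o ^+ y * lower k o ^+ x.

Section Monomials.
Variables (k : fieldType) (n : nat) (o : 'I_n.-1 -> bool).
Let Q := quiverA o.
Local Notation Pi := (preproj k Q).
Local Notation vtx := (vtx k o).
Local Notation raise := (raise k o).
Local Notation lower := (lower k o).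
Local Notation scal := (@scal k n o).
Local Notation mono := (mono k o).

Lemma monoE d y x : mono d y x = vtx d * raise ^+ y * lower ^+ x.
Proof. by rewrite mono.unlock. Qed.

Lemma vtx_raiseX d y : vtx d * raise ^+ y = raise ^+ y * vtx (d + y).
Proof.
elim: y d => [|y IH] d; first by rewrite addn0 mul1r mulr1.
by rewrite exprS mulrA vtx_raise -mulrA IH addSnnS mulrA.
Qed.

Lemma vtx_lowerX d x : vtx (d + x) * lower ^+ x = lower ^+ x * vtx d.
Proof.
elim: x d => [|x IH] d; first by rewrite addn0 mul1r mulr1.
by rewrite exprS mulrA addnS vtx_lower -mulrA IH mulrA.
Qed.

Lemma mono_lower d y x : mono d y x * lower = mono d y x.+1.
Proof. by rewrite !monoE exprSr mulrA. Qed.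

Lemma mono_raise d y x : mono d y x * raise = mono d y.+1 x.
Proof.
rewrite !monoE exprSr -!mulrA; congr (_ * (_ * _)).
by apply/esym/commrX; exact: raise_lower.
Qed.

Lemma mono_end d y x : (x <= d + y)%N ->
  mono d y x = raise ^+ y * lower ^+ x * vtx (d + y - x).
Proof.
by move=> h; rewrite monoE vtx_raiseX -{1}(subnK h) -mulrA vtx_lowerX mulrA.
Qed.

Lemma mono_vtx d y x m : (x <= d + y)%N ->
  mono d y x * vtx m = if (d + y - x == m)%N then mono d y x else 0.
Proof.
by move=> h; rewrite mono_end // -(mulrA _ (vtx _) (vtx m)) vtxM; case: ifP; rewrite ?mulr0.
Qed.

(** If d + y >= n, raising leaves the quiver. If x > d, the powers commute, and lowering first from
    the vertex d passes below the vertex 0. *)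
Lemma mono_out d y x : ~~ ((x <= d) && (d + y < n))%N -> mono d y x = 0.
Proof.
rewrite negb_and -!ltnNge ltnS => /orP[h|h]; last first.
  by rewrite monoE vtx_raiseX vtx_out // mulr0 mul0r.
rewrite monoE -mulrA.
have -> : raise ^+ y * lower ^+ x = lower ^+ x * raise ^+ y.
  by apply/commrX/commr_sym/commrX/commr_sym/raise_lower.
rewrite mulrA.
have -> : x = (d + (x - d.+1).+1)%N by lia.
rewrite exprD exprS !mulrA -{1}[d]add0n vtx_lowerX.
by rewrite -(mulrA _ (vtx 0)) vtx0_lower mulr0 !mul0r.
Qed.

(** No rewriting of paths to normal form is needed: the right side, as a function of z, respects
    every operation of [preproj_ind]. Multiplication by [raise] or [lower] shifts the sum by one in
    s or in x, and the terms lost at the boundary vanish. *)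
Lemma preproj_span (z : Pi) :
  z = \sum_(d < n) \sum_(x < n) \sum_(s < n) mono d (s - d) x * scal (bcoef z d x s).
Proof.
elim/preproj_ind: z => [|z z' IHz IHz'|c z IH||z a IH|z IH|z IH].
- by do 3 (rewrite big1 // => ? _); rewrite bcoef0 scal0 mulr0.
- rewrite {1}IHz {1}IHz'; do 3 (rewrite -big_split; apply: eq_bigr => ? _).
  by rewrite bcoefD scalD mulrDr.
- rewrite {1}IH; do 3 (rewrite mulr_suml; apply: eq_bigr => ? _).
  by rewrite bcoef_scal [c * _]mulrC scalM mulrA.
- rewrite -[LHS](sum_vtx k o); apply: eq_bigr => d _.
  have n0 : (0 < n)%N by apply: leq_ltn_trans (ltn_ord d).
  rewrite (bigD1 (Ordinal n0)) //= [X in _ + X]big1 ?addr0 => [|x x0]; last first.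
    rewrite big1 // => s _; rewrite bcoef1.
    by rewrite -val_eqE /= in x0; rewrite (negbTE x0) scal0 mulr0.
  rewrite (bigD1 d) //= big1 ?addr0 => [|s sd]; last first.
    by rewrite bcoef1 eqxx (inj_eq val_inj) (negbTE sd) scal0 mulr0.
  by rewrite bcoef1 !eqxx ltn_ord scal1 subnn monoE !expr0 !mulr1.
- rewrite {1}IH; do 3 (rewrite mulr_suml; apply: eq_bigr => ? _).
  rewrite -mulrA scalC mulrA bcoef_vtx; set d := nat_of_ord _; set s := nat_of_ord _.
  set x := nat_of_ord _.
  have [h|h] := boolP [&& x <= d, d <= s & s < n]%N; last first.
    by rewrite (bcoef_out _ h) if_same scal0 !mulr0.
  rewrite mono_vtx; last by lia.
  have -> : (d + (s - d) = s)%N by lia.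
  by case: ifP => _; [reflexivity | rewrite scal0 mul0r mulr0].
- rewrite {1}IH; do 2 (rewrite mulr_suml; apply: eq_bigr => ? _).
  rewrite mulr_suml; set d := nat_of_ord _; set x := nat_of_ord _; apply: esym.
  pose F s := mono d (s - d) x * scal (bcoef (z * raise) d x s).
  pose G s := mono d (s - d) x * scal (bcoef z d x s) * raise.
  apply: (@sum_shift _ n F G) => [|s sn|].
  - by rewrite /F bcoef_raise0 scal0 mulr0.
  - rewrite /F /G bcoef_raise sn -mulrA scalC mulrA mono_raise.
    have [h|h] := leqP d s; first by rewrite subSn.
    by rewrite bcoef_out; [rewrite scal0 !mulr0 | apply/negP; lia].
  - rewrite /G -mulrA scalC mulrA mono_raise.
    have [h|h] := leqP d n.-1.
      by rewrite mono_out; [rewrite !mul0r | apply/negP; lia].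
    by rewrite bcoef_out; [rewrite scal0 !mulr0 | apply/negP; lia].
- rewrite {1}IH; rewrite mulr_suml; apply: eq_bigr => ? _.
  rewrite mulr_suml exchange_big /=.
  under eq_bigr do rewrite mulr_suml; rewrite exchange_big /=.
  apply: eq_bigr => ? _; set d := nat_of_ord _; set s := nat_of_ord _; apply: esym.
  pose F x := mono d (s - d) x * scal (bcoef (z * lower) d x s).
  pose G x := mono d (s - d) x * scal (bcoef z d x s) * lower.
  apply: (@sum_shift _ n F G) => [|x sn|].
  - by rewrite /F bcoef_lower0 scal0 mulr0.
  - rewrite /F /G bcoef_lower -mulrA scalC mulrA mono_lower.
    have [h|h] := leqP x.+1 d; first reflexivity.
    by rewrite mono_out; [rewrite !mul0r | apply/negP; lia].
  - rewrite /G -mulrA scalC mulrA mono_lower.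
    by rewrite mono_out; [rewrite !mul0r | apply/negP; lia].
Qed.

End Monomials.

(** * The ideals I(w) *)

Section WordIdeals.
Variables (k : fieldType) (n : nat) (o : 'I_n.-1 -> bool).
Local Notation Q := (quiverA o).
Local Notation Pi := (preproj k Q).
Local Notation vtx := (vtx k o).
Local Notation raise := (raise k o).
Local Notation lower := (lower k o).
Local Notation scal := (@scal k n o).
Local Notation mono := (mono k o).
Local Notation word_ideal := (@word_ideal k Q).
Local Notation vertex_ideal := (@vertex_ideal k Q).
Implicit Types (u : seq 'I_n) (w : 'S_n.+1) (z : Pi).

(* The boxes whose monomials span a complement of I(w): in row d they form the
   Young diagram of the d + 1-element set {w(1), ..., w(d + 1)}. *)
Definition below w (d x s : nat) : bool := (x < cnt w d (s.+1 - x))%N.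

(** With [below_lower], this says that stepping up or down never re-enters the diagram, which makes
    [vanishes_below] stable under right multiplication. *)
Lemma below_raise w d x s : below w d x s.+1 -> below w d x s.
Proof.
rewrite /below; have := cnt_step w d (s.+1 - x).
(* The first alternative is the truncated subtraction, for x beyond s + 1. *)
have [->|->] : (s.+2 - x = s.+1 - x \/ s.+2 - x = (s.+1 - x).+1)%N by lia.
  by lia.
by lia.
Qed.

Lemma below_lower w d x s : below w d x.+1 s -> below w d x s.
Proof.
rewrite /below subSS; have := cnt_step w d (s - x).
have [->|->] : (s.+1 - x = s - x \/ s.+1 - x = (s - x).+1)%N by lia.
  by lia.
by lia.
Qed.

Definition vanishes_below w z : Prop :=
  forall d x s, below w d x s -> bcoef z d x s = 0.

Lemma vanishes_belowD w z z' :
  vanishes_below w z -> vanishes_below w z' -> vanishes_below w (z + z').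
Proof. by move=> h h' d x s b; rewrite bcoefD h // h' // addr0. Qed.

Lemma vanishes_below0 w : vanishes_below w 0.
Proof. by move=> d x s _; apply: bcoef0. Qed.

Lemma vanishes_belowMr w z z' : vanishes_below w z -> vanishes_below w (z * z').
Proof.
move=> hz; elim/preproj_ind: z' => [|x y hx hy|c x hx||x a hx|x hx|x hx].
- by rewrite mulr0; apply: vanishes_below0.
- by rewrite mulrDr; apply: vanishes_belowD.
- by rewrite mulrA => d y s b; rewrite bcoef_scal hx // mulr0.
- by rewrite mulr1.
- by rewrite mulrA => d y s b; rewrite bcoef_vtx hx // if_same.
- rewrite mulrA => d y [|s] b; first by rewrite bcoef_raise0.
  by rewrite bcoef_raise hx ?if_same //; apply: below_raise.
rewrite mulrA => d [|y] s b; first by rewrite bcoef_lower0.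
by rewrite bcoef_lower hx ?if_same //; apply: below_lower.
Qed.

Lemma vanishes_below_word u z : z \in word_ideal u -> vanishes_below (word_perm u) z.
Proof.
elim: u z => [|a u IH] z.
  (* For the identity permutation no genuine box is [below], in accordance with I(1) = Pi. *)
  move=> _ d x s; rewrite /below => h; apply: bcoef_out.
  apply/negP => hb; have dn : (d <= n)%N by lia.
  by move: h; rewrite /= cnt1 //; lia.
move=> /asboolP[m [f [g [fg ->]]]].
elim/big_ind: _ => [||t _]; [exact: vanishes_below0 | exact: vanishes_belowD |].
have [/IH hf /ideal_genP[r [p [q [p' [hq ->]]]]]] := fg t.
rewrite mulr_sumr; elim/big_ind: _ => [||v _];
  [exact: vanishes_below0 | exact: vanishes_belowD |].
rewrite !mulrA; apply: vanishes_belowMr; rewrite hq.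
have hfp := vanishes_belowMr (p v) hf.
move: (f t * p v) hfp => y hy d x s b.
(* Subtracting y e_a clears the coefficients of y at boxes ending at a and keeps the others, and
   away from a the diagrams of u and a :: u agree. *)
rewrite -vtxE mulrBr mulr1 -mulrN1.
have -> : bcoef (y + y * vtx a * -1) d x s = bcoef y d x s - bcoef (y * vtx a) d x s.
  rewrite bcoefD; congr (_ + _); rewrite -[RHS]mulN1r -bcoef_scal; congr bcoef.
  congr (_ * _); apply/eqP; rewrite eq_sym -addr_eq0 -(scal1 k o) -scalD addNr.
  by rewrite scal0.
rewrite bcoef_vtx; have [e|ne] := eqVneq (s - x)%N a; first by rewrite subrr.
rewrite subr0; have [sx|sx] := ltnP s x.
  by apply: bcoef_out; apply/negP; lia.
apply: hy; move: b; rewrite /below /= cnt_refl_neq //.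
by rewrite subSn // eqSS.
Qed.

Lemma word_ideal_cons u a z z' :
  z \in word_ideal u -> z' \in vertex_ideal a -> z * z' \in word_ideal (a :: u).
Proof.
move=> h h'; apply/asboolP; exists 1%N, (fun=> z), (fun=> z').
by split=> //; rewrite big_ord1.
Qed.

(** This and the next two facts are instances of one principle: I_a contains every path that visits
    a vertex other than a. *)
Lemma vtx_vertex_ideal (a : 'I_n) (m : nat) : m != a -> vtx m \in vertex_ideal a.
Proof.
move=> ma; apply/ideal_genP.
exists 1%N, (fun=> vtx m), (fun=> 1 - @idem k Q a), (fun=> 1).
split=> //; rewrite big_ord1 mulr1 -vtxE mulrBr mulr1 vtxM (negbTE ma).
by rewrite subr0.
Qed.

Lemma raise_vertex_ideal (a : 'I_n) : raise * vtx a \in vertex_ideal a.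
Proof.
apply/ideal_genP; exists 1%N, (fun=> 1), (fun=> 1 - @idem k Q a), (fun=> raise * vtx a).
split=> //; rewrite big_ord1 mul1r -vtxE mulrBl mul1r mulrA vtx_raise -mulrA vtxM.
by rewrite gtn_eqF // mulr0 subr0.
Qed.

Lemma lower_vertex_ideal (a : 'I_n) : lower * vtx a \in vertex_ideal a.
Proof.
apply/ideal_genP; exists 1%N, (fun=> 1), (fun=> 1 - @idem k Q a), (fun=> lower * vtx a).
split=> //; rewrite big_ord1 mul1r -vtxE mulrBl mul1r mulrA.
case e: (nat_of_ord a) => [|b]; first by rewrite vtx0_lower mul0r subr0.
by rewrite vtx_lower -mulrA vtxM ltn_eqF // mulr0 subr0.
Qed.

Lemma word_ideal_sum u (I : Type) (r : seq I) (P : pred I) (F : I -> Pi) :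
  (forall i, P i -> F i \in word_ideal u) -> \sum_(i <- r | P i) F i \in word_ideal u.
Proof.
have [h0 hD] := @word_ideal_submod k Q u.
move=> hF; elim/big_ind: _ => // x y hx hy.
by have := hD 1 x y hx hy; rewrite scale1r.
Qed.

Lemma word_idealMr u z z' : z \in word_ideal u -> z * z' \in word_ideal u.
Proof.
have [h0 hD] := @word_ideal_submod k Q u => hz.
by have := hD z' z 0 hz h0; rewrite addr0.
Qed.

(** Induction on the word: the monomial is factored as a monomial outside the diagram of the shorter
    word times an element of I_a. *)
Lemma mono_word_ideal u w (d : 'I_n) y x : reduced_expr w u ->
  ~~ below w d x (d + y) -> mono d y x \in word_ideal u.
Proof.
rewrite /below -leqNgt.
elim: u w y x => [|a u IH] w y x hw hx; first by [].
have [hv asc] := reduced_cons hw; case: hw => ew _.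
have [hb|hb] := boolP ((x <= d) && (d + y < n))%N; last first.
  have [h0 _] := @word_ideal_submod k Q (a :: u).
  by rewrite mono_out.
(* Away from a, the idempotent at the end of the monomial already lies in I_a. *)
have [ea|na] := eqVneq (d + y - x)%N (nat_of_ord a); last first.
  have -> : mono d y x = mono d y x * vtx (d + y - x) by rewrite mono_vtx ?eqxx //; lia.
  apply: word_ideal_cons; last exact: vtx_vertex_ideal.
  apply: IH hv _; move: hx; rewrite -ew /= cnt_refl_neq //.
  by rewrite subSn ?eqSS //; lia.
have {}hx : ((letter_pos (word_perm u) (lo_letter a) <= d)
             + cnt (word_perm u) d a.+2 <= x)%N.
  by move: hx; rewrite -ew /= subSn ?ea ?cnt_refl_eq //; lia.
have hlo := cntS (word_perm u) d (lo_letter a).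
have hhi := cntS (word_perm u) d (hi_letter a); rewrite hi_letterE in hhi.
rewrite /= in hlo.
(* If the letter a occurs up to position d, then x > 0 and the last step can be taken as [lower],
   coming from the vertex a + 1. *)
have [dlo|dlo] := leqP (letter_pos (word_perm u) (lo_letter a)) d.
  case: x hx hb ea => [|x] hx hb ea; first by move: hx; rewrite dlo.
  have -> : mono d y x.+1 = mono d y x * (lower * vtx a).
    by rewrite mulrA mono_lower mono_vtx ?ea ?eqxx //; lia.
  apply: word_ideal_cons; last exact: lower_vertex_ideal.
  apply: IH hv _; move: hx; rewrite dlo.
  by have -> : ((d + y).+1 - x = a.+2)%N by lia.
(* Otherwise the ascent puts a + 1 beyond position d as well, so the counts at a and at a + 2
   coincide and the last step can be taken as [raise], coming from a - 1. This bound excludes y =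
   0. *)
have hge := @cnt_ge n (word_perm u) d a (ltnW (ltn_ord d)).
case: y hb ea => [|y] hb ea; first by lia.
have -> : mono d y.+1 x = mono d y x * (raise * vtx a).
  by rewrite mulrA mono_raise mono_vtx ?ea ?eqxx //; lia.
apply: word_ideal_cons; last exact: raise_vertex_ideal.
apply: IH hv _; have -> : ((d + y).+1 - x = a)%N by lia.
by lia.
Qed.

(** Converse of [vanishes_below_word]; together they describe I(w) by coefficients. *)
Lemma word_ideal_below u w z : reduced_expr w u ->
  (forall d x s, (x <= d)%N -> (d <= s)%N -> (s < n)%N -> below w d x s ->
     bcoef z d x s = 0) -> z \in word_ideal u.
Proof.
move=> hw hz; rewrite [z]preproj_span.
apply: word_ideal_sum => d _; apply: word_ideal_sum => x _.
apply: word_ideal_sum => s _.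
have mono0 : mono d (s - d) x * scal 0 \in word_ideal u.
  by have [? _] := @word_ideal_submod k Q u; rewrite scal0 mulr0.
have [hv|hv] := boolP [&& x <= d, d <= s & s < n]%N; last by rewrite (bcoef_out _ hv).
case/and3P: hv => xd ds sn.
have [hb|hb] := boolP (below w d x s); first by rewrite hz.
by apply: word_idealMr; apply: mono_word_ideal hw _; rewrite subnKC.
Qed.

End WordIdeals.

Section RightAction.
Variables (R : pzRingType) (M : lmodType R^c).
Implicit Types (v : M) (z : R).

(* The right action v z underlying the left action of the converse ring. *)
Definition rscale v z : M := (z : R^c) *: v.

Lemma rscaleM v z z' : rscale v (z * z') = rscale (rscale v z) z'.
Proof. by rewrite /rscale scalerA. Qed.
Lemma rscale1 v : rscale v 1 = v.
Proof. exact: scale1r. Qed.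
Lemma rscaleDr v z z' : rscale v (z + z') = rscale v z + rscale v z'.
Proof. exact: scalerDl. Qed.
Lemma rscale0l z : rscale 0 z = 0.
Proof. exact: scaler0. Qed.
Lemma rscale0r v : rscale v 0 = 0.
Proof. exact: scale0r. Qed.
Lemma rscale_suml (I : finType) (P : pred I) (F : I -> M) z :
  rscale (\sum_(t | P t) F t) z = \sum_(t | P t) rscale (F t) z.
Proof. exact: scaler_sumr. Qed.
Lemma rscale_sumr (I : finType) (P : pred I) (F : I -> R) v :
  rscale v (\sum_(t | P t) F t) = \sum_(t | P t) rscale v (F t).
Proof. exact: scaler_suml. Qed.
End RightAction.

Lemma rscale_linear (R : pzRingType) (M M' : lmodType R^c) (f : {linear M -> M'}) v z :
  f (rscale v z) = rscale (f v) z.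
Proof. exact: linearZZ. Qed.

(** Quotients are used only through these three properties, so their construction stays opaque. *)
Lemma mod_quot_proj (R : pzRingType) (M : lmodType R) (L : submodClosed M) :
  {P : M -> mod_quot L & {S : mod_quot L -> M | [/\ cancel S P,
    forall a z, a *: P z = P (a *: z) & forall z z', P z = P z' <-> z - z' \in L]}}.
Proof.
exists (to_mquot L), (fun xi => repr (xi : Quotient.quot _)); split.
- exact: to_mquot_repr.
- by move=> a z; apply: esym; apply: to_mquotZ.
- by move=> z z'; split=> h; apply/(to_mquotP L).
Qed.

Lemma preproj_quot_proj (k : fieldType) (Q : quiver) (u : seq (vertex Q)) :
  {P : preproj k Q -> preproj_quot k u & {S : preproj_quot k u -> preproj k Q |
  [/\ cancel S P, forall z a, rscale (P z) a = P (z * a) &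
      forall z z', P z = P z' <-> z - z' \in word_ideal u]}}.
Proof.
rewrite /preproj_quot.
match goal with |- context [@mod_quot ?R ?M ?L] => have := @mod_quot_proj R M L end.
case=> P [S [h1 h2 h3]]; exists P, S; split; [exact: h1 | | exact: h3].
by move=> z a; exact: h2.
Qed.

(** * Modules cogenerated by Pi / I(w) *)

Section Cogenerated.
Variables (k : fieldType) (n : nat) (o : 'I_n.-1 -> bool).
Local Notation Q := (quiverA o).
Local Notation Pi := (preproj k Q).
Local Notation vtx := (vtx k o).
Local Notation raise := (raise k o).
Local Notation lower := (lower k o).
Local Notation scal := (@scal k n o).
Variables (w : 'S_n.+1) (u : seq 'I_n).
Hypothesis uw : reduced_expr w u.
Local Notation PiW := (@preproj_quot k Q u).
Implicit Types (xi : PiW) (z : Pi).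

Definition to_PiW : Pi -> PiW := projT1 (@preproj_quot_proj k Q u).
Definition lift_PiW : PiW -> Pi := sval (projT2 (@preproj_quot_proj k Q u)).

Lemma lift_PiWK : cancel lift_PiW to_PiW.
Proof. by rewrite /lift_PiW; case: (svalP (projT2 (@preproj_quot_proj k Q u))). Qed.

Lemma to_PiW_rscale z z' : rscale (to_PiW z) z' = to_PiW (z * z').
Proof. by case: (svalP (projT2 (@preproj_quot_proj k Q u))). Qed.

Lemma to_PiW_eq z z' :
  (to_PiW z = to_PiW z') <-> (z - z' \in @word_ideal k Q u).
Proof. by case: (svalP (projT2 (@preproj_quot_proj k Q u))). Qed.

Lemma to_PiW_surj xi : exists z, to_PiW z = xi.
Proof. by exists (lift_PiW xi); apply: lift_PiWK. Qed.

Lemma to_PiW0 : to_PiW 0 = 0.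
Proof. by rewrite -{1}(mulr0 0) -to_PiW_rscale rscale0r. Qed.

(** Independent of the chosen lift at the boxes [below] w, where elements of I(w) have zero
    coefficient; hence the hypothesis of the lemmas that follow. *)
Definition qcoef xi d x s : k := locked (bcoef (lift_PiW xi) d x s).

Lemma qcoefE z d x s : below w d x s -> qcoef (to_PiW z) d x s = bcoef z d x s.
Proof.
move=> b; rewrite /qcoef -lock; set z' := lift_PiW _.
have h : z' - z \in @word_ideal k Q u by apply/to_PiW_eq; apply: lift_PiWK.
have [ew _] := uw; rewrite -ew in b.
have e := vanishes_below_word h b.
by rewrite -[z'](subrK z) bcoefD e add0r.
Qed.

Lemma qcoef0 d x s : below w d x s -> qcoef 0 d x s = 0.
Proof. by move=> b; rewrite -to_PiW0 qcoefE // bcoef0. Qed.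

Lemma qcoef_vtx xi a d x s : below w d x s ->
  qcoef (rscale xi (vtx a)) d x s = if (s - x == a)%N then qcoef xi d x s else 0.
Proof.
by move=> b; have [z <-] := to_PiW_surj xi; rewrite to_PiW_rscale !qcoefE // bcoef_vtx.
Qed.

Lemma qcoef_scal xi c d x s : below w d x s ->
  qcoef (rscale xi (scal c)) d x s = c * qcoef xi d x s.
Proof.
by move=> b; have [z <-] := to_PiW_surj xi; rewrite to_PiW_rscale !qcoefE // bcoef_scal.
Qed.

Lemma qcoef_raise xi d x s : below w d x s.+1 ->
  qcoef (rscale xi raise) d x s.+1 = if (s.+1 < n)%N then qcoef xi d x s else 0.
Proof.
move=> b; have [z <-] := to_PiW_surj xi; rewrite to_PiW_rscale !qcoefE //.
  by rewrite bcoef_raise.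
exact: below_raise.
Qed.

Lemma qcoef_lower xi d x s : below w d x.+1 s ->
  qcoef (rscale xi lower) d x.+1 s = if (x.+1 <= d)%N then qcoef xi d x s else 0.
Proof.
move=> b; have [z <-] := to_PiW_surj xi; rewrite to_PiW_rscale !qcoefE //.
  by rewrite bcoef_lower.
exact: below_lower.
Qed.

Lemma qcoef_lower0 xi d s : below w d 0 s -> qcoef (rscale xi lower) d 0 s = 0.
Proof.
by move=> b; have [z <-] := to_PiW_surj xi; rewrite to_PiW_rscale !qcoefE // bcoef_lower0.
Qed.

Lemma qcoef_neq0 xi : xi != 0 -> exists d x s,
  [/\ (x <= d)%N, (d <= s)%N, (s < n)%N, below w d x s & qcoef xi d x s != 0].
Proof.
move=> xi0; apply: contrapT => no; case/eqP: xi0.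
have [z ez] := to_PiW_surj xi; rewrite -ez -to_PiW0; apply/to_PiW_eq; rewrite subr0.
apply: word_ideal_below uw _ => d x s xd ds sn b.
apply/eqP; apply: contrapT => /negP h; apply: no; exists d, x, s; split=> //.
by rewrite -ez qcoefE.
Qed.

(** What membership in F(w) provides, see [in_Sub_separated]: any nonzero vector can be detected by
    coefficients. *)
Definition cogenerated (M : lmodType Pi^c) : Prop :=
  forall v : M, v != 0 -> exists f : {linear M -> PiW}, f v != 0.

Local Notation pos t := (letter_pos w (inord t)).

Lemma scal_inj0 (M : lmodType Pi^c) (v : M) c :
  v != 0 -> rscale v (scal c) = 0 -> c = 0.
Proof.
move=> v0 e; apply/eqP; apply: contraNT v0 => c0.
by rewrite -[v]rscale1 -(scal1 k o) -(mulfV c0) scalM rscaleM e rscale0l.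
Qed.

(* Since raise lower = lower raise, the product r_m l_m does not depend on m,
   and it vanishes at the end of the chain. *)
Lemma chain_scal0 (M : lmodType Pi^c) (X : nat -> M) (r l : nat -> k) p q :
  (forall m, (p <= m < q)%N -> X m != 0) ->
  (forall m, (p <= m)%N -> (m.+1 < q)%N ->
     rscale (X m) raise = rscale (X m.+1) (scal (r m.+1))) ->
  (forall m, (p <= m)%N -> (m.+1 < q)%N ->
     rscale (X m.+1) lower = rscale (X m) (scal (l m.+1))) ->
  rscale (X p) lower = 0 ->
  forall m, (p <= m)%N -> (m.+1 < q)%N -> r m.+1 * l m.+1 = 0.
Proof.
move=> hX hr hl hl0.
have XLR m : (p <= m)%N -> (m.+1 < q)%N ->
    rscale (X m.+1) (lower * raise) = rscale (X m.+1) (scal (r m.+1 * l m.+1)).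
  move=> pm mq; rewrite rscaleM hl // -rscaleM scalC rscaleM hr //.
  by rewrite -rscaleM -scalM.
have XRL m : (p <= m)%N -> (m.+1 < q)%N ->
    rscale (X m) (raise * lower) = rscale (X m) (scal (r m.+1 * l m.+1)).
  move=> pm mq; rewrite rscaleM hr // -rscaleM scalC rscaleM hl //.
  by rewrite -rscaleM -scalM mulrC.
move=> m pm; rewrite -(subnKC pm); elim: (m - p)%N => [|i IHi] iq.
    have X0 := hX (p + 0)%N ltac:(lia); apply: (scal_inj0 X0).
    rewrite -XRL ?leq_addr // raise_lower rscaleM addn0 hl0.
    exact: rscale0l.
  have X0 := hX (p + i.+1)%N ltac:(lia); apply: (scal_inj0 X0).
  rewrite -XRL ?leq_addr // raise_lower addnS XLR ?leq_addr //; last by lia.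
  by rewrite IHi ?scal0 ?rscale0r //; lia.
Qed.

(* Otherwise, the subchains [p, m) and [m, q) show by induction that every inner
   letter m is on the side prescribed by whether r_m or l_m is nonzero. For a
   homomorphism f to Pi/I(w) with f X_p != 0, a nonzero coefficient of f X_p in
   row d then contradicts X_p lower = 0 if pos p <= d; if d < pos q it propagates
   to f X_(q-1) and contradicts X_(q-1) raise = 0. *)
Lemma chain_inversion (M : lmodType Pi^c) (X : nat -> M) (r l : nat -> k) p q :
  cogenerated M -> (p < q)%N -> (q <= n)%N ->
  (forall m, (p <= m < q)%N -> X m != 0 /\ rscale (X m) (vtx m) = X m) ->
  (forall m, (p <= m)%N -> (m.+1 < q)%N ->
     rscale (X m) raise = rscale (X m.+1) (scal (r m.+1))) ->
  rscale (X q.-1) raise = 0 ->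
  (forall m, (p <= m)%N -> (m.+1 < q)%N ->
     rscale (X m.+1) lower = rscale (X m) (scal (l m.+1))) ->
  rscale (X p) lower = 0 ->
  (pos q < pos p)%N.
Proof.
move=> cog; elim/ltn_ind: {p}(q - p)%N {-2}p {-2}q (erefl (q - p)%N) => N IH {}p {}q eN.
move=> pq qn hX hr hr0 hl hl0.
have sub a b : (p <= a)%N -> (a < b)%N -> (b <= q)%N -> (p < a)%N || (b < q)%N ->
    rscale (X b.-1) raise = 0 -> rscale (X a) lower = 0 -> (pos b < pos a)%N.
  move=> pa ab bq ne h1 h2.
  apply: (IH (b - a)%N) (erefl _) _ _ _ _ h1 _ h2 => //; try lia.
  - by move=> m hm; apply: hX; lia.
  - by move=> m h h'; apply: hr; lia.
  - by move=> m h h'; apply: hl; lia.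
(* If l vanishes at m + 1, then [m + 1, q) is a shorter chain; if r vanishes too, so is [p, m + 1),
   and the two inequalities compose to the goal. *)
have alt m : (p <= m)%N -> (m.+1 < q)%N ->
    l m.+1 != 0 \/ (r m.+1 != 0 /\ (pos q < pos m.+1)%N) \/ (pos q < pos p)%N.
  move=> pm mq; have [l0|] := eqVneq (l m.+1) 0; last by left.
  right; have qm : (pos q < pos m.+1)%N.
    by apply: sub => //; try lia; rewrite hl // l0 scal0 rscale0r.
  have [r0|] := eqVneq (r m.+1) 0; last by left.
  right; apply: ltn_trans qm _; apply: sub => //; try lia.
  by rewrite hr // r0 scal0 rscale0r.
have [Xp Xpv] := hX p ltac:(lia); have [f fXp] := cog _ Xp.
have [d [x [s [xd ds sn b c]]]] := qcoef_neq0 fXp.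
have sxp : (s = p + x)%N.
  move: c; rewrite -Xpv rscale_linear qcoef_vtx //.
  by case: (s - x =P p)%N => [|_]; [lia | rewrite eqxx].
rewrite ltnNge; apply/negP => pq_pos.
(* If p occurred up to position d, the box one step down would still be below w, and its coefficient
   in f (X_p) lower = 0 is c, which is nonzero. *)
have dp : (d < pos p)%N.
  rewrite ltnNge; apply/negP => pd.
  have b' : below w d x.+1 s.
    move: b; rewrite /below subSS (_ : s - x = p)%N; last by lia.
    rewrite (_ : s.+1 - x = p.+1)%N; last by lia.
    by rewrite (@cntS_nat _ w d p) ?pd; lia.
  have := qcoef_lower (f (X p)) b'; rewrite -rscale_linear hl0 raddf0 qcoef0 //.
  move: b'; rewrite /below => b'.
  have := @cnt_le n w d (s.+1 - x.+1) ltac:(lia); case: ifP => [_ _ e|]; last by lia.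
  by case/eqP: c.
have dq : (d < pos q)%N by lia.
(* Where l is nonzero, the coefficient is pulled back along [lower] and y drops by one; where r is
   nonzero, it is pushed along [raise] with y fixed, staying in the diagram because d < pos q < pos
   m. *)
have walk m : (p <= m)%N -> (m < q)%N ->
    exists y, below w d y (m + y) /\ qcoef (f (X m)) d y (m + y) != 0.
  move=> pm; rewrite -(subnKC pm); elim: (m - p)%N => [|i IHi] iq.
    by rewrite addn0; exists x; rewrite -sxp.
  have [y [by_ cy]] := IHi ltac:(lia); rewrite addnS in iq *.
  move: (p + i)%N (leq_addr i p) iq by_ cy => a pa aq by_ cy.
  have aq' : (a.+1 < q)%N by lia.
  have cn := cnt_step w d a.+1.
  move: (by_); rewrite /below (_ : (a + y).+1 - y = a.+1)%N; last by lia.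
  move=> by'.
  case: (alt a pa aq') => [l0|[[r0 qa]|]]; last by lia.
  - have e : rscale (f (X a.+1)) lower = rscale (f (X a)) (scal (l a.+1)).
      by rewrite -!rscale_linear hl.
    have ne : qcoef (rscale (f (X a.+1)) lower) d y (a + y) != 0.
      by rewrite e qcoef_scal // mulf_neq0.
    case: y by_ cy by' e ne => [|y] by_ cy by' e ne.
      by rewrite qcoef_lower0 ?eqxx in ne.
    exists y; move: ne; rewrite addSnnS qcoef_lower //.
    case: ifP => [_ cne|_ /eqP //]; split=> //.
    rewrite /below (_ : (a + y.+1).+1 - y = a.+2)%N; last by lia.
    by lia.
  have e : rscale (f (X a)) raise = rscale (f (X a.+1)) (scal (r a.+1)).
    by rewrite -!rscale_linear hr.
  have ca : cnt w d a.+1 = cnt w d a.+2.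
    by rewrite cntS_nat; [rewrite leqNgt (_ : d < pos a.+1)%N //; lia | lia].
  have b' : below w d y (a + y).+1.
    by rewrite /below (_ : (a + y).+2 - y = a.+2)%N -?ca //; lia.
  have := qcoef_raise (f (X a)) b'.
  have := cnt_le_out w d a.+2; rewrite -ca => cn'.
  rewrite (_ : (a + y).+1 < n)%N; last by lia.
  rewrite e qcoef_scal // => e'; exists y; rewrite addSn; split=> //.
  by apply: contra_neq cy => z; rewrite -e' z mulr0.
have [y [by_ cy]] := walk q.-1 ltac:(lia) ltac:(lia).
have qK : q.-1.+1 = q by lia.
have cq : cnt w d q = cnt w d q.+1.
  by rewrite cntS_nat // leqNgt dq.
have by' : (y < cnt w d q.+1)%N.
  by move: by_; rewrite /below (_ : (q.-1 + y).+1 - y = q)%N ?cq //; lia.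
have b' : below w d y (q.-1 + y).+1.
  by rewrite /below (_ : (q.-1 + y).+2 - y = q.+1)%N //; lia.
have := qcoef_raise (f (X q.-1)) b'.
have := cnt_le_out w d q.+1 => cn.
rewrite (_ : (q.-1 + y).+1 < n)%N; last by lia.
rewrite -rscale_linear hr0 raddf0 qcoef0 // => e.
by case/eqP: cy.
Qed.

End Cogenerated.

(** * The modules B_e *)

Section ThinBasis.
Variables (k : fieldType) (Q : quiver).
Variables (V : {set vertex (double_quiver Q)}) (E : {set arrow (double_quiver Q)}).
Hypothesis nE : forall x : arrow Q, ~~ ((inl x \in E) && (inr x \in E)).
Local Notation M := (thin_module k V nE).
Implicit Types (v : M) (a b : vertex (double_quiver Q)).

Definition thin_basis a : M := (\row_t (enum_val t == a)%:R : 'rV[k]_#|V|).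
Definition thin_coord v a : k := \sum_(t | enum_val t == a) (v : 'rV[k]_#|V|) 0 t.

Lemma thin_rscale v x :
  rscale v (to_preproj x) = (v : 'rV[k]_#|V|) *m rep_hom (thin_is_rep k V E) x.
Proof. by congr (_ *m _); apply: quot_liftE. Qed.

Lemma thin_rscale_kscalar v c :
  rscale v (kscalar Q c) = c *: (v : 'rV[k]_#|V|) :> 'rV[k]_#|V|.
Proof.
rewrite thin_rscale.
have -> : rep_hom (thin_is_rep k V E)
      (c *: (1 : path_algebra k (double_quiver Q))) = c%:M.
  rewrite -scalemx1; apply: etrans
      (linearZZ (lin_ext (path_mx (thin_vertex k V) (thin_arrow k V E))) c _) _.
  by congr (_ *: _); apply: (rmorph1 (rep_hom (thin_is_rep k V E))).
by rewrite -scalemx1 -scalemxAr mulmx1.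
Qed.

Lemma thin_basis_arrow a (x : arrow (double_quiver Q)) : a \in V ->
  rscale (thin_basis a) (to_preproj (pbasis k (arrow_path x)))
  = if (x \in E) && (src x == a) then thin_basis (tgt x) else 0.
Proof.
move=> aV; rewrite thin_rscale rep_hom_basis (arrow_path_mx (thin_is_rep k V E)).
apply/rowP=> t; rewrite mxE (bigD1 (enum_rank_in aV a)) //= big1 ?addr0 => [|s sa].
  rewrite !mxE enum_rankK_in // eqxx mul1r (eq_sym a).
  by case: (x \in E); case: (src x == a) => /=; rewrite !mxE.
rewrite !mxE; case: eqP => [e|_]; last by rewrite mul0r.
by case/eqP: sa; apply: enum_val_inj; rewrite enum_rankK_in.
Qed.

Lemma thin_basis_idem a b :
  rscale (thin_basis a) (@idem k Q b) = if a == b then thin_basis a else 0.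
Proof.
rewrite thin_rscale rep_hom_basis /path_mx /=; apply/rowP=> t.
rewrite mxE (bigD1 t) //= big1 ?addr0 => [|s st]; last first.
  by rewrite !mxE (negbTE st) mulr0.
rewrite !mxE eqxx -[psrc _]/b /=; case: (eqVneq a b) => [->|ab]; rewrite !mxE.
  by case: (_ == b); rewrite ?mulr1 ?mulr0.
by case: eqP => [->|_]; rewrite ?(negbTE ab) ?mulr0 ?mul0r.
Qed.

Lemma thin_basis_out a : a \notin V -> thin_basis a = 0.
Proof.
move=> aV; apply/rowP=> t; rewrite !mxE; case: eqP => // e.
by move: aV; rewrite -e enum_valP.
Qed.

Lemma thin_basis_neq0 a : a \in V -> thin_basis a != 0.
Proof.
move=> aV; apply/eqP => /rowP/(_ (enum_rank_in aV a)).
by rewrite !mxE enum_rankK_in // eqxx => /eqP; rewrite oner_eq0.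
Qed.

Lemma thin_coordD v v' a : thin_coord (v + v') a = thin_coord v a + thin_coord v' a.
Proof. by rewrite /thin_coord -big_split; apply: eq_bigr => t _; rewrite /= mxE. Qed.

Lemma thin_coordZ v c a : thin_coord (rscale v (kscalar Q c)) a = c * thin_coord v a.
Proof.
rewrite /thin_coord mulr_sumr; apply: eq_bigr => t _.
by rewrite thin_rscale_kscalar mxE.
Qed.

Lemma thin_coord_basis a b : thin_coord (thin_basis a) b = ((a == b) && (a \in V))%:R.
Proof.
rewrite /thin_coord; have [aV|aV] := boolP (a \in V); last first.
  by rewrite thin_basis_out // big1 ?andbF // => t _; rewrite mxE.
rewrite andbT; have [<-|ab] := eqVneq a b; last first.
  by rewrite big1 // => t /eqP e; rewrite mxE e eq_sym (negbTE ab).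
rewrite (big_pred1 (enum_rank_in aV a)) => [|t].
  by rewrite mxE enum_rankK_in // eqxx.
apply/eqP/eqP => [e|->]; last by rewrite enum_rankK_in.
by apply: enum_val_inj; rewrite enum_rankK_in.
Qed.

Lemma thin_decomp v :
  v = \sum_(a in V) rscale (thin_basis a) (kscalar Q (thin_coord v a)).
Proof.
have sumE (F : vertex Q -> M) t : (\sum_(a in V) F a : 'rV[k]_#|V|) 0 t
    = \sum_(a in V) (F a : 'rV[k]_#|V|) 0 t.
  exact: summxE.
apply/rowP=> t; rewrite sumE (bigD1 (enum_val t)) ?enum_valP //=.
rewrite big1 ?addr0 => [|a /andP[_ ne]].
  rewrite thin_rscale_kscalar !mxE eqxx mulr1 /thin_coord (big_pred1 t) // => s.
  by rewrite (inj_eq enum_val_inj).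
by rewrite thin_rscale_kscalar !mxE eq_sym (negbTE ne) mulr0.
Qed.

End ThinBasis.

Lemma range_lt n (i j : 'I_n.+1) m : (i <= m < j)%N -> (m < n)%N.
Proof. by have := ltn_ord j; lia. Qed.

Section ArcBasis.
Variables (k : fieldType) (n : nat) (o : 'I_n.-1 -> bool).
Variables (w : 'S_n.+1) (i j : 'I_n.+1) (hij : BInv w i j).
Local Notation Q := (quiverA o).
Local Notation Pi := (preproj k Q).
Local Notation vtx := (vtx k o).
Local Notation raise := (raise k o).
Local Notation lower := (lower k o).
Local Notation scal := (@scal k n o).
Local Notation B := (arc_module k o hij).
Local Notation tbasis :=
  (@thin_basis k Q (arc_vertices o i j) (arc_arrows o w i j) (arc_arrowsP o hij)).
Local Notation tcoord :=
  (@thin_coord k Q (arc_vertices o i j) (arc_arrows o w i j) (arc_arrowsP o hij)).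
Local Notation pos t := (letter_pos w (inord t)).

(* The sign of lower on the edge between the vertices t - 1 and t. *)
Definition edge_sign (t : nat) : k :=
  if insub t.-1 is Some y then if o y then 1 else -1 else 1.

Lemma edge_sign_neq0 t : edge_sign t != 0.
Proof.
rewrite /edge_sign; case: insub => [y|]; last exact: oner_neq0.
by case: (o y); rewrite ?oppr_eq0 oner_eq0.
Qed.

Lemma edge_signE (y : 'I_n.-1) : edge_sign y.+1 = if o y then 1 else -1.
Proof. by rewrite /edge_sign /= valK. Qed.

Definition arc_basis (m : nat) : B :=
  if insub m is Some a then tbasis a else 0.
Definition arc_coord (v : B) (m : nat) : k :=
  if insub m is Some a then tcoord v a else 0.

Lemma arc_basisE (a : 'I_n) : arc_basis a = tbasis a.
Proof. by rewrite /arc_basis valK. Qed.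

Lemma arc_coordE (v : B) (a : 'I_n) :
  arc_coord v a = tcoord v a.
Proof. by rewrite /arc_coord valK. Qed.

Lemma arc_basis_out m : ~~ (i <= m < j)%N -> arc_basis m = 0.
Proof.
rewrite /arc_basis; case: insubP => [a _ <- h|//].
by apply: thin_basis_out; rewrite inE.
Qed.

Lemma arc_basis_neq0 m : (i <= m < j)%N -> arc_basis m != 0.
Proof.
move=> h; rewrite -[m]/(val (Ordinal (range_lt h))) arc_basisE.
by apply: thin_basis_neq0; rewrite inE.
Qed.

Lemma arc_basis_vtx m a :
  rscale (arc_basis m) (vtx a) = if m == a then arc_basis m else 0.
Proof.
have [am|am] := ltnP m n; last first.
  by rewrite arc_basis_out ?rscale0l ?if_same //; have := ltn_ord j; lia.
have [an|an] := ltnP a n; last first.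
  by rewrite vtx_out // rscale0r; case: eqP => // e; rewrite arc_basis_out //; lia.
rewrite -[m]/(val (Ordinal am)) -[a]/(val (Ordinal an)) !arc_basisE vtxE.
by rewrite thin_basis_idem.
Qed.

Lemma arc_arrow_up (y : 'I_n.-1) :
  arc_arrow w i j (edge_lo y) (edge_hi y)
  = (i < y.+1 < j)%N && (pos i < pos y.+1)%N.
Proof.
have yn : (y.+1 < n.+1)%N by have := ltn_ord y; lia.
apply/existsP/idP => [[m /andP[hm]]|/andP[h1 h2]].
  case/orP => /and3P[/= /eqP e1 /eqP e2 h]; last by lia.
  by rewrite e1 hm /= !inord_val.
exists (inord y.+1); rewrite inordK // h1 /= eqxx /=.
by rewrite inord_val in h2; rewrite ?h2 ?eqxx.
Qed.

Lemma arc_arrow_down (y : 'I_n.-1) :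
  arc_arrow w i j (edge_hi y) (edge_lo y)
  = (i < y.+1 < j)%N && (pos y.+1 < pos j)%N.
Proof.
have yn : (y.+1 < n.+1)%N by have := ltn_ord y; lia.
apply/existsP/idP => [[m /andP[hm]]|/andP[h1 h2]].
  case/orP => /and3P[/= /eqP e1 /eqP e2 h]; first by lia.
  by rewrite e1 hm /= !inord_val.
exists (inord y.+1); rewrite inordK // h1 /= eqxx /=.
by rewrite inord_val in h2; rewrite ?h2 ?eqxx ?orbT.
Qed.

(** At m = j - 1 the right side is 0, since [arc_basis] vanishes at j; the same convention at i - 1
    serves [arc_basis_lower]. *)
Lemma arc_basis_raise m : (i <= m < j)%N ->
  rscale (arc_basis m) raise = rscale (arc_basis m.+1) (scal (pos i < pos m.+1)%N%:R).
Proof.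
move=> h; have mn := range_lt h.
have -> : rscale (arc_basis m) raise = rscale (arc_basis m) (vtx m * raise).
  by rewrite rscaleM arc_basis_vtx eqxx.
have [m1|m1] := ltnP m.+1 n; last first.
  rewrite vtx_raise vtx_out // mulr0 rscale0r arc_basis_out ?rscale0l //.
  by have := ltn_ord j; lia.
have my : (m < n.-1)%N by lia.
pose y := Ordinal my; rewrite -[m]/(nat_of_ord y) -up_pathE.
rewrite -[nat_of_ord y in LHS]/(nat_of_ord (edge_lo y)) arc_basisE.
rewrite thin_basis_arrow; last by rewrite inE.
rewrite src_up tgt_up eqxx andbT -arc_basisE inE src_up tgt_up arc_arrow_up.
have [hr|hr] := boolP (i < y.+1 < j)%N; last first.
  by rewrite /= arc_basis_out ?rscale0l //; move: hr h; rewrite /=; lia.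
rewrite /=; case: ifP => _; first by rewrite scal1 rscale1.
by rewrite scal0 rscale0r.
Qed.

Lemma arc_basis_lower m : (i <= m.+1 < j)%N ->
  rscale (arc_basis m.+1) lower
  = rscale (arc_basis m) (scal (edge_sign m.+1 * (pos m.+1 < pos j)%N%:R)).
Proof.
move=> h; have mn := range_lt h.
have -> : rscale (arc_basis m.+1) lower = rscale (arc_basis m.+1) (vtx m.+1 * lower).
  by rewrite rscaleM arc_basis_vtx eqxx.
have my : (m < n.-1)%N by lia.
pose y := Ordinal my; rewrite -[m]/(nat_of_ord y) -down_pathE edge_signE.
have -> : to_preproj (down_path k o y)
    = to_preproj (pbasis k (arrow_path (down_arrow o y))) * scal (if o y then 1 else -1).
  rewrite /down_path to_preprojM -scalC; congr (_ * _).
  case: (o y); first by rewrite scal1 to_preproj1.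
  apply/eqP; rewrite -subr_eq0 -[X in to_preproj X]sub0r to_preprojB to_preproj0.
  rewrite to_preproj1 sub0r -opprD oppr_eq0 -(scal1 k o) -scalD.
  by rewrite subrr scal0.
rewrite rscaleM -[y.+1]/(nat_of_ord (edge_hi y)) arc_basisE.
rewrite thin_basis_arrow; last by rewrite inE.
rewrite src_down tgt_down eqxx andbT -arc_basisE inE src_down tgt_down arc_arrow_down.
have [hr|hr] := boolP (i < y.+1 < j)%N; last first.
  by rewrite /= rscale0l arc_basis_out ?rscale0l //; move: hr h; rewrite /=; lia.
rewrite /=; case: ifP => _; first by rewrite mulr1.
by rewrite mulr0 scal0 rscale0r rscale0l.
Qed.

Lemma arc_basis_lower0 : rscale (arc_basis 0) lower = 0.
Proof.
have -> : rscale (arc_basis 0) lower = rscale (arc_basis 0) (vtx 0 * lower).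
  by rewrite rscaleM arc_basis_vtx eqxx.
by rewrite vtx0_lower rscale0r.
Qed.

Lemma arc_coordD v v' m : arc_coord (v + v') m = arc_coord v m + arc_coord v' m.
Proof.
by rewrite /arc_coord; case: insub => [a|]; rewrite ?addr0 // thin_coordD.
Qed.

Lemma arc_coordZ v c m : arc_coord (rscale v (scal c)) m = c * arc_coord v m.
Proof.
by rewrite /arc_coord scalE; case: insub => [a|]; rewrite ?mulr0 // thin_coordZ.
Qed.

Lemma arc_coord_basis m a :
  arc_coord (arc_basis m) a = ((m == a) && (i <= m < j)%N)%:R.
Proof.
have arc_coord0 : arc_coord 0 a = 0.
  by have := arc_coordZ 0 0 a; rewrite rscale0l mul0r.
have [hm|hm] := boolP (i <= m < j)%N; last first.
  by rewrite arc_basis_out // arc_coord0 andbF.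
rewrite andbT; have mn := range_lt hm; have [an|an] := ltnP a n; last first.
  rewrite /arc_coord insubF; first by case: eqP => // e; lia.
  by lia.
rewrite -[m]/(val (Ordinal mn)) -[a]/(val (Ordinal an)) arc_basisE arc_coordE.
by rewrite thin_coord_basis inE /= hm andbT.
Qed.

Lemma arc_decomp v :
  v = \sum_(m < n) rscale (arc_basis m) (scal (arc_coord v m)).
Proof.
rewrite {1}[v]thin_decomp [RHS](bigID (fun a => a \in arc_vertices o i j)) /=.
rewrite [X in _ = _ + X]big1 ?addr0 => [|a ha]; last first.
  by rewrite arc_basisE thin_basis_out // rscale0l.
by apply: eq_bigr => a _; rewrite arc_basisE arc_coordE scalE.
Qed.

End ArcBasis.

(** * Linear maps, summands and the category Sub *)

Section LinearMaps.
Variable R : pzRingType.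
Implicit Types M N X Y : lmodType R.

Lemma linear_of M N (f : M -> N) : linear f -> {F : {linear M -> N} | F =1 f}.
Proof.
move=> lf; pose m := GRing.isLinear.Build _ _ _ _ f lf.
by exists (HB.pack f m : {linear M -> N}).
Qed.

Lemma isomorphic_of_bij M N (g : {linear N -> M}) :
  injective g -> (forall x, exists y, g y = x) -> isomorphic M N.
Proof.
move=> gi gs; have [h hK] := choice gs.
have Kh : cancel g h by move=> y; apply: gi; rewrite hK.
have lh : linear h by move=> a x y; apply: gi; rewrite linearP !hK.
have [H eH] := linear_of lh; exists H; exists g => x; rewrite eH //.
Qed.

Lemma is_summand_inj X Y : is_summand X Y -> exists f : {linear X -> Y}, injective f.
Proof.
case=> X' [f [f' fK _]].
have [h eh] := @linear_of X (X * X')%type (fun x => (x, 0))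
  ltac:(by move=> a x y; congr (_, _); rewrite /= ?scaler0 ?addr0).
have lc : linear (f \o h) by move=> a x y; rewrite /= !linearP.
have [F eF] := linear_of lc; exists F => x y; rewrite !eF /= !eh.
by move/(can_inj fK) => [].
Qed.

Lemma is_summand_refl Y : is_summand Y Y.
Proof.
exists (dsum (fun _ : 'I_0 => Y)).
have [F eF] := @linear_of (Y * dsum (fun _ : 'I_0 => Y))%type Y fst ltac:(by []).
exists F; exists (fun y => (y, 0)) => [[y z]|y]; rewrite eF //=.
by congr (_, _); apply/ffunP => -[].
Qed.

Lemma in_Sub_inj Y M (f : {linear M -> Y}) : fin_gen M -> injective f -> in_Sub Y M.
Proof.
move=> fgM fi; split=> //; exists 1%N, (fun=> Y); split.
  by move=> _; apply: is_summand_refl.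
have [F eF] := @linear_of M (dsum (fun _ : 'I_1 => Y)) (fun x => [ffun=> f x])
  ltac:(by move=> a x y; apply/ffunP => t; rewrite !ffunE linearP).
exists F => x y; rewrite !eF => /ffunP/(_ ord0); rewrite !ffunE.
exact: fi.
Qed.

Lemma in_Sub_separated Y M : in_Sub Y M ->
  forall v : M, v != 0 -> exists f : {linear M -> Y}, f v != 0.
Proof.
case=> _ [r [X [hX [f fi]]]] v v0.
have [t ft] : exists t, f v t != 0.
  apply: contrapT => no; case/eqP: v0; apply: fi; rewrite linear0; apply/ffunP => t.
  rewrite [RHS]ffunE; apply/eqP; apply: contrapT => /negP h; apply: no; by exists t.
have [g gi] := is_summand_inj (hX t).
have lh : linear (fun x => g (f x t)).
  by move=> a x y; rewrite [f _]linearP ![in LHS]ffunE linearP.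
have [H eH] := linear_of lh; exists H; rewrite eH.
by apply: contra_neq ft => h; apply: gi; rewrite h linear0.
Qed.

End LinearMaps.

Lemma BInv_cases n (w : 'S_n.+1) (i j : 'I_n.+1) (m : nat) :
  BInv w i j -> (i < m < j)%N ->
  (letter_pos w (inord m) < letter_pos w (inord j))%N
  || (letter_pos w (inord i) < letter_pos w (inord m))%N.
Proof.
case/and3P=> _ ji /forallP/(_ (inord m)) h hm.
have em : (inord m : 'I_n.+1) = m :> nat by rewrite inordK //; have := ltn_ord j; lia.
move: h; rewrite em hm /= => h.
have ne (l : 'I_n.+1) : l != m :> nat -> letter_pos w (inord m) != letter_pos w l :> nat.
  by move=> lm; rewrite val_eqE (inj_eq (@letter_pos_inj _ w)) -val_eqE /= em eq_sym.
rewrite !inord_val. have := ne i ltac:(lia); have := ne j ltac:(lia). lia.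
Qed.

(** * Homomorphisms from B_e to a chain with the same arrows *)

Section ArcHom.
Variables (k : fieldType) (n : nat) (o : 'I_n.-1 -> bool).
Variables (w : 'S_n.+1) (i j : 'I_n.+1) (hij : BInv w i j).
Local Notation Q := (quiverA o).
Local Notation Pi := (preproj k Q).
Local Notation vtx := (vtx k o).
Local Notation raise := (raise k o).
Local Notation lower := (lower k o).
Local Notation scal := (@scal k n o).
Local Notation B := (arc_module k o hij).
Local Notation pos t := (letter_pos w (inord t)).
Local Notation arcb := (arc_basis k o hij).
Local Notation sgn := (edge_sign k o).
Variables (M : lmodType Pi^c) (Y : nat -> M) (r l : nat -> k).
Hypothesis Y_neq0 : forall m, (i <= m < j)%N -> Y m != 0.
Hypothesis Y_vtx : forall m, (i <= m < j)%N -> rscale (Y m) (vtx m) = Y m.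
Hypothesis Y_raise : forall m, (i <= m)%N -> (m.+1 < j)%N ->
  rscale (Y m) raise = rscale (Y m.+1) (scal (r m.+1)).
Hypothesis Y_raise_last : rscale (Y j.-1) raise = 0.
Hypothesis Y_lower : forall m, (i <= m)%N -> (m.+1 < j)%N ->
  rscale (Y m.+1) lower = rscale (Y m) (scal (l m.+1)).
Hypothesis Y_lower_first : rscale (Y i) lower = 0.
Hypothesis up_pattern : forall m, (i < m < j)%N -> (pos i < pos m)%N ->
  r m != 0 /\ l m = 0.
Hypothesis down_pattern : forall m, (i < m < j)%N -> (pos m < pos j)%N ->
  l m != 0 /\ r m = 0.

Let ij : (i < j)%N. Proof. by case/and3P: hij. Qed.
Let pji : (pos j < pos i)%N. Proof. by rewrite !inord_val; case/and3P: hij. Qed.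

(* Compatibility with raise and lower forces the m-th basis vector of the arc
   module to go to lam m times Y m, up to a global factor. *)
Let ratio t : k := if (pos i < pos t)%N then r t else sgn t / l t.
Let lam (m : nat) : k := \prod_(i.+1 <= t < m.+1) ratio t.

Let lamS m : (i <= m)%N -> lam m.+1 = lam m * ratio m.+1.
Proof. by move=> im; rewrite /lam big_nat_recr. Qed.

Let lam_neq0 m : (i <= m < j)%N -> lam m != 0.
Proof.
move=> hm; rewrite prodf_seq_neq0; apply/allP => t; rewrite mem_index_iota => ht /=.
have tij : (i < t < j)%N by lia.
rewrite /ratio; case: ifP => h; first by case: (up_pattern tij h).
have := BInv_cases hij tij; rewrite h orbF => h'; case: (down_pattern tij h') => l0 _.
by rewrite mulf_neq0 ?invr_eq0 // edge_sign_neq0.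
Qed.

Let g (v : B) : M :=
  \sum_(m < n | (i <= m < j)%N) rscale (Y m) (scal (lam m * arc_coord v m)).

Let gD v v' : g (v + v') = g v + g v'.
Proof.
rewrite /g -big_split; apply: eq_bigr => m _.
by rewrite arc_coordD mulrDr scalD rscaleDr.
Qed.

Let gZ v c : g (rscale v (scal c)) = rscale (g v) (scal c).
Proof.
rewrite /g rscale_suml; apply: eq_bigr => m _.
rewrite arc_coordZ mulrCA [c * _]mulrC.
by rewrite (scalM o (_ * _)) [LHS]rscaleM.
Qed.

Let g0 : g 0 = 0.
Proof. by rewrite -[0 in LHS](rscale0r (0 : B)) -(scal0 k o) gZ scal0 rscale0r. Qed.

Let g_arcb m : (i <= m < j)%N -> g (arcb m) = rscale (Y m) (scal (lam m)).
Proof.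
move=> hm; have mn := range_lt hm.
rewrite /g (bigD1 (Ordinal mn)) //= big1 ?addr0 => [|a /andP[_ am]].
  by rewrite arc_coord_basis eqxx hm mulr1.
rewrite arc_coord_basis; have/negbTE-> : m != a by rewrite eq_sym -val_eqE in am.
by rewrite mulr0 scal0 rscale0r.
Qed.

Let g_out m : ~~ (i <= m < j)%N -> g (arcb m) = 0.
Proof. by move=> hm; rewrite arc_basis_out. Qed.

(** Scalars are central, so compatibility with z need only be checked on basis vectors. *)
Let g_gen z :
  (forall m, (i <= m < j)%N -> g (rscale (arcb m) z) = rscale (g (arcb m)) z) ->
  forall v, g (rscale v z) = rscale (g v) z.
Proof.
move=> h v; rewrite {2}[v]arc_decomp {1}[v]arc_decomp rscale_suml !(big_morph g gD g0).
rewrite rscale_suml; apply: eq_bigr => m _.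
rewrite -rscaleM scalC rscaleM !gZ -[in RHS]rscaleM scalC [in RHS]rscaleM; congr rscale.
have [hm|hm] := boolP (i <= m < j)%N; first exact: h.
by rewrite arc_basis_out // rscale0l g0 rscale0l.
Qed.

Let g_vtx a v : g (rscale v (vtx a)) = rscale (g v) (vtx a).
Proof.
apply: g_gen => m hm; rewrite arc_basis_vtx g_arcb // -rscaleM scalC rscaleM.
rewrite -{1}(Y_vtx hm) -(rscaleM (Y m)) vtxM.
case: eqP => _; last by rewrite g0 rscale0r rscale0l.
by rewrite Y_vtx // g_arcb.
Qed.

Let g_raise v : g (rscale v raise) = rscale (g v) raise.
Proof.
apply: g_gen => m hm; rewrite arc_basis_raise // gZ (g_arcb hm).
rewrite -(rscaleM (Y m)) scalC rscaleM.
have [mj|mj] := ltnP m.+1 j; last first.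
  have -> : m = j.-1 by lia.
  by rewrite Y_raise_last rscale0l g_out ?rscale0l //; lia.
have hm' : (i <= m.+1 < j)%N by lia.
have hm2 : (i < m.+1 < j)%N by lia.
have im : (i <= m)%N by lia.
rewrite g_arcb // Y_raise // -!rscaleM -!scalM lamS // /ratio.
congr (rscale _ (scal _)).
case: ifP => h; first by rewrite mulr1 mulrC.
have := BInv_cases hij hm2; rewrite h orbF => h'.
by have [_ ->] := down_pattern hm2 h'; rewrite mulr0 mul0r.
Qed.

Let g_lower v : g (rscale v lower) = rscale (g v) lower.
Proof.
apply: g_gen => m hm; rewrite g_arcb // -(rscaleM (Y m)) scalC rscaleM.
have [e|ne] := eqVneq m (nat_of_ord i).
  rewrite e Y_lower_first rscale0l -e; case: m hm e => [|m] hm e.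
    by rewrite arc_basis_lower0 g0.
  rewrite arc_basis_lower // gZ g_out ?rscale0l //.
  by rewrite -e; lia.
case: m hm ne => [|m] hm ne; first by lia.
have hm2 : (i < m.+1 < j)%N by lia.
have im : (i <= m)%N by lia.
have hm' : (i <= m < j)%N by lia.
have mj : (m.+1 < j)%N by lia.
rewrite arc_basis_lower // gZ g_arcb // Y_lower // -!rscaleM -!scalM lamS // /ratio.
congr (rscale _ (scal _)); case: ifP => h.
  have [_ ->] := up_pattern hm2 h; rewrite mul0r.
  by rewrite (_ : (_ < _)%N = false) ?mulr0 //; lia.
have := BInv_cases hij hm2; rewrite h orbF => h'.
have [l0 _] := down_pattern hm2 h'; rewrite h' mulr1 [RHS]mulrC -mulrA; congr (_ * _).
by rewrite divfK.
Qed.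

Let g_rscale v z : g (rscale v z) = rscale (g v) z.
Proof.
elim/preproj_ind: z v => [v|x y hx hy v|c x hx v|v|x a hx v|x hx v|x hx v].
- by rewrite !rscale0r g0.
- by rewrite !rscaleDr gD hx hy.
- by rewrite !rscaleM gZ hx.
- by rewrite !rscale1.
- by rewrite !rscaleM g_vtx hx.
- by rewrite !rscaleM g_raise hx.
- by rewrite !rscaleM g_lower hx.
Qed.

(** Serves both to embed B_e in Pi / I(w) and to compare B_e with an arbitrary candidate M.
    Injectivity holds because the idempotent at m isolates the m-th term of [g v], whose scalar lam
    m is nonzero. *)
Lemma arc_hom : exists G : {linear B -> M}, injective G /\
  forall m, (i <= m < j)%N -> exists v, G v = Y m.
Proof.
have gl : linear g by move=> a x y; rewrite gD -[a *: x]/(rscale x a) g_rscale.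
have [G eG] := linear_of gl; exists G; split=> [|m hm].
  apply: raddf_inj => v e'; have {e'}e : g v = 0 by rewrite -eG.
  rewrite [v]arc_decomp big1 // => m _.
  have [hm|hm] := boolP (i <= m < j)%N; last by rewrite arc_basis_out // rscale0l.
  have gv : rscale (g v) (vtx m) = rscale (Y m) (scal (lam m * arc_coord v m)).
    rewrite /g rscale_suml (bigD1 m) //= big1 ?addr0 => [|a /andP[ha am]].
      by rewrite -rscaleM scalC rscaleM Y_vtx.
    rewrite -rscaleM scalC rscaleM -(Y_vtx ha) -(rscaleM _ (vtx a)) vtxM.
    by rewrite val_eqE (negbTE am) rscale0r rscale0l.
  rewrite e rscale0l in gv; have := scal_inj0 (Y_neq0 hm) (esym gv).
  move/eqP; rewrite mulf_eq0 (negbTE (lam_neq0 hm)) => /eqP ->.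
  by rewrite scal0 rscale0r.
exists (rscale (arcb m) (scal (lam m)^-1)).
rewrite eG gZ g_arcb // -rscaleM -scalM divff ?scal1 ?rscale1 //.
exact: lam_neq0.
Qed.

End ArcHom.

(** * The embedding of B_e in Pi / I(w) *)

Section ArcEmbedding.
Variables (k : fieldType) (n : nat) (o : 'I_n.-1 -> bool).
Variables (w : 'S_n.+1) (u : seq 'I_n) (hw : reduced_expr w u).
Variables (i j : 'I_n.+1) (hij : BInv w i j).
Local Notation Q := (quiverA o).
Local Notation Pi := (preproj k Q).
Local Notation vtx := (vtx k o).
Local Notation raise := (raise k o).
Local Notation lower := (lower k o).
Local Notation scal := (@scal k n o).
Local Notation mono := (mono k o).
Local Notation B := (arc_module k o hij).
Local Notation PiW := (@preproj_quot k Q u).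
Local Notation to_PiW := (@to_PiW k n o u).
Local Notation pos t := (letter_pos w (inord t)).

Lemma bcoef_mono (d y x : nat) : (x <= d)%N -> (d + y < n)%N ->
  bcoef (mono d y x) d x (d + y) = 1.
Proof.
elim: x => [|x IH] xd yn; last first.
  by rewrite -mono_lower bcoef_lower xd IH // ltnW.
elim: y yn => [|y IH] yn; last first.
  by rewrite -mono_raise addnS bcoef_raise -addnS yn IH //; lia.
rewrite monoE !expr0 !mulr1 -[vtx d]mul1r bcoef_vtx addn0 subn0 eqxx bcoef1.
by rewrite !eqxx /= (_ : (d < n)%N) //; lia.
Qed.

Lemma to_PiW_mono0 (d y x : nat) : (d < n)%N -> ~~ below w d x (d + y) ->
  to_PiW (mono d y x) = 0 :> PiW.
Proof.
move=> dn h; rewrite -to_PiW0; apply/to_PiW_eq; rewrite subr0.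
exact: (@mono_word_ideal k n o u w (Ordinal dn) y x hw h).
Qed.

(* The basis vector at the vertex m goes to the last box at m in row c that is
   not in I(w). *)
Let c : nat := pos j.
Let x m : nat := (cnt w c m.+1).-1.
Let Y m : PiW := to_PiW (mono c (m + x m - c) (x m)).

Let ij : (i < j)%N. Proof. by case/and3P: hij. Qed.
Let ci : (c < pos i)%N. Proof. by rewrite /c !inord_val; case/and3P: hij. Qed.
Let cn : (c < n)%N. Proof. by have := ltn_ord (pos i); lia. Qed.

Let cnt_mono d s t : (s <= t)%N -> (cnt w d t <= cnt w d s <= cnt w d t + (t - s))%N.
Proof.
move=> /subnK <-; elim: (t - s)%N => [|r IH]; first by rewrite add0n; lia.
by have := cnt_step w d (r + s); rewrite addSn; lia.
Qed.

(** The letter j is counted in row c, so some box at m survives. The letter i is not counted, which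
    gains one in [cnt_ge] and yields c <= m + x m, so that the exponent m + x m - c is not
    truncated. *)
Let bounds m : (i <= m < j)%N ->
  [/\ cnt w c m.+1 = (x m).+1, (x m <= c)%N, (c <= m + x m)%N & (m + x m < n)%N].
Proof.
move=> hm; have jn := ltn_ord j.
have h1 := cnt_mono c (_ : m.+1 <= j)%N; have {}h1 := h1 ltac:(lia).
have h2 := @cntS_nat n w c j ltac:(lia); rewrite leqnn in h2.
have h3 := @cnt_le n w c m.+1 ltac:(lia).
have h4 := cnt_le_out w c m.+1.
have h5 := @cnt_ge n w c i ltac:(lia).
have h6 := @cntS_nat n w c i ltac:(lia).
rewrite (_ : (_ <= _)%N = false) in h6; last by lia.
have h7 := cnt_mono c (_ : i.+1 <= m.+1)%N; have {}h7 := h7 ltac:(lia).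
rewrite /x; split; lia.
Qed.

(** No inner letter lies between j and i, so being counted in row c = pos j is the same as being to
    the left of j. *)
Let cnt_letter m : (i < m < j)%N ->
  (pos i < pos m)%N /\ cnt w c m = cnt w c m.+1 \/
  [/\ (pos m < pos j)%N, ~~ (pos i < pos m)%N & cnt w c m = (cnt w c m.+1).+1].
Proof.
move=> hm; have jn := ltn_ord j; have h := @cntS_nat n w c m ltac:(lia).
have := BInv_cases hij hm => /orP[h1|h1]; last first.
  by left; split=> //; rewrite h (_ : (_ <= _)%N = false) //; lia.
by right; split=> //; first lia; rewrite h (_ : (_ <= _)%N) //; lia.
Qed.

Lemma arc_embedding : exists G : {linear B -> PiW}, injective G.
Proof.
have jn := ltn_ord j.
(* No orientation signs appear here; [arc_hom] absorbs those of B_e by rescaling. *)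
pose r m : k := (pos i < pos m)%N%:R; pose l m : k := (pos m < pos j)%N%:R.
have [||||||||G [Gi _]] := @arc_hom k n o w i j hij PiW Y r l; last by exists G.
- move=> m hm; have [h1 h2 h3 h4] := bounds hm.
  have b : below w c (x m) (m + x m).
    by rewrite /below (_ : (m + x m).+1 - x m = m.+1)%N ?h1 //; lia.
  apply/eqP => e; have := @qcoef0 k n o w u hw _ _ _ b; rewrite -e.
  have := @qcoefE k n o w u hw (mono c (m + x m - c) (x m)) _ _ _ b.
  rewrite -/(Y m) => ->; rewrite -{2}(subnKC h3) bcoef_mono //.
    by move/eqP; rewrite oner_eq0.
  by rewrite subnKC.
- move=> m hm; have [h1 h2 h3 h4] := bounds hm.
  by rewrite to_PiW_rscale mono_vtx subnKC ?addnK ?eqxx //; lia.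
- move=> m im mj; rewrite to_PiW_rscale mono_raise.
  have [h1 h2 h3 h4] := bounds (ltac:(lia) : (i <= m < j)%N).
  have [g1 g2 g3 g4] := bounds (ltac:(lia) : (i <= m.+1 < j)%N).
  case: (cnt_letter (ltac:(lia) : (i < m.+1 < j)%N)) => [[hp e]|[_ /negbTE hp e]].
    have xm : x m.+1 = x m by lia.
    rewrite /r hp scal1 rscale1 /Y xm (_ : (m + x m - c).+1 = m.+1 + x m - c)%N //.
    by lia.
  rewrite /r hp scal0 rscale0r to_PiW_mono0 // /below.
  by rewrite (_ : (c + (m + x m - c).+1).+1 - x m = m.+2)%N; lia.
(* The count drops at j, so raising the last box at j - 1 leaves the diagram. *)
- have hm : (i <= j.-1 < j)%N by lia.
  have [h1 h2 h3 h4] := bounds hm; have jK : j.-1.+1 = j by lia.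
  have h := @cntS_nat n w c j ltac:(lia); rewrite leqnn in h.
  rewrite to_PiW_rscale mono_raise to_PiW_mono0 // /below.
  rewrite (_ : (c + (j.-1 + x j.-1 - c).+1).+1 - x j.-1 = j.+1)%N; last by lia.
  by rewrite jK in h1; lia.
- move=> m im mj; rewrite to_PiW_rscale mono_lower.
  have [h1 h2 h3 h4] := bounds (ltac:(lia) : (i <= m < j)%N).
  have [g1 g2 g3 g4] := bounds (ltac:(lia) : (i <= m.+1 < j)%N).
  case: (cnt_letter (ltac:(lia) : (i < m.+1 < j)%N)) => [[hp e]|[hp _ e]].
    rewrite /l (_ : (_ < _)%N = false); last by lia.
    rewrite scal0 rscale0r to_PiW_mono0 // /below.
    by rewrite (_ : (c + (m.+1 + x m.+1 - c)).+1 - (x m.+1).+1 = m.+1)%N; lia.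
  have xm : x m = (x m.+1).+1 by lia.
  rewrite /l hp scal1 rscale1 /Y xm (_ : m.+1 + x m.+1 - c = m + (x m.+1).+1 - c)%N //.
  by lia.
(* The count does not grow at i, so lowering the last box at i leaves the diagram. *)
- have hm : (i <= i < j)%N by lia.
  have [h1 h2 h3 h4] := bounds hm.
  have h := @cntS_nat n w c i ltac:(lia).
  rewrite (_ : (_ <= _)%N = false) in h; last by lia.
  rewrite to_PiW_rscale mono_lower to_PiW_mono0 // /below.
  rewrite (_ : (c + (i + x i - c)).+1 - (x i).+1 = i)%N; last by lia.
  by lia.
- move=> m hm hp; rewrite /r /l hp (_ : (_ < _)%N = false) ?oner_neq0 //.
  by apply/negP => hp'; lia.
- move=> m hm hp; rewrite /r /l hp (_ : (_ < _)%N = false) ?oner_neq0 //.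
  by apply/negP => hp'; lia.
Qed.

Lemma arc_fin_gen : fin_gen B.
Proof.
exists n, (arc_basis k o hij) => v; exists (fun t => scal (arc_coord v t)).
exact: arc_decomp.
Qed.

End ArcEmbedding.

(** * Roots and dimension vectors *)

Section SimpleRoots.
Variable n : nat.

(** The fundamental coweight: it reads off the coefficient of the simple root a. *)
Let psum (a : nat) (v : 'rV[int]_n.+1) : int := \sum_(t < n.+1 | (t <= a)%N) v 0 t.

Let psum_root a (i j : 'I_n.+1) : psum a (rootA i j) = (i <= a)%N%:R - (j <= a)%N%:R.
Proof.
have pe (l : 'I_n.+1) : \sum_(t < n.+1 | (t <= a)%N) eps l 0 t = (l <= a)%N%:R.
  rewrite big_mkcond (bigD1 l) //= big1 ?addr0 => [|t tl].
    by rewrite /eps mxE !eqxx; case: ifP.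
  by rewrite /eps mxE (negbTE tl) andbF if_same.
by rewrite -!pe /psum -sumrB; apply: eq_bigr => t _; rewrite !mxE.
Qed.

Let psum_simple a (b : 'I_n) : psum a (simple_root b) = (b == a :> nat)%:R.
Proof.
rewrite psum_root /= /bump /= add1n leq_eqVlt.
by have [e|ne] := eqVneq (b : nat) a; rewrite ?e ?ltnn ?subr0 //= subrr.
Qed.

Lemma root_simple_coord (i j : 'I_n.+1) (d : 'I_n -> nat) : (i < j)%N ->
  rootA i j = \sum_a simple_root a *+ d a -> forall a, d a = (i <= a < j)%N.
Proof.
move=> ij e a; have : psum a (rootA i j) = (d a)%:R.
  rewrite e /psum; under eq_bigr do rewrite summxE.
  rewrite exchange_big (bigD1 a) //= [X in _ + X]big1 ?addr0 => [|b ba].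
    under eq_bigr do rewrite mulmxnE.
    by rewrite sumrMnl -/(psum a _) psum_simple eqxx.
  under eq_bigr do rewrite mulmxnE.
  by rewrite sumrMnl -/(psum a _) psum_simple val_eqE (negbTE ba) mul0rn.
rewrite psum_root => h.
by move: h; case: (leqP i a); case: (leqP j a) => /= *; lia.
Qed.

Lemma root_sum_simple (i j : 'I_n.+1) : (i < j)%N ->
  rootA i j = \sum_a simple_root a *+ (i <= a < j)%N.
Proof.
move=> ij; pose f t : 'rV[int]_n.+1 := - eps (inord t).
have -> : rootA i j = f j - f i by rewrite /f opprK !inord_val addrC.
rewrite -telescope_sumr ?(ltnW ij) //.
rewrite (big_nat_widen _ _ n) /= ?big_mkord; last by rewrite -ltnS ltn_ord.
rewrite (big_nat_widenl _ 0) // big_mkord big_mkcond; apply: eq_bigr => a _.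
rewrite andbC; case: ifP => _; last by rewrite mulr0n.
rewrite mulr1n /f /simple_root /rootA opprK addrC; congr (eps _ - eps _);
  by apply: val_inj; rewrite /= inordK //; have := ltn_ord a; lia.
Qed.

End SimpleRoots.

Section Dimensions.
Variables (k : fieldType) (n : nat) (o : 'I_n.-1 -> bool).
Local Notation Q := (quiverA o).
Local Notation Pi := (preproj k Q).
Local Notation vtx := (vtx k o).
Local Notation scal := (@scal k n o).
Variable M : lmodType Pi^c.

Lemma has_dim_atE (a : 'I_n) m :
  @has_dim_at k Q M a m <-> exists b : 'I_m -> M,
    [/\ forall t, rscale (b t) (vtx a) = b t,
        forall v : M, rscale v (vtx a) = v ->
          exists c : 'I_m -> k, v = \sum_t rscale (b t) (scal (c t))
      & forall c : 'I_m -> k, \sum_t rscale (b t) (scal (c t)) = 0 ->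
          forall t, c t = 0].
Proof.
have -> : scal = @kscalar k Q by apply/funext => c; rewrite scalE.
rewrite vtxE.
exact: iff_refl.
Qed.

Lemma has_dim_at0 (a : 'I_n) :
  @has_dim_at k Q M a 0 <-> forall v : M, rscale v (vtx a) = v -> v = 0.
Proof.
split=> [/has_dim_atE[b [_ h _]] v /h [c ->]|h]; first by rewrite big_ord0.
apply/has_dim_atE; exists (fun=> 0); split=> [[]//|v /h ->|c _ []//].
by exists (fun=> 0); rewrite big_ord0.
Qed.

Lemma has_dim_at1 (a : 'I_n) :
  @has_dim_at k Q M a 1 <-> exists y : M, [/\ y != 0, rscale y (vtx a) = y &
    forall v : M, rscale v (vtx a) = v -> exists c, v = rscale y (scal c)].
Proof.
split=> [/has_dim_atE[b [h1 h2 h3]]|[y [y0 yv yc]]].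
  exists (b ord0); split=> // [|v /h2[c ->]]; last first.
    by exists (c ord0); rewrite big_ord1.
  apply/eqP => b0; have := h3 (fun=> 1); rewrite big_ord1 b0 rscale0l.
  by move=> /(_ erefl ord0) /eqP; rewrite oner_eq0.
apply/has_dim_atE; exists (fun=> y); split=> [//|v /yc[c ->]|c].
  by exists (fun=> c); rewrite big_ord1.
rewrite big_ord1 => e t; rewrite (ord1 t).
exact: scal_inj0 y0 e.
Qed.

End Dimensions.

(** * Simplicity of B_e *)

Section ArcSimple.
Variables (k : fieldType) (n : nat) (o : 'I_n.-1 -> bool).
Variables (w : 'S_n.+1) (u : seq 'I_n) (hw : reduced_expr w u).
Variables (i j : 'I_n.+1) (hij : BInv w i j).
Local Notation Q := (quiverA o).
Local Notation Pi := (preproj k Q).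
Local Notation vtx := (vtx k o).
Local Notation raise := (raise k o).
Local Notation lower := (lower k o).
Local Notation scal := (@scal k n o).
Local Notation B := (arc_module k o hij).
Local Notation arcb := (arc_basis k o hij).
Local Notation pos t := (letter_pos w (inord t)).

Let ij : (i < j)%N. Proof. by case/and3P: hij. Qed.
Let pji : (pos j < pos i)%N. Proof. by rewrite !inord_val; case/and3P: hij. Qed.

Lemma arc_dim_vector : has_dim_vector B (rootA i j).
Proof.
exists (fun a => (i <= a < j)%N); split; last exact: root_sum_simple.
move=> a; have coord v : rscale v (vtx a) = rscale (arcb a) (scal (arc_coord v a)).
  rewrite {1}[v]arc_decomp rscale_suml (bigD1 a) //= big1 ?addr0 => [|b ba].
    by rewrite -rscaleM scalC rscaleM arc_basis_vtx eqxx.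
  by rewrite -rscaleM scalC rscaleM arc_basis_vtx val_eqE (negbTE ba) rscale0l.
have [ha|ha] := boolP (i <= a < j)%N.
  apply/has_dim_at1; exists (arcb a); rewrite arc_basis_vtx eqxx arc_basis_neq0 //.
  by split=> // v ev; exists (arc_coord v a); rewrite -coord.
by apply/has_dim_at0 => v <-; rewrite coord arc_basis_out // rscale0l.
Qed.

Lemma arc_torsion_free : torsion_free (k := k) (o := o) u B.
Proof.
have [G Gi] := arc_embedding k o hw hij.
exact: in_Sub_inj (arc_fin_gen k o hij) Gi.
Qed.

(* [p, q) is a connected component of the set of vertices where the quotient is
   nonzero; it gives a chain in the quotient with pos p < pos q. *)
Lemma arc_no_torsion_free_quotient (L : submodClosed B) (v v' : B) :
  v \in L -> v != 0 -> v' \notin L ->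
  ~ cogenerated u (mod_quot L).
Proof.
move=> vL v0 v'L cog.
have LZ x z : x \in L -> rscale x z \in L by move=> xL; apply: rpredZ.
(* L is stable under idempotents and scalars and B_e is thin, so L contains each basis vector
   occurring in one of its elements. *)
have Lcoord x m : x \in L -> arc_coord x m != 0 -> (m < n)%N -> arcb m \in L.
  move=> xL c0 mn; have := LZ _ (vtx m * scal (arc_coord x m)^-1) xL.
  rewrite rscaleM {1}[x]arc_decomp rscale_suml.
  rewrite (bigD1 (Ordinal mn)) //= big1 ?addr0 => [|b]; last first.
    rewrite -val_eqE /= => /negbTE bm.
    by rewrite -rscaleM scalC rscaleM arc_basis_vtx bm rscale0l.
  rewrite -(rscaleM (arcb m)) scalC rscaleM arc_basis_vtx eqxx -rscaleM -scalM.
  by rewrite divff // scal1 rscale1.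
have [m0 m0r m0L] : exists2 m, (i <= m < j)%N & arcb m \in L.
  apply: contrapT => no; case/eqP: v0; rewrite [v]arc_decomp big1 // => m _.
  have [hm|hm] := boolP (i <= m < j)%N; last by rewrite arc_basis_out // rscale0l.
  have [->|c0] := eqVneq (arc_coord v m) 0; first by rewrite scal0 rscale0r.
  by case: no; exists m => //; apply: Lcoord vL c0 _.
have ex1 : exists m, (i <= m < j)%N && (arcb m \notin L).
  apply: contrapT => no; case/negP: v'L; rewrite [v']arc_decomp.
  apply: rpred_sum => m _; apply: LZ.
  have [hm|hm] := boolP (i <= m < j)%N; last by rewrite arc_basis_out ?rpred0.
  by apply: contrapT => /negP h; apply: no; exists m; rewrite hm.
case: (ex_minnP ex1) => p /andP[pr pL] pmin.
(* Allowing m = j lets the run of vertices outside L that starts at p extend to the end of the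
   arc. *)
have ex2 : exists m, (p < m <= j)%N && ((m == j :> nat) || (arcb m \in L)).
  by exists j; rewrite eqxx /= leqnn; lia.
case: (ex_minnP ex2) => q /andP[qr qL] qmin.
have inU m : (p <= m < q)%N -> arcb m \notin L.
  move=> hm; have [->//|mp] := eqVneq m p.
  apply/negP => h; have := qmin m; rewrite h orbT andbT; lia.
have [P [S [SK PZ PE]]] := mod_quot_proj L.
have P0 x : (P x = 0) <-> (x \in L).
  have e0 : P 0 = 0 by rewrite -(scale0r 0) -PZ scale0r.
  by rewrite -[x in _ <-> (x \in L)]subr0 -e0; apply: PE.
have PR x z : rscale (P x) z = P (rscale x z) by apply: PZ.
have qLz : P (arcb q) = 0.
  apply/P0; case/orP: qL => [/eqP ->|//]; rewrite arc_basis_out ?rpred0 //; lia.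
have pLz m : p = m.+1 -> P (arcb m) = 0.
  move=> e; apply/P0; apply: contrapT => /negP h; have := pmin m; rewrite h andbT.
  have [hm|hm] := boolP (i <= m < j)%N; first by lia.
  by case/negP: h; rewrite arc_basis_out ?rpred0.
have inv : (pos q < pos p)%N.
  apply: (@chain_inversion k n o w u hw (mod_quot L) (fun m => P (arcb m))
    (fun m => (pos i < pos m)%N%:R)
    (fun m => edge_sign k o m * (pos m < pos j)%N%:R) p q cog).
  - by lia.
  - by have := ltn_ord j; lia.
  - move=> m hm; split; last by rewrite PR arc_basis_vtx eqxx.
    by apply/eqP => /P0 h; case/negP: (inU m hm).
  - by move=> m pm mq; rewrite !PR arc_basis_raise //; lia.
  - have qK : q.-1.+1 = q by lia.
    by rewrite PR arc_basis_raise ?qK -?PR ?qLz ?rscale0l //; lia.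
  - by move=> m pm mq; rewrite !PR arc_basis_lower //; lia.
  - case: p pLz {pL pmin ex2 qr qmin inU} pr => [|m] pLz pr.
      by rewrite PR arc_basis_lower0; apply/P0; apply: rpred0.
    by rewrite PR arc_basis_lower // -PR (pLz m) // rscale0l.
(* Here [arcb] at p - 1 lies in L, so an arrow p - 1 -> p would force [arcb p] into L. *)
have pi : p != i :> nat -> (pos p < pos j)%N.
  move=> ne; have := BInv_cases hij (ltac:(lia) : (i < p < j)%N) => /orP[//|h].
  case: p pL pLz pr ne h {pmin ex2 qr qmin inU inv} => [|m] pL pLz pr ne h;
    first by lia.
  case/negP: pL; apply/P0.
  have := arc_basis_raise k o hij (ltac:(lia) : (i <= m < j)%N).
  by rewrite h scal1 rscale1 => <-; rewrite -PR pLz // rscale0l.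
(* Dually, [arcb q] lies in L, so an arrow q -> q - 1 would force [arcb] at q - 1 into L. *)
have qi : q != j :> nat -> (pos i < pos q)%N.
  move=> ne; have := BInv_cases hij (ltac:(lia) : (i < q < j)%N) => /orP[h|//].
  have qK : q.-1.+1 = q by lia.
  case/negP: (inU q.-1 ltac:(lia)); apply/P0.
  have := arc_basis_lower k o hij (ltac:(lia) : (i <= q.-1.+1 < j)%N).
  rewrite qK h mulr1 => e.
  have : P (rscale (arcb q) lower) = 0 by rewrite -PR qLz rscale0l.
  rewrite e -PR => e'; apply/eqP; apply: contraNT (edge_sign_neq0 k o q) => h0.
  by apply/eqP; apply: scal_inj0 h0 e'.
(* If [p, q) is the whole arc, L contains no basis vector, against m0. Otherwise [pi], [qi] and pos
   j < pos i give pos p < pos q, against [inv]. *)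
have [ep|np] := eqVneq p (i : nat); have [eq_|nq] := eqVneq q (j : nat).
- by case/negP: (inU m0 ltac:(lia)).
- by have := qi nq; rewrite ep in inv; lia.
- by have := pi np; rewrite eq_ in inv; lia.
by have := pi np; have := qi nq; lia.
Qed.

Lemma arc_simple : is_simple_object (torsion_free (k := k) (o := o) u) B.
Proof.
split; first exact: arc_torsion_free.
  by exists (arcb i); apply: arc_basis_neq0; lia.
case=> L [[v vL v0] [v' v'L] _ FQ].
apply: (arc_no_torsion_free_quotient vL v0 v'L).
exact: in_Sub_separated FQ.
Qed.

End ArcSimple.

(** * Uniqueness of B_e *)

Section ArcUnique.
Variables (k : fieldType) (n : nat) (o : 'I_n.-1 -> bool).
Variables (w : 'S_n.+1) (u : seq 'I_n) (hw : reduced_expr w u).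
Variables (i j : 'I_n.+1) (hij : BInv w i j).
Local Notation Q := (quiverA o).
Local Notation Pi := (preproj k Q).
Local Notation vtx := (vtx k o).
Local Notation raise := (raise k o).
Local Notation lower := (lower k o).
Local Notation scal := (@scal k n o).
Local Notation B := (arc_module k o hij).
Local Notation pos t := (letter_pos w (inord t)).

Let ij : (i < j)%N. Proof. by case/and3P: hij. Qed.
Let pji : (pos j < pos i)%N. Proof. by rewrite !inord_val; case/and3P: hij. Qed.

(** The dimension vector gives M a line at each vertex of [i, j), so generators Y m of these lines
    form a chain with scalars r and l. [chain_inversion] makes the scalar prescribed by the letter m
    nonzero, [chain_scal0] makes the other one zero, and [arc_hom] then applies. *)
Lemma arc_unique (M : lmodType Pi^c) :
  cogenerated u M -> has_dim_vector M (rootA i j) -> isomorphic M B.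
Proof.
move=> cog [d [hd /(root_simple_coord ij) ed]]; have jn := ltn_ord j.
have out m v : ~~ (i <= m < j)%N -> rscale v (vtx m) = v -> v = 0 :> M.
  move=> hm; have [mn|mn] := ltnP m n; last by rewrite vtx_out // rscale0r.
  have := hd (Ordinal mn); rewrite ed /= (negbTE hm) => /has_dim_at0; exact.
have /choice [Y hY] : forall m, exists y : M, (i <= m < j)%N ->
    [/\ y != 0, rscale y (vtx m) = y &
        forall v : M, rscale v (vtx m) = v -> exists c, v = rscale y (scal c)].
  move=> m; have [hm|hm] := boolP (i <= m < j)%N; last by exists 0.
  have := hd (Ordinal (range_lt hm)); rewrite ed /= hm => /has_dim_at1[y hy].
  by exists y.
have Yup m : (i <= m < j)%N ->
    rscale (rscale (Y m) raise) (vtx m.+1) = rscale (Y m) raise.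
  by move=> hm; have [_ e _] := hY m hm; rewrite -rscaleM -vtx_raise rscaleM e.
have Ydown m : (i <= m.+1 < j)%N ->
    rscale (rscale (Y m.+1) lower) (vtx m) = rscale (Y m.+1) lower.
  by move=> hm; have [_ e _] := hY _ hm; rewrite -rscaleM -vtx_lower rscaleM e.
(* The scalars for the edge between the vertices m - 1 and m are indexed by the letter m separating
   them. *)
have /choice [r hr] : forall m, exists c, (i < m < j)%N ->
    rscale (Y m.-1) raise = rscale (Y m) (scal c).
  case=> [|m]; first by exists 0; rewrite ltn0.
  have [hm|hm] := boolP (i < m.+1 < j)%N; last by exists 0.
  have [_ _ h] := hY m.+1 ltac:(lia); have [c ec] := h _ (Yup m ltac:(lia)).
  by exists c.
have /choice [l hl] : forall m, exists c, (i < m < j)%N ->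
    rscale (Y m) lower = rscale (Y m.-1) (scal c).
  case=> [|m]; first by exists 0; rewrite ltn0.
  have [hm|hm] := boolP (i < m.+1 < j)%N; last by exists 0.
  have [_ _ h] := hY m ltac:(lia); have [c ec] := h _ (Ydown m ltac:(lia)).
  by exists c.
have Y0 m : (i <= m < j)%N -> Y m != 0 by case/hY.
have Yv m : (i <= m < j)%N -> rscale (Y m) (vtx m) = Y m by case/hY.
have Yr m : (i <= m)%N -> (m.+1 < j)%N ->
    rscale (Y m) raise = rscale (Y m.+1) (scal (r m.+1)).
  by move=> im mj; apply: (hr m.+1); lia.
have Yl m : (i <= m)%N -> (m.+1 < j)%N ->
    rscale (Y m.+1) lower = rscale (Y m) (scal (l m.+1)).
  by move=> im mj; apply: (hl m.+1); lia.
have Yr_last : rscale (Y j.-1) raise = 0.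
  by apply: (out j.-1.+1) (Yup j.-1 ltac:(lia)); lia.
have Yl_first : rscale (Y i) lower = 0.
  case ei: (nat_of_ord i) => [|m].
    rewrite -(Yv 0%N ltac:(lia)) -rscaleM vtx0_lower; exact: rscale0r.
  by apply: (out m) (Ydown m ltac:(lia)); lia.
have sub a b : (i <= a)%N -> (a < b)%N -> (b <= j)%N ->
    rscale (Y b.-1) raise = 0 -> rscale (Y a) lower = 0 -> (pos b < pos a)%N.
  move=> ia ab bj h1 h2.
  apply: (@chain_inversion k n o w u hw M Y r l a b cog ab _ _ _ h1 _ h2); try lia.
  - by move=> m hm; split; [apply: Y0 | apply: Yv]; lia.
  - by move=> m h h'; apply: Yr; lia.
  - by move=> m h h'; apply: Yl; lia.
have rl0 m : (i < m < j)%N -> r m * l m = 0.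
  case: m => [|m] hm; first by lia.
  by apply: (chain_scal0 Y0 Yr Yl Yl_first); lia.
(* If r m = 0, then [i, m) is a chain of its own, which puts m to the left of i. *)
have r_neq0 m : (i < m < j)%N -> (pos i < pos m)%N -> r m != 0.
  case: m => [|m] hm hp; first by lia.
  apply/eqP => r0; have := sub i m.+1 ltac:(lia) ltac:(lia) ltac:(lia).
  rewrite /= Yr ?r0 ?scal0 ?rscale0r //; try lia.
  by move=> /(_ erefl Yl_first); lia.
(* If l m = 0, then [m, j) is a chain of its own, which puts j to the left of m. *)
have l_neq0 m : (i < m < j)%N -> (pos m < pos j)%N -> l m != 0.
  case: m => [|m] hm hp; first by lia.
  apply/eqP => l0; have := sub m.+1 j ltac:(lia) ltac:(lia) ltac:(lia) Yr_last.
  rewrite Yl ?l0 ?scal0 ?rscale0r //; try lia.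
  by move=> /(_ erefl); lia.
have [||G [Gi GY]] := @arc_hom k n o w i j hij M Y r l Y0 Yv Yr Yr_last Yl Yl_first.
- move=> m hm hp; have r0 := r_neq0 m hm hp; split=> //.
  by move/eqP: (rl0 m hm); rewrite mulf_eq0 (negbTE r0) => /eqP.
- move=> m hm hp; have l0 := l_neq0 m hm hp; split=> //.
  by move/eqP: (rl0 m hm); rewrite mulf_eq0 (negbTE l0) orbF => /eqP.
apply: isomorphic_of_bij Gi _ => v.
(* Surjectivity is checked vertex by vertex, v being the sum of its components v e_m. *)
have comp m : exists y, G y = rscale v (vtx m).
  have vv : rscale (rscale v (vtx m)) (vtx m) = rscale v (vtx m).
    by rewrite -rscaleM vtxM eqxx.
  have [hm|hm] := boolP (i <= m < j)%N; last first.
    by exists 0; rewrite linear0 (out m _ hm vv).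
  have [_ _ h] := hY m hm; have [c ->] := h _ vv; have [y <-] := GY m hm.
  by exists (rscale y (scal c)); rewrite rscale_linear.
have [y hy] := choice comp; exists (\sum_(m < n) y m).
rewrite linear_sum; under eq_bigr do rewrite hy.
by rewrite -rscale_sumr sum_vtx rscale1.
Qed.

End ArcUnique.

Theorem propositionA4 (k : fieldType) (n : nat) (o : 'I_n.-1 -> bool)
    (w : 'S_n.+1) (u : seq 'I_n) (hu : reduced_expr w u)
    (i j : 'I_n.+1) (hij : BInv w i j) :
  [/\ is_simple_object (torsion_free (k := k) (o := o) u) (arc_module k o hij),
      has_dim_vector (arc_module k o hij) (rootA i j)
    & forall M : lmodType (preproj k (quiverA o))^c,
        is_simple_object (torsion_free (k := k) (o := o) u) M ->
        has_dim_vector M (rootA i j) ->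
        isomorphic M (arc_module k o hij)].
Proof.
split; [exact: arc_simple | exact: arc_dim_vector | move=> M [FM _ _] dM].
by apply: (arc_unique hu hij _ dM); apply: in_Sub_separated FM.
Qed.
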